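(* Let $n\ge 1$, let $\tau\in\mathbb{C}$ with $\mathrm{Im}(\tau)>0$ and let $B\in \mathrm{GL}_n(\mathbb{C})$. For $(v,y)\in(\mathbb{C}\setminus\Sigma_B)\times(\mathbb{C}\setminus\Lambda)$ let $r_B(v,y)\in \mathrm{Mat}_{n\times n}(\mathbb{C})\otimes \mathrm{Mat}_{n\times n}(\mathbb{C})$ be the tensor constructed in the context. (1) The function $(\mathbb{C}\setminus\Sigma_B)\times(\mathbb{C}\setminus\Lambda)\to \mathrm{Mat}_{n\times n}(\mathbb{C})\otimes \mathrm{Mat}_{n\times n}(\mathbb{C})$, $(v,y)\mapsto r_B(v,y)$, is a non-degenerate holomorphic unitary solution of the associative Yang--Baxter equation (AYBE). Moreover, this function is meromorphic on $\mathbb{C}\times\mathbb{C}$. (2) Let $S\in \mathrm{GL}_n(\mathbb{C})$ and $A=S^{-1}BS$. Then for any $(v,y)\in(\mathbb{C}\setminus\Sigma_B)\times(\mathbb{C}\setminus\Lambda)$ one has $$r_A(v,y)=(S^{-1}\otimes S^{-1})\,r_B(v,y)\,(S\otimes S).$$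
   Context: $\Lambda=\mathbb{Z}+\tau\mathbb{Z}$, and $\Sigma_B=\{\lambda-\lambda' : \exp(2\pi i\lambda),\exp(2\pi i\lambda')\text{ are eigenvalues of }B\}+\Lambda\subset\mathbb{C}$. Let $\bar\theta(z)=\sum_{m\in\mathbb{Z}}\exp(\pi i m^2\tau+2\pi i m z)$ (third Jacobian theta function). Construction of $r_B$. For $v\in\mathbb{C}$ let $e(z)=-\exp(-2\pi i(z+v+\tau))$ and let $\mathrm{Sol}_{B,v,\tau}$ be the complex vector space of holomorphic functions $\Phi:\mathbb{C}\to \mathrm{Mat}_{n\times n}(\mathbb{C})$ with $\Phi(z+1)=\Phi(z)$ and $\Phi(z+\tau)B=e(z)B\Phi(z)$. Let $\mathrm{res}_0:\mathrm{Sol}_{B,v,\tau}\to \mathrm{Mat}_{n\times n}(\mathbb{C})$, $\Phi\mapsto\Phi(0)$, which is an isomorphism if $v\notin\Sigma_B$; and for $y\in\mathbb{C}\setminus\Lambda$ let $\mathrm{ev}_y:\mathrm{Sol}_{B,v,\tau}\to \mathrm{Mat}_{n\times n}(\mathbb{C})$, $\Phi\mapsto\frac{1}{\bar\theta(y+\frac{\tau+1}{2})}\Phi(y)$. Put $\tilde r_B(v,y)=\mathrm{ev}_y\circ \mathrm{res}_0^{-1}$, and let $r_B(v,y)$ be the tensor corresponding to $\tilde r_B(v,y)$ under the isomorphism $\mathrm{Mat}_{n\times n}(\mathbb{C})\otimes \mathrm{Mat}_{n\times n}(\mathbb{C})\to \mathrm{Hom}_{\mathbb{C}}(\mathrm{Mat}_{n\times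 n}(\mathbb{C}),\mathrm{Mat}_{n\times n}(\mathbb{C}))$, $X\otimes Y\mapsto(Z\mapsto \mathrm{Tr}(XZ)Y)$. AYBE: with $A=\mathrm{Mat}_{n\times n}(\mathbb{C})$, $r$ is a solution if $$r^{12}(u,x)\,r^{23}(u+v,y)=r^{13}(u+v,x+y)\,r^{12}(-v,x)+r^{23}(v,y)\,r^{13}(u,x+y)$$ for all $u,v,x,y$ for which all terms are defined, where $r^{12},r^{23},r^{13}$ are obtained by composing $r$ with $a\otimes b\mapsto a\otimes b\otimes 1$, $a\otimes b\mapsto 1\otimes a\otimes b$, $a\otimes b\mapsto a\otimes 1\otimes b$. Unitary: $r(-u,-x)=-\rho(r(u,x))$ with $\rho(a\otimes b)=b\otimes a$. Non-degenerate: for generic $(v,y)$ the linear map $\mathrm{Mat}_{n\times n}(\mathbb{C})\to \mathrm{Mat}_{n\times n}(\mathbb{C})$ corresponding to $r(v,y)$ is an isomorphism. *)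

(* Defs.v *)
From HB Require Import structures.
From mathcomp Require Import all_boot all_order all_algebra.
From mathcomp Require Import complex mxtens.
From mathcomp Require Import all_classical all_reals all_analysis.

Set Implicit Arguments.
Unset Strict Implicit.
Unset Printing Implicit Defensive.

Import Order.TTheory GRing.Theory Num.Theory.
Import numFieldNormedType.Exports.

Local Open Scope classical_set_scope.
Local Open Scope ring_scope.
Local Open Scope complex_scope.

(* MathComp-Analysis puts the usual topology and norm on the sort of any
   numFieldType, but not on the bare type R[i]. *)
Definition Cplx (R : realType) : numFieldType := R[i].

Section ComplexAnalysis.
Context {R : realType}.
Local Notation C := (Cplx R).

Definition cexp (z : C) : C :=
  (expR (complex.Re z) * cos (complex.Im z))
    +i* (expR (complex.Re z) * sin (complex.Im z)).

Definition twopii : C := 0 +i* (2 * pi).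

(* [differentiable] is Frechet differentiability over the scalar field, here
   the complex numbers: complex differentiability, in one or several variables. *)
Definition holomorphic (V W : normedModType C) (D : set V) (f : V -> W) :=
  open D /\ forall p, D p -> differentiable f p.

(* f, only meaningful on D, is a meromorphic function on the whole of V: it is
   holomorphic on the dense open set D and, around every point of V, a quotient
   h / g of holomorphic functions with g not vanishing on any nonempty open
   set. *)
Definition meromorphic (V W : normedModType C) (D : set V) (f : V -> W) :=
  [/\ dense D, holomorphic D f &
    forall p : V, exists (U : set V) (g : V -> C) (h : V -> W),
      [/\ U p, holomorphic U g, holomorphic U h,
          U `<=` closure (U `&` [set q | g q != 0]) &
          forall q, U q -> D q -> g q *: f q = h q]].

(* P holds on D outside a nowhere dense analytic subset of D. *)
Definition generically (V : normedModType C) (D P : set V) :=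
  exists g : V -> C,
    [/\ holomorphic D g, D `<=` closure (D `&` [set p | g p != 0]) &
        forall p, D p -> g p != 0 -> P p].

(* The two-sided series converges absolutely for Im tau > 0, so that summing it
   symmetrically is harmless. *)
Definition theta_bar (tau z : C) : C :=
  limn (fun N : nat => \sum_(k < N.*2.+1)
    let m : C := (k%:Z - N%:Z)%:~R in
    cexp (twopii / 2 * m ^+ 2 * tau + twopii * m * z)).

End ComplexAnalysis.

(* Mat_n (x) Mat_n and Mat_n (x) Mat_n (x) Mat_n are 'M_(n * n) and
   'M_(n * n * n), with X (x) Y the Kronecker product X *t Y. *)
Section Tensors.
Context {K : comNzRingType} {n : nat}.
Local Notation M := 'M[K]_n.

(* The linear map on Mat_n (x) Mat_n induced by a bilinear map b, see
   [tens_lift_tens]. *)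
Definition tens_lift (V : lmodType K) (b : M -> M -> V) (t : 'M[K]_(n * n)) : V :=
  \sum_i \sum_j \sum_k \sum_l
    t (mxtens_index (i, k)) (mxtens_index (j, l))
      *: b (delta_mx i j) (delta_mx k l).

Definition tens12 : 'M[K]_(n * n) -> 'M[K]_(n * n * n) :=
  tens_lift (fun a b => a *t b *t 1%:M).
Definition tens23 : 'M[K]_(n * n) -> 'M[K]_(n * n * n) :=
  tens_lift (fun a b => 1%:M *t a *t b).
Definition tens13 : 'M[K]_(n * n) -> 'M[K]_(n * n * n) :=
  tens_lift (fun a b => a *t 1%:M *t b).
Definition tens_swap : 'M[K]_(n * n) -> 'M[K]_(n * n) :=
  tens_lift (fun a b => b *t a).

Definition tens_hom (t : 'M[K]_(n * n)) (Z : M) : M :=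
  tens_lift (fun X Y => \tr (X *m Z) *: Y) t.

(* The inverse of [tens_hom], see [tens_homK] and [hom_tensK]. *)
Definition hom_tens (f : M -> M) : 'M[K]_(n * n) :=
  \sum_i \sum_j delta_mx j i *t f (delta_mx i j).

End Tensors.

Section TensorTheory.
Context {K : comNzRingType} {n : nat}.
Local Notation M := 'M[K]_n.

Lemma tens_lift_tens (V : lmodType K) (b : M -> M -> V) :
    (forall Y, linear (b^~ Y)) -> (forall X, linear (b X)) ->
  forall X Y, tens_lift b (X *t Y) = b X Y.
Proof.
move=> bl br X Y.
have suml Z (I : finType) (c : I -> K) (F : I -> M) :
    b (\sum_i c i *: F i) Z = \sum_i c i *: b (F i) Z.
  apply: (big_ind2 (fun x y => b x Z = y)) => [|x1 x2 y1 y2 <- <-|i _].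
  - by have := bl Z (-1) 0 0; rewrite scaler0 addr0 scaleN1r addNr.
  - by rewrite -{1}[x1]scale1r bl scale1r.
  - have b0 : b 0 Z = 0.
      by have := bl Z (-1) 0 0; rewrite scaler0 addr0 scaleN1r addNr.
    by rewrite -[c i *: F i]addr0 bl b0 addr0.
have sumr Z (I : finType) (c : I -> K) (F : I -> M) :
    b Z (\sum_i c i *: F i) = \sum_i c i *: b Z (F i).
  apply: (big_ind2 (fun x y => b Z x = y)) => [|x1 x2 y1 y2 <- <-|i _].
  - by have := br Z (-1) 0 0; rewrite scaler0 addr0 scaleN1r addNr.
  - by rewrite -{1}[x1]scale1r br scale1r.
  - have b0 : b Z 0 = 0.
      by have := br Z (-1) 0 0; rewrite scaler0 addr0 scaleN1r addNr.
    by rewrite -[c i *: F i]addr0 br b0 addr0.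
rewrite {2}[X]matrix_sum_delta {2}[Y]matrix_sum_delta.
rewrite !(pair_big xpredT xpredT) /= suml /tens_lift.
rewrite (pair_big xpredT xpredT) /=; apply: eq_bigr => -[i j] _ /=.
rewrite pair_big sumr scaler_sumr; apply: eq_bigr => -[k l] _ /=.
by rewrite tensmxE scalerA.
Qed.

Lemma tens_homE (t : 'M[K]_(n * n)) (i j k l : 'I_n) :
  tens_hom t (delta_mx i j) k l = t (mxtens_index (j, k)) (mxtens_index (i, l)).
Proof.
have trd (a b : 'I_n) : \tr (delta_mx a b *m delta_mx i j) =
    ((a == j) && (b == i))%:R :> K.
  rewrite mul_delta_mx_cond raddfMn /= /mxtrace (bigD1 a) //= big1 => [|c /negPf ca].
    by rewrite mxE eqxx addr0; case: (b == i); case: (a == j).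
  by rewrite mxE ca.
rewrite /tens_hom /tens_lift summxE (bigD1 j) //= [X in _ + X]big1 ?addr0; last first.
  move=> a /negPf aj; rewrite summxE big1 // => b _; rewrite summxE big1 // => c _.
  by rewrite summxE big1 // => d _; rewrite trd aj scale0r scaler0 mxE.
rewrite summxE (bigD1 i) //= [X in _ + X]big1 ?addr0; last first.
  move=> b /negPf bi; rewrite summxE big1 // => c _.
  by rewrite summxE big1 // => d _; rewrite trd bi andbF scale0r scaler0 mxE.
rewrite summxE (bigD1 k) //= [X in _ + X]big1 ?addr0; last first.
  move=> c /negPf ck; rewrite summxE big1 // => d _.
  by rewrite !mxE [k == c]eq_sym ck mulr0 mulr0.
rewrite summxE (bigD1 l) //= [X in _ + X]big1 ?addr0; last first.
  by move=> d /negPf dl; rewrite !mxE [l == d]eq_sym dl andbF mulr0 mulr0.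
by rewrite trd !mxE !eqxx !mulr1.
Qed.

Lemma hom_tensE (f : M -> M) (i j k l : 'I_n) :
  hom_tens f (mxtens_index (j, k)) (mxtens_index (i, l)) = f (delta_mx i j) k l.
Proof.
rewrite /hom_tens summxE (bigD1 i) //= [X in _ + X]big1 ?addr0; last first.
  move=> a /negPf ai; rewrite summxE big1 // => b _.
  by rewrite tensmxE mxE [i == a]eq_sym ai andbF mul0r.
rewrite summxE (bigD1 j) //= [X in _ + X]big1 ?addr0; last first.
  by move=> b /negPf bj; rewrite tensmxE mxE [j == b]eq_sym bj mul0r.
by rewrite tensmxE mxE !eqxx mul1r.
Qed.

Lemma tens_hom_is_linear (t : 'M[K]_(n * n)) : linear (tens_hom t).
Proof.
move=> c X Y; rewrite /tens_hom /tens_lift.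
do 4![rewrite scaler_sumr -big_split /=; apply: eq_bigr => ? _].
by rewrite mulmxDr -scalemxAr mxtraceD mxtraceZ scalerDl scalerDr !scalerA mulrCA mulrA.
Qed.

Lemma tens_homK (t : 'M[K]_(n * n)) : hom_tens (tens_hom t) = t.
Proof.
apply/matrixP => p q.
case: (mxtens_indexP p) => j k; case: (mxtens_indexP q) => i l.
by rewrite hom_tensE tens_homE.
Qed.

Lemma hom_tensK (f : M -> M) : linear f -> tens_hom (hom_tens f) =1 f.
Proof.
move=> fl Z.
have eq_delta i j : tens_hom (hom_tens f) (delta_mx i j) = f (delta_mx i j).
  by apply/matrixP => k l; rewrite tens_homE hom_tensE.
pose F : {linear M -> M} := HB.pack f (GRing.isLinear.Build _ _ _ _ f fl).
pose G : {linear M -> M} := HB.pack (tens_hom (hom_tens f))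
  (GRing.isLinear.Build _ _ _ _ _ (tens_hom_is_linear (hom_tens f))).
rewrite -[f Z]/(F Z) -[LHS]/(G Z) [Z]matrix_sum_delta !linear_sum.
apply: eq_bigr => i _; rewrite !linear_sum; apply: eq_bigr => j _.
by rewrite !linearZ /= eq_delta.
Qed.

End TensorTheory.

Section YangBaxter.
Context {R : realType} {n : nat}.
Local Notation C := (Cplx R).
Implicit Types (D : set (C * C)) (r : C -> C -> 'M[C]_(n * n)).

Definition AYBE_solution D r :=
  forall u v x y : C,
    D (u, x) -> D (u + v, y) -> D (u + v, x + y) ->
    D (- v, x) -> D (v, y) -> D (u, x + y) ->
    tens12 (r u x) *m tens23 (r (u + v) y) =
      tens13 (r (u + v) (x + y)) *m tens12 (r (- v) x)
      + tens23 (r v y) *m tens13 (r u (x + y)).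

Definition tensor_unitary D r :=
  forall u x : C, D (u, x) -> r (- u) (- x) = - tens_swap (r u x).

Definition tensor_nondegenerate D r :=
  generically D [set p | bijective (tens_hom (r p.1 p.2))].

End YangBaxter.

Section Construction.
Context {R : realType} {n : nat}.
Local Notation C := (Cplx R).
Local Notation M := 'M[C]_n.
Implicit Types (tau v y : C) (B : M) (Phi : C -> M).

Definition Lambda tau : set C :=
  [set z | exists a b : int, z = a%:~R + tau * b%:~R].

Definition Sigma tau B : set C :=
  [set z | exists l l' w : C,
    [/\ eigenvalue B (cexp (twopii * l)), eigenvalue B (cexp (twopii * l')),
        Lambda tau w & z = l - l' + w]].

Definition dom_r tau B : set (C * C) := ~` Sigma tau B `*` ~` Lambda tau.

Definition e_factor tau v (z : C) : C := - cexp (- twopii * (z + v + tau)).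

Definition Sol tau B v : set (C -> M) :=
  [set Phi : C -> M | [/\ holomorphic setT Phi,
    forall z : C, Phi (z + 1) = Phi z &
    forall z : C, Phi (z + tau) *m B = e_factor tau v z *: (B *m Phi z)]].

Definition res0 Phi : M := Phi 0.

Definition ev tau y Phi : M := (theta_bar tau (y + (tau + 1) / 2))^-1 *: Phi y.

(* The inverse of the restriction of res0 to Sol, see [res0_invP]; meaningful
   when that restriction is bijective, in particular for v outside Sigma. *)
Definition res0_inv tau B v : M -> (C -> M) :=
  'pinv_(fun _ _ => 0) (Sol tau B v) res0.

Lemma res0_invP tau B v :
    set_bij (Sol tau B v) setT res0 ->
  forall Z Phi, Sol tau B v Phi /\ res0 Phi = Z <-> Phi = res0_inv tau B v Z.
Proof.
move=> bij Z Phi.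
have [/image_subP sub inj /(_ Z I)[Psi SPsi <-]] := bij.
have K : {in Sol tau B v, cancel res0 (res0_inv tau B v)}.
  exact: (pinvKV _ inj).
rewrite K ?inE //; split=> [[SPhi e]|->//].
by apply: inj; rewrite ?inE.
Qed.

Definition r_tilde tau B v y : M -> M := ev tau y \o res0_inv tau B v.

Definition r_tens tau B v y : 'M[C]_(n * n) := hom_tens (r_tilde tau B v y).

End Construction.

(* Main.v *)
Require Import Defs.
From HB Require Import structures.
From mathcomp Require Import all_boot all_order all_algebra.
From mathcomp Require Import complex mxtens.
From mathcomp Require Import all_classical all_reals all_analysis.
From mathcomp Require Import perm.
From mathcomp Require Import ring lra zify.

Set Implicit Arguments.
Unset Strict Implicit.
Unset Printing Implicit Defensive.

Import Order.TTheory GRing.Theory Num.Theory.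
Import numFieldNormedType.Exports.

Local Open Scope classical_set_scope.
Local Open Scope ring_scope.
Local Open Scope complex_scope.

(** Write e(z) = exp(2 pi i z) and let theta be the theta function of the
construction, translated by (tau + 1)/2: it is 1-periodic, satisfies
theta(z + tau) = - e(- z - tau) theta(z) and theta(- z) = - e(z) theta(z), and
its zeros are exactly the lattice points ([thf_eq0]). Its Fourier coefficients
c_m decay faster than any geometric sequence, so that the sum
  F(w) X = sum over m of c_m e(m w) B^(- m) X B^m
converges for every matrix X and defines an entire family F of endomorphisms
of Mat_n. Shifting the index of summation shows that z |-> F(z + v) X satisfies
the functional equation of Sol_(B,v,tau).

These are all the solutions. On a matrix Y with B Y = alpha Y and Y B = beta Y
the operator F(w) is multiplication by theta(w + log beta - log alpha), and F(w)
commutes with X |-> B X and X |-> X B; a nonzero kernel of F(v) would contain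
such a common eigenvector, and v would lie in Sigma_B ([Fop_inj]). Conversely,
the functional equation expresses each Fourier coefficient of a solution by the
next one, so a solution is determined by a single coefficient, and a dimension
count gives [Sol_Fop]. Hence evaluation at 0 is bijective off Sigma_B and
  r~(v, y) = theta(y)^-1 F(y + v) F(v)^-1.
This formula yields the analytic claims: theta(y) det F(v) is a denominator that
vanishes nowhere on the domain, so r is holomorphic there and meromorphic
everywhere, and r~(v, y) is bijective as soon as det F(y + v) is nonzero.

The identities come from the uniqueness of solutions with given value at 0.
Conjugating a solution for B by S gives one for S^-1 B S. The adjoint of
W |-> Phi_W(- y), with Phi_W the solution of value W at 0, is up to the factor
e(- y) the solution for - v, which is unitarity ([sol_dual]). For the associative
Yang-Baxter equation, the slots of the tensors are contracted with two matrices
Z1 and Z2; the equation then says that a product of two solutions is a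
combination of two translated solutions ([sol_fay]), an analogue of Fay's
trisecant identity. Both sides are quasi-periodic functions of degree 2, a space
in which a function is determined by two Fourier coefficients, and evaluation at
the two zeros of the theta factors identifies the combination. The passage
between tensors and operators is the invariance of the Casimir element
sum of E_ji (x) E_ij ([casimir]).

Two analytic facts are proved on the way. A periodic entire function all of
whose Fourier coefficients vanish is zero ([fourier_uniq]): if f has this
property, the coefficients of the continuous function (f - f(0)) / (e - 1) are
constant on either side of 0 and jump by f(0) there, while by Bessel's inequality
both constants are zero. Independence of the Fourier coefficients from the
horizontal line of integration is Goursat's theorem. Second, the zeros of
theta: multiplying theta by a suitable kernel series shows that a zero z with
e(z) <> 1 spreads along the horizontal line through z ([kernel_zero]), and theta
cannot vanish on a horizontal segment of length 1, its mean there being c_0 = 1. *)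

(** * The modulus as a real number *)

Section Basics.
Context {R : realType}.
Local Notation C := (Cplx R).

(** The norm of a complex number is itself a complex number; all estimates below
are carried out in R, with this modulus. *)
Definition nrm (z : C) : R := Normc.normc z.
#[local] Arguments nrm : simpl never.

Lemma normE (z : C) : `|z| = (nrm z)%:C.
Proof. by []. Qed.

Lemma nrm_ge0 z : 0 <= nrm z.
Proof. by rewrite -lecR -normE normr_ge0. Qed.
Lemma nrmD x y : nrm (x + y) <= nrm x + nrm y.
Proof. exact: le_normcD. Qed.
Lemma nrmM x y : nrm (x * y) = nrm x * nrm y.
Proof. exact: Normc.normcM. Qed.
Lemma nrmN x : nrm (- x) = nrm x.
Proof. exact: normcN. Qed.
Lemma nrm0 : nrm 0 = 0.
Proof. exact: Normc.normc0. Qed.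
Lemma nrm1 : nrm 1 = 1.
Proof. exact: Normc.normc1. Qed.
Lemma nrmB x y : nrm (x - y) <= nrm x + nrm y.
Proof. by rewrite -(nrmN y); exact: nrmD. Qed.
Lemma nrmBC x y : nrm (x - y) = nrm (y - x).
Proof. by rewrite -nrmN opprB. Qed.
Lemma nrm_eq0 x : (nrm x == 0) = (x == 0).
Proof. by apply/eqP/eqP=> [/Normc.eq0_normc//|->]; exact: nrm0. Qed.
Lemma nrm_gt0 x : (0 < nrm x) = (x != 0).
Proof. by rewrite lt_def nrm_ge0 andbT nrm_eq0. Qed.
Lemma nrmX x n : nrm (x ^+ n) = nrm x ^+ n.
Proof. by elim: n => [|n IH]; rewrite ?expr0 ?nrm1// !exprS nrmM IH. Qed.
Lemma nrmV x : nrm x^-1 = (nrm x)^-1.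
Proof. exact: Normc.normcV. Qed.
Lemma nrmRe z : `|complex.Re z| <= nrm z.
Proof. by rewrite -lecR -normE; exact: normc_ge_Re. Qed.
Lemma nrmIm z : `|complex.Im z| <= nrm z.
Proof.
rewrite /nrm; case: z => a b /=; rewrite -sqrtr_sqr ler_wsqrtr//.
by rewrite lerDr sqr_ge0.
Qed.
Lemma complex_ext (x y : C) : complex.Re x = complex.Re y -> complex.Im x = complex.Im y -> x = y.
Proof. by case: x => a b; case: y => c d /= -> ->. Qed.
Lemma nrm_le_ReIm z : nrm z <= `|complex.Re z| + `|complex.Im z|.
Proof.
case: z => a b /=; have := nrmD (a +i* 0 : C) (0 +i* b : C).
have -> : nrm (a +i* 0) = `|a| by rewrite /nrm /= expr0n/= addr0 sqrtr_sqr.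
have -> : nrm (0 +i* b) = `|b| by rewrite /nrm /= expr0n/= add0r sqrtr_sqr.
apply: le_trans.
by rewrite (_ : _ + _ = a +i* b) //; apply: complex_ext; rewrite /= ?addr0 ?add0r.
Qed.
Lemma nrm_real (x : R) : nrm x%:C = `|x|.
Proof. by rewrite /nrm /= expr0n/= addr0 sqrtr_sqr. Qed.

Lemma nrm_sum (I : Type) (r : seq I) (P : pred I) (F : I -> C) :
  nrm (\sum_(i <- r | P i) F i) <= \sum_(i <- r | P i) nrm (F i).
Proof.
elim/big_ind2: _ => //; first by rewrite nrm0.
by move=> x1 x2 y1 y2 h1 h2; apply: (le_trans (nrmD _ _)); exact: lerD.
Qed.

Lemma cReD (x y : C) : complex.Re (x + y : C) = complex.Re x + complex.Re y.
Proof. by case: x; case: y. Qed.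
Lemma cImD (x y : C) : complex.Im (x + y : C) = complex.Im x + complex.Im y.
Proof. by case: x; case: y. Qed.
Lemma cReN (x : C) : complex.Re (- x : C) = - complex.Re x.
Proof. by case: x. Qed.
Lemma cImN (x : C) : complex.Im (- x : C) = - complex.Im x.
Proof. by case: x. Qed.
Lemma cReB (x y : C) : complex.Re (x - y : C) = complex.Re x - complex.Re y.
Proof. by rewrite cReD cReN. Qed.
Lemma cImB (x y : C) : complex.Im (x - y : C) = complex.Im x - complex.Im y.
Proof. by rewrite cImD cImN. Qed.
Lemma cReM (x y : C) : complex.Re (x * y : C) =
  complex.Re x * complex.Re y - complex.Im x * complex.Im y.
Proof. by case: x; case: y. Qed.
Lemma cImM (x y : C) : complex.Im (x * y : C) =
  complex.Re x * complex.Im y + complex.Im x * complex.Re y.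
Proof. by case: x => a b; case: y => c d /=; rewrite addrC [b * c]mulrC [a * d]mulrC mulrC [d * a]mulrC. Qed.

Lemma nearC (x : C) (P : C -> Prop) :
  (\forall y \near x, P y) <-> exists2 d : R, 0 < d & forall y, nrm (y - x) < d -> P y.
Proof.
split.
- move=> /nbhs_ballP[d /= d0 H].
  have hd : d = (complex.Re d)%:C.
    by move: d0; rewrite ltcE /= => /andP[/eqP h _]; apply: complex_ext.
  exists (complex.Re d) => [|y yx]; first by rewrite -ltcR -hd.
  apply: H; rewrite /ball/= -opprB normrN normE hd ltcR.
  by rewrite -nrmN opprB; rewrite nrmBC.
- move=> [d d0 H]; apply/nbhs_ballP; exists (d%:C) => /=; first by rewrite ltcR.
  move=> y; rewrite /ball/= normE ltcR nrmBC; exact: H.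
Qed.

Lemma cvgC {T : Type} (F : set_system T) (FF : Filter F) (f : T -> C) (l : C) :
  f @ F --> l <-> forall e : R, 0 < e -> \forall x \near F, nrm (f x - l) < e.
Proof.
split=> [/cvgr_dist_lt H e e0|H].
  have /H : (0 : C) < e%:C by rewrite ltcR.
  by apply: filterS => x; rewrite normE ltcR nrmBC.
apply/cvgrPdist_lt => e e0.
have he : e = (complex.Re e)%:C.
  by move: e0; rewrite ltcE /= => /andP[/eqP h _]; apply: complex_ext.
have /H : 0 < complex.Re e by rewrite -ltcR -he.
by apply: filterS => x; rewrite he normE ltcR nrmBC.
Qed.

End Basics.
#[global] Arguments nrm {R} z : simpl never.

(** * Complex derivatives and the exponential function *)

Section GenDeriv.
Context {K : numFieldType}.

(** Clearing the denominator of the difference quotient makes the case h = 0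
harmless, so that estimates can be composed without separating it. *)
Lemma is_deriveK (f : K -> K) (x df : K) :
  is_derive x (1 : K) f df <->
  forall e, 0 < e -> \forall h \near (0 : K),
    `|f (x + h) - f x - h * df| <= e * `|h|.
Proof.
split.
- move=> [dv vE] e e0; move: dv vE; rewrite /derivable /derive => dv vE.
  have := dv; rewrite /cvg_to /= => dv'.
  have {dv'}H : h^-1 *: ((f \o shift x) (h *: (1:K)) - f x) @[h --> 0^'] --> df.
    by rewrite -vE.
  move/cvgr_dist_lt: H => /(_ _ e0); rewrite near_withinE; apply: filterS => h H.
  have [->|h0] := eqVneq h 0; first by rewrite addr0 subrr mul0r subrr !normr0 mulr0.
  have /ltW := H h0; rewrite /= => {}H.
  have {}H : `|df - h^-1 * (f (x + h) - f x)| <= e.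
    by move: H; rewrite /shift/= -[h *: 1]/(h * 1) mulr1 (addrC h).
  rewrite (_ : _ - _ = - h * (df - h^-1 * (f (x + h) - f x))).
    by rewrite normrM normrN mulrC ler_wpM2r.
  by field.
- move=> H.
  have dv : h^-1 *: ((f \o shift x) (h *: (1:K)) - f x) @[h --> 0^'] --> df.
    apply/cvgrPdist_le => e e0.
    rewrite near_withinE; move: (H _ e0); apply: filterS => h {}H h0.
    have hp : 0 < `|h| by rewrite normr_gt0.
    rewrite -(ler_pM2r hp) /= /shift/= -[h *: 1]/(h * 1) mulr1 (addrC h) -normrM.
    rewrite (_ : _ * h = - (f (x + h) - f x - h * df)) ?normrN//.
    by rewrite -[_ *: _]/(h^-1 * _); field.
  split; first by apply/cvg_ex; exists df.
  exact: cvg_lim.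
Qed.

End GenDeriv.

Section CDeriv.
Context {R : realType}.
Local Notation C := (Cplx R).

Definition cderiv (f : C -> C) (x l : C) :=
  forall e : R, 0 < e -> exists2 d : R, 0 < d &
    forall h, nrm h < d -> nrm (f (x + h) - f x - h * l) <= e * nrm h.

Lemma cderivP f x l : cderiv f x l <-> is_derive x (1 : C) f l.
Proof.
split.
- move=> H; apply/is_deriveK => e e0.
  have he : e = (complex.Re e)%:C.
    by move: e0; rewrite ltcE /= => /andP[/eqP h _]; apply: complex_ext.
  have /H[d d0 {}H] : 0 < complex.Re e by rewrite -ltcR -he.
  apply/nearC; exists d => // h; rewrite subr0 => /H.
  by rewrite he !normE -rmorphM lecR.
- move=> /is_deriveK H e e0.
  have /H/nearC[d d0 {}H] : (0 : C) < e%:C by rewrite ltcR.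
  exists d => // h hd; have := H h; rewrite subr0 => /(_ hd).
  by rewrite !normE -rmorphM lecR.
Qed.

Lemma cderiv_diff f x l : cderiv f x l -> differentiable (f : C -> C) x.
Proof. by move=> /cderivP[d _]; apply/derivable1_diffP. Qed.

Lemma diff_cderiv f x : differentiable (f : C -> C) x -> exists l, cderiv f x l.
Proof.
move=> /derivable1_diffP d; exists ('D_1 f x); apply/cderivP.
exact: DeriveDef.
Qed.

Lemma diff_cont (f : C -> C) x : differentiable (f : C -> C) x -> {for x, continuous f}.
Proof. exact: differentiable_continuous. Qed.

Definition rderiv (f : R -> R) (x l : R) :=
  forall e : R, 0 < e -> exists2 d : R, 0 < d &
    forall h, `|h| < d -> `|f (x + h) - f x - h * l| <= e * `|h|.

Lemma nearR (x : R) (P : R -> Prop) :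
  (\forall y \near x, P y) <-> exists2 d : R, 0 < d & forall y, `|y - x| < d -> P y.
Proof.
split.
- move=> /nbhs_ballP[d /= d0 H]; exists d => // y yx; apply: H.
  by rewrite /ball/= distrC.
- move=> [d d0 H]; apply/nbhs_ballP; exists d => //= y; rewrite /ball/= distrC.
  exact: H.
Qed.

Lemma rderivP f x l : rderiv f x l <-> is_derive x (1 : R) f l.
Proof.
split.
- move=> H; apply/is_deriveK => e /H[d d0 {}H].
  by apply/nearR; exists d => // h; rewrite subr0 => /H.
- move=> /is_deriveK H e /H/nearR[d d0 {}H].
  by exists d => // h hd; have := H h; rewrite subr0 => /(_ hd).
Qed.

Lemma cexpD (x y : C) : cexp (x + y) = cexp x * cexp y.
Proof.
case: x => a b; case: y => c d; apply: complex_ext; rewrite ?cReM ?cImM /=.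
  by rewrite expRD cosD; ring.
by rewrite expRD sinD; ring.
Qed.

Lemma cexp0 : cexp (0 : C) = 1.
Proof. by apply: complex_ext; rewrite /= expR0 ?cos0 ?sin0 ?mul1r. Qed.

Lemma nrm_cexp (x : C) : nrm (cexp x) = expR (complex.Re x).
Proof.
case: x => a b; rewrite /nrm /=.
rewrite (_ : _ + _ = expR a ^+ 2); first by rewrite sqrtr_sqr ger0_norm ?expR_ge0.
by rewrite !exprMn -mulrDr cos2Dsin2 mulr1.
Qed.

Lemma cexp_neq0 (x : C) : cexp x != 0.
Proof. by rewrite -nrm_gt0 nrm_cexp expR_gt0. Qed.

Lemma cexpN (x : C) : cexp (- x) = (cexp x)^-1.
Proof.
apply: (mulfI (cexp_neq0 x)); rewrite -cexpD subrr cexp0 divff//.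
exact: cexp_neq0.
Qed.

(** The functional equation of cexp reduces its derivative at any point to this one,
so only first-order expansions of exp, sin and cos at 0 are needed. *)
Lemma cderiv_cexp0 : cderiv (@cexp R) 0 1.
Proof.
have dE : rderiv (@expR R) 0 1.
  by apply/rderivP; have := is_derive_expR (0 : R); rewrite expR0.
have dS : rderiv (@sin R) 0 1.
  by apply/rderivP; have := is_derive_sin (0 : R); rewrite cos0.
have dC : rderiv (@cos R) 0 0.
  by apply/rderivP; have := is_derive_cos (0 : R); rewrite sin0 oppr0.
move=> e e0.
have [r r0 [r1 re]] : exists2 r : R, 0 < r & r <= 1 /\ r <= e / 8.
  exists (Num.min (e / 8) 1); first by rewrite lt_min divr_gt0 //=.
  by rewrite !ge_min !lexx orbT.
have [d1 d10 D1] := dE _ r0; have [d2 d20 D2] := dS _ r0; have [d3 d30 D3] := dC _ r0.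
exists (Num.min r (Num.min d1 (Num.min d2 d3))); first by rewrite !lt_min r0 d10 d20.
case=> a b; rewrite !lt_min => /and4P[hr h1 h2 h3].
have ha := nrmRe (a +i* b : C); have hb := nrmIm (a +i* b : C).
rewrite /= in ha hb.
move: hr h1 h2 h3 ha hb; set N := nrm _ => hr h1 h2 h3 ha hb.
have N0 : 0 <= N by exact: nrm_ge0.
apply: (le_trans (nrm_le_ReIm _)); rewrite add0r mulr1 cexp0 !cReB !cImB.
rewrite -/N /=; clearbody N.
have {D1} := D1 a (le_lt_trans ha h1); have {D2} := D2 b (le_lt_trans hb h2).
have {D3} := D3 b (le_lt_trans hb h3).
rewrite !add0r expR0 sin0 cos0 !mulr1 mulr0 !subr0.
have ca := cos_max b; have sa := sin_max b.
move: (expR a) (cos b) (sin b) ca sa => E co s ca sa H3 H2 H1.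
have hE : `|E - 1| <= 2 * N.
  rewrite (_ : E - 1 = (E - 1 - a) + a); last by ring.
  apply: (le_trans (ler_normD _ _)); rewrite mulr2n mulrDl mul1r lerD//.
  apply: (le_trans H1); apply: le_trans ha.
  by rewrite ler_piMl.
have h1a : `|1 + a| <= 2.
  apply: (le_trans (ler_normD _ _)); rewrite normr1 -[2]/(1 + 1) lerD2l.
  by apply: (le_trans ha); apply: ltW; exact: lt_le_trans r1.
have K1 : `|E * co - 1 - a| <= r * N + 2 * (r * N).
  rewrite (_ : _ - a = (E - 1 - a) * co + (1 + a) * (co - 1)); last by ring.
  apply: (le_trans (ler_normD _ _)); rewrite !normrM lerD//.
    rewrite -[leRHS]mulr1 ler_pM//; apply: (le_trans H1).
    by rewrite ler_wpM2l// ltW.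
  rewrite ler_pM//; apply: (le_trans H3).
  by rewrite ler_wpM2l// ltW.
have K2 : `|E * s - b| <= 4 * (r * N) + r * N.
  rewrite (_ : _ - b = (E - 1) * s + (s - b)); last by ring.
  apply: (le_trans (ler_normD _ _)); rewrite !normrM lerD//.
    have sN : `|s| <= 2 * N.
      rewrite (_ : s = (s - b) + b); last by ring.
      apply: (le_trans (ler_normD _ _)); rewrite mulr2n mulrDl mul1r lerD//.
      by apply: (le_trans H2); apply: le_trans hb; rewrite ler_piMl.
    rewrite (_ : 4 * (r * N) = (2 * N) * (2 * r)); last by ring.
    by rewrite ler_pM//; apply: (le_trans sN); rewrite ler_wpM2l// ltW.
  by apply: (le_trans H2); rewrite ler_wpM2l// ltW.
apply: (le_trans (lerD K1 K2)).
have -> : r * N + 2 * (r * N) + (4 * (r * N) + r * N) = 8 * r * N by ring.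
by rewrite ler_wpM2r//; lra.
Qed.

Lemma cderiv_cexp (x : C) : cderiv (@cexp R) x (cexp x).
Proof.
move=> e e0; have k0 : 0 < nrm (cexp x) by rewrite nrm_gt0 cexp_neq0.
have [d d0 H] := cderiv_cexp0 (divr_gt0 e0 k0); exists d => // h /H.
rewrite cexp0 add0r mulr1 => {}H.
rewrite cexpD (_ : _ - _ = cexp x * (cexp h - 1 - h)); last by ring.
by rewrite nrmM mulrC -ler_pdivlMr// mulrAC.
Qed.

End CDeriv.

(** * Integrals over the unit interval *)

Section RealInt.
Context {R : realType}.

Local Notation mu := (@lebesgue_measure R).

Definition rint (f : R -> R) : R := (\int[mu]_(t in `[0, 1]) f t)%R.

Lemma integrable_cont (f : R -> R) (a b : R) : continuous f ->
  mu.-integrable `[a, b] (EFin \o f).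
Proof.
move=> cf; apply: continuous_compact_integrable; first exact: segment_compact.
by apply: continuous_subspaceT => x; exact: cf.
Qed.

Lemma rint_prim (F f : R -> R) : continuous f ->
  (forall x : R, 0 <= x <= 1 -> is_derive x (1 : R) F (f x)) -> rint f = F 1 - F 0.
Proof.
move=> cf dF; rewrite /rint /Rintegral (@continuous_FTC2 _ f F)//=.
- by apply: continuous_subspaceT => x; exact: cf.
- split.
  + move=> x; rewrite in_itv/= => /andP[x0 x1].
    by have xx : 0 <= x <= 1 by [rewrite !ltW]; have [] := dF x xx.
  + apply: cvg_at_right_filter; apply: differentiable_continuous; apply/derivable1_diffP.
    by have xx : 0 <= (0:R) <= 1 by [rewrite lexx ler01]; have [] := dF 0 xx.
  + apply: cvg_at_left_filter; apply: differentiable_continuous; apply/derivable1_diffP.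
    by have xx : 0 <= (1:R) <= 1 by [rewrite lexx ler01]; have [] := dF 1 xx.
- move=> x; rewrite in_itv/= => /andP[x0 x1]; rewrite derive1E.
  by have xx : 0 <= x <= 1 by [rewrite !ltW]; have [] := dF x xx.
Qed.

Lemma prim_exists (f : R -> R) : continuous f ->
  exists F : R -> R, forall x : R, 0 <= x <= 1 -> is_derive x (1 : R) F (f x).
Proof.
(* Starting at -1 keeps the end point 0 inside the interval of integration. *)
move=> cf; exists (fun x => \int[mu]_(t in `[(-1)%R, x]) f t)%R => x /andP[x0 x1].
have [||d dE] := @continuous_FTC1_closed _ f (-1) x 2 _ (integrable_cont _ _ cf) _ (cf x).
- by lra.
- by lra.
by rewrite -dE derive1E; apply: DeriveDef d erefl.
Qed.

Lemma rintD (f g : R -> R) : continuous f -> continuous g ->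
  rint (fun t => f t + g t) = rint f + rint g.
Proof. by move=> cf cg; rewrite /rint RintegralD//; exact: integrable_cont. Qed.

Lemma rintZ (f : R -> R) (k : R) : continuous f ->
  rint (fun t => k * f t) = k * rint f.
Proof. by move=> cf; rewrite /rint RintegralZl//; exact: integrable_cont. Qed.

Lemma rint_cst (k : R) : rint (fun=> k) = k.
Proof.
have ck : continuous (fun _ : R => k) by exact: cst_continuous.
have dk (x : R) : 0 <= x <= 1 -> is_derive x (1 : R) (fun t => k * t) k.
  move=> _; have H := @is_deriveZ _ _ _ id k x 1 1 (is_derive_id x 1).
  by rewrite -[X in is_derive _ _ _ X](mulr1 k); exact: H.
by rewrite (rint_prim ck dk) mulr1 mulr0 subr0.
Qed.

Lemma rint_ge0 (f : R -> R) : (forall t, 0 <= t <= 1 -> 0 <= f t) -> 0 <= rint f.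
Proof. by move=> f0; apply: Rintegral_ge0 => x /=; rewrite in_itv/=; exact: f0. Qed.

Lemma rint_le (f g : R -> R) : continuous f -> continuous g ->
  (forall t, 0 <= t <= 1 -> f t <= g t) -> rint f <= rint g.
Proof.
move=> cf cg fg; rewrite -subr_ge0 -[- rint f]mulN1r -rintZ// -rintD//.
  by apply: rint_ge0 => t /fg; rewrite mulN1r subr_ge0.
by move=> x; apply: cvgZr; exact: cf.
Qed.

Lemma cont_affine (f : R -> R) (a b : R) : continuous f -> continuous (fun t => f (a * t + b)).
Proof.
move=> cf x; apply: (@continuous_comp _ _ _ (fun t => a * t + b) f); last exact: cf.
by apply: cvgD; [apply: cvgZr; exact: cvg_id|exact: cvg_cst].
Qed.

Lemma is_derive_affine (F : R -> R) (a b l x : R) :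
  is_derive (a * x + b) (1 : R) F l ->
  is_derive x (1 : R) (fun t => F (a * t + b)) (a * l).
Proof.
move=> dF.
have dA : is_derive x (1 : R) (fun t : R => a * t + b) a.
  have H := @is_deriveD _ _ _ _ _ x 1 _ _
    (@is_deriveZ _ _ _ id a x 1 1 (is_derive_id x 1)) (is_derive_cst b x 1).
  by rewrite -[X in is_derive _ _ _ X](mulr1 a) -[X in is_derive _ _ _ X]addr0; exact: H.
by have := @is_derive1_comp R F (fun t : R => a * t + b) x _ _ dF dA; rewrite mulrC.
Qed.

(** The only change of variables that the bisection in Goursat's theorem uses. *)
Lemma rint_halves (f : R -> R) : continuous f ->
  2 * rint f = rint (fun t => f (2^-1 * t + 0)) + rint (fun t => f (2^-1 * t + 2^-1)).
Proof.
move=> cf; have [F dF] := prim_exists cf.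
have half (b : R) : 0 <= b <= 2^-1 ->
    rint (fun t => f (2^-1 * t + b)) = 2 * F (2^-1 * 1 + b) - 2 * F (2^-1 * 0 + b).
  move=> b01; have cfb : continuous (fun t : R => f (2^-1 * t + b)) by exact: cont_affine.
  have dFb (x : R) : 0 <= x <= 1 ->
      is_derive x (1 : R) (fun t : R => 2 * F (2^-1 * t + b)) (f (2^-1 * x + b)).
    move=> x01; have xx : 0 <= 2^-1 * x + b <= 1 by lra.
    have := @is_deriveZ _ _ _ _ 2 _ _ _ (is_derive_affine (dF _ xx)).
    by rewrite -[X in is_derive _ _ _ X]/(2 * (2^-1 * f (2^-1 * x + b))) mulrA divff ?mul1r.
  exact: (rint_prim cfb dFb).
rewrite (rint_prim cf dF) !half; [|lra|lra].
rewrite !mulr1 !mulr0 !add0r !addr0.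
have -> : 2^-1 + 2^-1 = 1 :> R by lra.
ring.
Qed.

End RealInt.

Section CInt.
Context {R : realType}.
Local Notation C := (Cplx R).
Local Notation RtoC t := ((t : R)%:C : C).

Definition cint (g : R -> C) : C :=
  rint (fun t => complex.Re (g t)) +i* rint (fun t => complex.Im (g t)).

Lemma contR (g : R -> C) : continuous g <-> forall x (e : R), 0 < e ->
  \forall t \near x, nrm (g t - g x) < e.
Proof.
split => [H x|H x]; first exact: (cvgC (nbhs_filter x) g (g x)).1 (H x).
exact: (cvgC (nbhs_filter x) g (g x)).2 (H x).
Qed.

Lemma cont_Re (g : R -> C) : continuous g -> continuous (fun t => complex.Re (g t)).
Proof.
move=> /contR H x; apply/cvgrPdist_lt => e /(H x); apply: filterS => t.
by apply: le_lt_trans; rewrite distrC -cReB nrmRe.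
Qed.

Lemma cont_Im (g : R -> C) : continuous g -> continuous (fun t => complex.Im (g t)).
Proof.
move=> /contR H x; apply/cvgrPdist_lt => e /(H x); apply: filterS => t.
by apply: le_lt_trans; rewrite distrC -cImB nrmIm.
Qed.

Lemma eq_cint (f g : R -> C) : f =1 g -> cint f = cint g.
Proof. by move=> /funext ->. Qed.

Lemma cintD (f g : R -> C) : continuous f -> continuous g ->
  cint (fun t => f t + g t) = cint f + cint g.
Proof.
move=> cf cg; apply: complex_ext; rewrite ?cReD ?cImD /=.
  by rewrite -rintD; [congr rint; apply/funext => t; rewrite cReD|exact: cont_Re|exact: cont_Re].
by rewrite -rintD; [congr rint; apply/funext => t; rewrite cImD|exact: cont_Im|exact: cont_Im].
Qed.

Lemma contZ (f : R -> C) k : continuous f -> continuous (fun t => k * f t).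
Proof. by move=> cf x; apply: cvgM; [exact: cvg_cst|exact: cf]. Qed.

Lemma cont_RZ (f : R -> R) k : continuous f -> continuous (fun t => k * f t).
Proof. by move=> cf x; apply: cvgM; [exact: cvg_cst|exact: cf]. Qed.

Lemma cintZ (f : R -> C) (k : C) : continuous f ->
  cint (fun t => k * f t) = k * cint f.
Proof.
move=> cf; have c1 := cont_Re cf; have c2 := cont_Im cf.
apply: complex_ext.
  rewrite cReM /= -mulNr -(rintZ _ c1) -(rintZ _ c2) -rintD; try exact: cont_RZ.
  by congr rint; apply/funext => t; rewrite cReM mulNr.
rewrite cImM /= -(rintZ _ c1) -(rintZ _ c2) -rintD; try exact: cont_RZ.
by congr rint; apply/funext => t; rewrite cImM.
Qed.

Lemma cint_cst (k : C) : cint (fun=> k) = k.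
Proof. by apply: complex_ext; rewrite /= rint_cst. Qed.

Lemma cintN (f : R -> C) : continuous f -> cint (fun t => - f t) = - cint f.
Proof. by move=> cf; rewrite -mulN1r -cintZ//; apply: eq_cint => t; rewrite mulN1r. Qed.

Lemma cintB (f g : R -> C) : continuous f -> continuous g ->
  cint (fun t => f t - g t) = cint f - cint g.
Proof.
move=> cf cg; have cg' : continuous (fun t : R => - g t) by move=> x; apply: cvgN; exact: cg.
by rewrite -(cintN cg) -(cintD cf cg').
Qed.

(** The real and imaginary parts are bounded separately, which costs the factor 2
and spares the rotation that gives the sharp constant. *)
Lemma cint_bound (f : R -> C) (M : R) : continuous f ->
  (forall t, 0 <= t <= 1 -> nrm (f t) <= M) -> nrm (cint f) <= 2 * M.
Proof.
move=> cf fM; apply: (le_trans (nrm_le_ReIm _)) => /=.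
have bd (h : R -> R) : continuous h -> (forall t, 0 <= t <= 1 -> `|h t| <= M) -> `|rint h| <= M.
  move=> ch hM; rewrite ler_norml; apply/andP; split.
    rewrite -(rint_cst (- M)); apply: rint_le => //; first exact: cst_continuous.
    by move=> t /hM; rewrite ler_norml => /andP[].
  rewrite -[leRHS](rint_cst M); apply: rint_le => //; first exact: cst_continuous.
  by move=> t /hM; rewrite ler_norml => /andP[].
rewrite mulr2n mulrDl mul1r lerD//; apply: bd.
- exact: cont_Re.
- by move=> t /fM; apply: le_trans; exact: nrmRe.
- exact: cont_Im.
- by move=> t /fM; apply: le_trans; exact: nrmIm.
Qed.

Lemma cint_halves (f : R -> C) : continuous f ->
  2 * cint f = cint (fun t => f (2^-1 * t + 0)) + cint (fun t => f (2^-1 * t + 2^-1)).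
Proof.
move=> cf.
apply: complex_ext; rewrite ?cReM ?cImM ?cReD ?cImD /= ?add0r ?addr0 ?mul0r ?addr0 ?subr0.
  by rewrite (_ : 1 + 1 = 2)// (rint_halves (cont_Re cf)).
by rewrite (_ : 1 + 1 = 2)// (rint_halves (cont_Im cf)).
Qed.

Lemma cont_line (f : C -> C) (z a : C) : continuous f ->
  continuous (fun t : R => f (z + RtoC t * a)).
Proof.
move=> cf; apply/contR => x e e0.
have /cvgC/(_ _ e0)/nearC[d d0 H] := (cf (z + RtoC x * a)).
have a0 : 0 < nrm a + 1 by rewrite ltr_wpDl// nrm_ge0.
apply/nearR; exists (d / (nrm a + 1)); first exact: divr_gt0.
move=> t; rewrite ltr_pdivlMr// => tx; apply: H.
rewrite opprD addrACA subrr add0r -mulrBl nrmM -rmorphB nrm_real.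
by apply: le_lt_trans tx; rewrite ler_wpM2l// lerDl.
Qed.

Lemma cint_prim (P p : C -> C) (z a : C) : continuous p -> (forall x, cderiv P x (p x)) ->
  a * cint (fun t => p (z + RtoC t * a)) = P (z + a) - P z.
Proof.
move=> cp dP; rewrite -cintZ; last exact: cont_line.
have cg : continuous (fun t => a * p (z + RtoC t * a)) by apply: contZ; exact: cont_line.
have a0 : 0 < nrm a + 1 by rewrite ltr_wpDl// nrm_ge0.
have D (t e : R) : 0 < e -> exists2 d : R, 0 < d & forall h : R, `|h| < d ->
   nrm (P (z + RtoC (t + h) * a) - P (z + RtoC t * a) - RtoC h * (a * p (z + RtoC t * a)))
     <= e * `|h|.
  move=> e0; have [d d0 H] := dP (z + RtoC t * a) _ (divr_gt0 e0 a0).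
  exists (d / (nrm a + 1)); first exact: divr_gt0.
  move=> h; rewrite ltr_pdivlMr// => hd.
  have ha : nrm (RtoC h * a) <= `|h| * (nrm a + 1).
    by rewrite nrmM nrm_real ler_wpM2l// lerDl.
  have := H (RtoC h * a) (le_lt_trans ha hd).
  rewrite rmorphD mulrDl addrA mulrA => /le_trans; apply.
  by rewrite -mulrA ler_wpM2l ?(ltW e0)// mulrC ler_pdivrMr.
have dR (t : R) : 0 <= t <= 1 -> is_derive t (1 : R) (fun t => complex.Re (P (z + RtoC t * a)))
    (complex.Re (a * p (z + RtoC t * a))).
  move=> _; apply/rderivP => e /(D t)[d d0 H]; exists d => // h /H.
  apply: le_trans; apply: le_trans (nrmRe _).
  by rewrite !cReB [complex.Re (RtoC h * _)]cReM /= mul0r subr0.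
have dI (t : R) : 0 <= t <= 1 -> is_derive t (1 : R) (fun t => complex.Im (P (z + RtoC t * a)))
    (complex.Im (a * p (z + RtoC t * a))).
  move=> _; apply/rderivP => e /(D t)[d d0 H]; exists d => // h /H.
  apply: le_trans; apply: le_trans (nrmIm _).
  by rewrite !cImB [complex.Im (RtoC h * _)]cImM /= mul0r addr0.
apply: complex_ext; rewrite ?cReB ?cImB /=.
  by rewrite (rint_prim (cont_Re cg) dR) rmorph1 rmorph0 mul1r mul0r addr0.
by rewrite (rint_prim (cont_Im cg) dI) rmorph1 rmorph0 mul1r mul0r addr0.
Qed.

End CInt.

(** * Goursat's theorem for parallelograms *)

Section Geometric.
Context {R : realType}.
Local Notation C := (Cplx R).

(** The intervals of centre u k and radius b/(b-1) * K / b^k are nested, so the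
supremum of their left ends lies in all of them. *)
Lemma geom_cauchyR (b : R) (u : nat -> R) (K : R) : 1 < b ->
  (forall k, `|u k.+1 - u k| <= K / b ^+ k) ->
  exists l, forall k, `|u k - l| <= b / (b - 1) * K / b ^+ k.
Proof.
move=> b1 H; set B := b / (b - 1).
have b0 : 0 < b by lra.
have K0 : 0 <= K.
  by have := H 0; rewrite expr0 divr1; apply: le_trans.
have B0 : 0 <= B by rewrite divr_ge0; lra.
have p2 k : 0 < b ^+ k by rewrite exprn_gt0.
have eK k : K / b ^+ k = B * K / b ^+ k - B * K / b ^+ k.+1.
  by rewrite exprS /B; field; rewrite !lt0r_neq0//=; lra.
have stepl k : u k - B * K / b ^+ k <= u k.+1 - B * K / b ^+ k.+1.
  by have := H k; rewrite ler_norml => /andP[h1 h2]; have := eK k; lra.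
have stepr k : u k.+1 + B * K / b ^+ k.+1 <= u k + B * K / b ^+ k.
  by have := H k; rewrite ler_norml => /andP[h1 h2]; have := eK k; lra.
have monl : {homo (fun k => u k - B * K / b ^+ k) : n m / (n <= m)%N >-> n <= m}.
  by apply: homo_leq => [x|y x z|k]; [exact: lexx|exact: le_trans|exact: stepl].
have monr : {homo (fun k => - (u k + B * K / b ^+ k)) : n m / (n <= m)%N >-> n <= m}.
  apply: homo_leq => [x|y x z|k]; [exact: lexx|exact: le_trans|].
  by rewrite lerN2 stepr.
have cross n m : u n - B * K / b ^+ n <= u m + B * K / b ^+ m.
  have h1 := monl _ _ (leq_maxl n m); have h2 := monr _ _ (leq_maxr n m).
  have h3 : 0 <= B * K / b ^+ maxn n m by apply: divr_ge0; [exact: mulr_ge0|exact: ltW].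
  by rewrite /= in h1 h2; lra.
pose S := [set x | exists k, x = u k - B * K / b ^+ k].
have S0 : S !=set0 by exists (u 0 - B * K / b ^+ 0); exists 0.
have Sub m : ubound S (u m + B * K / b ^+ m) by move=> _ [n ->]; exact: cross.
exists (sup S) => k; rewrite ler_distl; apply/andP; split.
  by rewrite lerBlDr; apply: (ge_sup S0); exact: Sub.
rewrite -lerBlDr.
have hs : has_sup S by split => //; exists (u 0 + B * K / b ^+ 0); exact: Sub.
by apply: (sup_upper_bound hs); exists k.
Qed.

Lemma geom_cauchy (b : R) (u : nat -> C) (K : R) : 1 < b ->
  (forall k, nrm (u k.+1 - u k) <= K / b ^+ k) ->
  exists l, forall k, nrm (u k - l) <= 2 * (b / (b - 1)) * K / b ^+ k.
Proof.
move=> b1 H.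
have [|x Hx] := @geom_cauchyR b (fun k => complex.Re (u k)) K b1.
  by move=> k; rewrite -cReB (le_trans (nrmRe _)).
have [|y Hy] := @geom_cauchyR b (fun k => complex.Im (u k)) K b1.
  by move=> k; rewrite -cImB (le_trans (nrmIm _)).
exists (x +i* y) => k; apply: (le_trans (nrm_le_ReIm _)).
rewrite cReB cImB /=; apply: (le_trans (lerD (Hx k) (Hy k))).
by rewrite le_eqVlt; apply/orP; left; apply/eqP; ring.
Qed.

End Geometric.

Section Goursat.
Context {R : realType}.
Local Notation C := (Cplx R).
Local Notation RtoC t := ((t : R)%:C : C).

Lemma ccontD (T : topologicalType) (f g : T -> C) : continuous f -> continuous g ->
  continuous (fun x => f x + g x).
Proof. by move=> cf cg x; exact: (continuousD (cf x) (cg x)). Qed.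
Lemma ccontB (T : topologicalType) (f g : T -> C) : continuous f -> continuous g ->
  continuous (fun x => f x - g x).
Proof. by move=> cf cg x; exact: (continuousB (cf x) (cg x)). Qed.
Lemma ccontM (T : topologicalType) (f g : T -> C) : continuous f -> continuous g ->
  continuous (fun x => f x * g x).
Proof. by move=> cf cg x; exact: (continuousM (cf x) (cg x)). Qed.
Lemma ccont_affine (A p l : C) : continuous (fun x : C => A + (x - p) * l).
Proof.
apply: ccontD; first exact: cst_continuous.
apply: ccontM; last exact: cst_continuous.
by apply: ccontB; [move=> x; exact: cvg_id|exact: cst_continuous].
Qed.

(** The integral of f along the segment from z to z + a. *)
Definition seg (f : C -> C) (z a : C) : C := a * cint (fun t => f (z + RtoC t * a)).

Lemma seg_halves (f : C -> C) z a : continuous f ->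
  seg f z a = seg f z (a / 2) + seg f (z + a / 2) (a / 2).
Proof.
move=> cf; rewrite /seg -mulrDr.
have e1 : cint (fun t => f (z + RtoC t * (a / 2))) =
   cint (fun t : R => f (z + RtoC (2^-1 * t + 0) * a)).
  apply: eq_cint => t; congr (f (z + _)).
  by rewrite addr0 rmorphM fmorphV rmorph_nat; ring.
have e2 : cint (fun t => f (z + a / 2 + RtoC t * (a / 2))) =
   cint (fun t : R => f (z + RtoC (2^-1 * t + 2^-1) * a)).
  apply: eq_cint => t; congr (f _).
  by rewrite rmorphD rmorphM fmorphV rmorph_nat; ring.
rewrite e1 e2 -(@cint_halves _ (fun t => f (z + RtoC t * a))); last exact: cont_line.
by rewrite mulrA divfK// pnatr_eq0.
Qed.

Lemma segD (f g : C -> C) z a : continuous f -> continuous g ->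
  seg (fun x => f x + g x) z a = seg f z a + seg g z a.
Proof. by move=> cf cg; rewrite /seg cintD ?mulrDr//; exact: cont_line. Qed.

Lemma seg_bound (f : C -> C) z a M : continuous f ->
  (forall t : R, 0 <= t <= 1 -> nrm (f (z + RtoC t * a)) <= M) ->
  nrm (seg f z a) <= 2 * M * nrm a.
Proof.
move=> cf fM; rewrite nrmM mulrC ler_wpM2r ?nrm_ge0//.
by apply: cint_bound => //; exact: cont_line.
Qed.

Lemma pigeon4 (j s2 s3 x1 x2 x3 x4 : R) :
  s2 <= x1 + x2 -> s3 <= s2 + x3 -> j <= s3 + x4 ->
  4 * x1 < j -> 4 * x2 < j -> 4 * x3 < j -> 4 * x4 < j -> False.
Proof. by lra. Qed.

(** The integral of f along the boundary of the parallelogram with corner z and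
sides a and b. *)
Definition circulation (f : C -> C) (z a b : C) : C :=
  seg f z a + seg f (z + a) b - seg f (z + b) a - seg f z b.

Lemma circ_quarters (f : C -> C) z a b : continuous f ->
  circulation f z a b =
    circulation f z (a / 2) (b / 2) + circulation f (z + a / 2) (a / 2) (b / 2)
  + circulation f (z + b / 2) (a / 2) (b / 2) + circulation f (z + a / 2 + b / 2) (a / 2) (b / 2).
Proof.
move=> cf; rewrite /circulation !(seg_halves _ a cf) !(seg_halves _ b cf).
have -> : z + a / 2 + a / 2 = z + a by field.
have -> : z + a / 2 + b / 2 + b / 2 = z + b + a / 2 by field.
have -> : z + a / 2 + b / 2 + a / 2 = z + a + b / 2 by field.
have -> : z + b / 2 + a / 2 = z + a / 2 + b / 2 by field.
have -> : z + b / 2 + b / 2 = z + b by field.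
repeat match goal with |- context [seg ?g ?x ?y] => generalize (seg g x y); intro end.
ring.
Qed.

(** An affine function has a primitive, and the increments of a primitive along a
closed path cancel. *)
Lemma circ_affine (p A l z a b : C) : circulation (fun x => A + (x - p) * l) z a b = 0.
Proof.
pose P x := A * x + (x - p) * (x - p) * l / 2.
pose f x := A + (x - p) * l.
have dP x : cderiv P x (f x).
  move=> e e0; have k0 : 0 < nrm (l / 2) + 1 by rewrite ltr_wpDl ?nrm_ge0.
  exists (e / (nrm (l / 2) + 1)) => [|h]; first exact: divr_gt0.
  rewrite ltr_pdivlMr// => he.
  have -> : P (x + h) - P x - h * f x = h * (h * (l / 2)) by rewrite /P /f; field.
  rewrite nrmM mulrC ler_wpM2r ?nrm_ge0// nrmM; apply: le_trans (ltW he).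
  by rewrite ler_wpM2l ?nrm_ge0// lerDl.
have cf : continuous (f : C -> C) by exact: ccont_affine.
have s x c : seg f x c = P (x + c) - P x by apply: cint_prim.
rewrite -[circulation _ _ _ _]/(circulation f z a b) /circulation !s.
have -> : z + b + a = z + a + b by ring.
ring.
Qed.

Lemma circD (f g : C -> C) z a b : continuous f -> continuous g ->
  circulation (fun x => f x + g x) z a b = circulation f z a b + circulation g z a b.
Proof. by move=> cf cg; rewrite /circulation !segD//; ring. Qed.

Lemma circ_bound (f : C -> C) z a b M : continuous f ->
  (forall s t : R, 0 <= s <= 1 -> 0 <= t <= 1 -> nrm (f (z + RtoC s * a + RtoC t * b)) <= M) ->
  nrm (circulation f z a b) <= 4 * M * (nrm a + nrm b).
Proof.
move=> cf fM.
have o01 : 0 <= (0 : R) <= 1 by rewrite lexx ler01.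
have l01 : 0 <= (1 : R) <= 1 by rewrite lexx ler01.
have h1 : nrm (seg f z a) <= 2 * M * nrm a.
  apply: seg_bound => // t t01; have := fM t 0 t01 o01.
  by rewrite rmorph0 mul0r addr0.
have h2 : nrm (seg f (z + a) b) <= 2 * M * nrm b.
  apply: seg_bound => // t t01; have := fM 1 t l01 t01.
  by rewrite rmorph1 mul1r.
have h3 : nrm (seg f (z + b) a) <= 2 * M * nrm a.
  apply: seg_bound => // t t01; have := fM t 1 t01 l01.
  by rewrite rmorph1 mul1r addrAC.
have h4 : nrm (seg f z b) <= 2 * M * nrm b.
  apply: seg_bound => // t t01; have := fM 0 t o01 t01.
  by rewrite rmorph0 mul0r addr0.
have := nrmB (seg f z a + seg f (z + a) b - seg f (z + b) a) (seg f z b).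
have := nrmB (seg f z a + seg f (z + a) b) (seg f (z + b) a).
have := nrmD (seg f z a) (seg f (z + a) b).
rewrite -/(circulation f z a b); lra.
Qed.

(** Some quarter of a parallelogram carries at least a quarter of the circulation.
Iterating, the parallelograms shrink to a point p, near which f is affine up to
an error negligible against the perimeter; affine functions do not contribute, and
the 4^k quarters are compensated by the error times the perimeter, of order
2^-k * 2^-k. *)
Lemma goursat (f : C -> C) z a b : (forall x, differentiable (f : C -> C) x) ->
  circulation f z a b = 0.
Proof.
move=> df; have cf : continuous (f : C -> C) by move=> x; exact: diff_cont.
have p2 k : 0 < (2 : R) ^+ k by rewrite exprn_gt0.
pose sc (c : C) k := c / 2 ^+ k.
have scS c k : sc c k.+1 = sc c k / 2 by rewrite /sc exprSr invfM mulrA.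
(* w' is the corner of a quarter, at scale 2^-(k+1), carrying at least a quarter
   of the circulation around w at scale 2^-k. *)
pose Q (wk : C * nat) w' :=
  (exists i j : bool, w' = wk.1 + (if i then sc a wk.2.+1 else 0) + (if j then sc b wk.2.+1 else 0))
  /\ nrm (circulation f wk.1 (sc a wk.2) (sc b wk.2)) <= 4 * nrm (circulation f w' (sc a wk.2.+1) (sc b wk.2.+1)).
have /choice[nx nxP] : forall wk, exists w', Q wk w'.
  move=> [w k]; rewrite /Q /=.
  apply: contrapT => /forallNP N.
  have N' i j : 4 * nrm (circulation f (w + (if i then sc a k.+1 else 0) +
       (if j then sc b k.+1 else 0)) (sc a k.+1) (sc b k.+1)) <
       nrm (circulation f w (sc a k) (sc b k)).
    rewrite ltNge; apply/negP => h.
    by apply: (N (w + (if i then sc a k.+1 else 0) + (if j then sc b k.+1 else 0)));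
      split => //; exists i, j.
  move: (N' false false) (N' true false) (N' false true) (N' true true).
  rewrite (circ_quarters w (sc a k) (sc b k) cf) !addr0 !scS.
  set c1 := circulation _ _ _ _; set c2 := circulation _ _ _ _; set c3 := circulation _ _ _ _; set c4 := circulation _ _ _ _.
  have := nrmD (c1 + c2 + c3) c4; have := nrmD (c1 + c2) c3; have := nrmD c1 c2.
  exact: pigeon4.
pose zs := fix zs k := if k is k'.+1 then nx (zs k', k') else z.
have zsP k : Q (zs k, k) (zs k.+1) by exact: nxP.
pose K := nrm a + nrm b.
have K0 : 0 <= K by rewrite addr_ge0 ?nrm_ge0.
have scN c k : nrm (sc c k) = nrm c / 2 ^+ k.
  by rewrite /sc nrmM nrmV nrmX -[2 : C]/(2%:R) -[2%:R : C](rmorph_nat (real_complex R)) nrm_real ger0_norm.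
have zsC k : nrm (zs k.+1 - zs k) <= K / 2 ^+ k.
  have [[i [j ->]] _] := zsP k; rewrite /=.
  have -> (x y : C) : zs k + x + y - zs k = x + y by ring.
  apply: (le_trans (nrmD _ _)); rewrite mulrDl.
  have hlp (c : C) (i' : bool) : nrm (if i' then sc c k.+1 else 0) <= nrm c / 2 ^+ k.
    case: i'; last by rewrite nrm0 divr_ge0 ?nrm_ge0// ltW.
    rewrite scN exprS invfM mulrA ler_wpM2r ?invr_ge0 ?(ltW (p2 k))//.
    by have := nrm_ge0 c; lra.
  by rewrite lerD.
have [p pP'] := geom_cauchy (ltr1n _ 2) zsC.
have pP k : nrm (zs k - p) <= 4 * K / 2 ^+ k.
  by apply: (le_trans (pP' k)); rewrite le_eqVlt; apply/orP; left; apply/eqP; field; rewrite lt0r_neq0.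
have zsJ k : nrm (circulation f z a b) <= 4 ^+ k * nrm (circulation f (zs k) (sc a k) (sc b k)).
  elim: k => [|k IH]; first by rewrite expr0 mul1r /sc expr0 !divr1.
  apply: (le_trans IH); have [_ /=] := zsP k => h.
  by rewrite exprSr -mulrA ler_wpM2l ?exprn_ge0.
have [l dl] := diff_cderiv (df p).
have main (e : R) : 0 < e -> nrm (circulation f z a b) <= 20 * e * K ^+ 2.
  move=> e0; have [d d0 H] := dl _ e0.
  have [k hk] : exists k, 5 * K / 2 ^+ k < d.
    have [k hk] : exists k : nat, 5 * K / d < k%:R.
      exists (Num.truncn (5 * K / d)).+1; exact: truncnS_gt.
    exists k; rewrite ltr_pdivrMr// [d * _]mulrC -ltr_pdivrMr//; apply: (lt_trans hk).
    by rewrite -natrX ltr_nat ltn_expl.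
  apply: (le_trans (zsJ k)).
  pose g x := f x - (f p + (x - p) * l).
  have ca : continuous (fun x : C => f p + (x - p) * l) by exact: ccont_affine.
  have cg : continuous (g : C -> C) := ccontB cf ca.
  have -> : circulation f (zs k) (sc a k) (sc b k) = circulation g (zs k) (sc a k) (sc b k).
    have h := circD (zs k) (sc a k) (sc b k) cg ca.
    have fE : f = (fun x => g x + (f p + (x - p) * l)).
      by apply/funext => x; rewrite /g subrK.
    move: h; rewrite -fE => ->.
    by rewrite (circ_affine p (f p) l (zs k) (sc a k) (sc b k)) addr0.
  have gb (s t : R) : 0 <= s <= 1 -> 0 <= t <= 1 ->
     nrm (g (zs k + RtoC s * sc a k + RtoC t * sc b k)) <= e * (5 * K / 2 ^+ k).
    move=> /andP[s0 s1] /andP[t0 t1].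
    set x := _ + _; have xp : nrm (x - p) <= 5 * K / 2 ^+ k.
      rewrite /x; have -> : zs k + RtoC s * sc a k + RtoC t * sc b k - p =
         (zs k - p) + (RtoC s * sc a k + RtoC t * sc b k) by ring.
      apply: (le_trans (nrmD _ _)); rewrite (_ : 5 * K = 4 * K + K); last by ring.
      rewrite mulrDl lerD//; apply: (le_trans (nrmD _ _)).
      rewrite !(nrmM (RtoC _)) !nrm_real !scN mulrDl !ger0_norm//.
      by rewrite lerD// ler_piMl// divr_ge0 ?nrm_ge0// ltW.
    have := H (x - p) (le_lt_trans xp hk); rewrite addrCA subrr addr0 => h.
    rewrite /g opprD addrA; apply: (le_trans h).
    by rewrite ler_wpM2l// ltW.
  have := circ_bound cg gb; rewrite !scN -mulrDl -/K => h.
  have p4 : (4 : R) ^+ k = 2 ^+ k * 2 ^+ k by rewrite -exprMn; congr (_ ^+ _); ring.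
  apply: (le_trans (ler_wpM2l (exprn_ge0 _ _) h)) => //.
  rewrite p4; rewrite le_eqVlt; apply/orP; left; apply/eqP; field.
  by rewrite lt0r_neq0.
apply/eqP; rewrite -nrm_eq0; apply/eqP/le_anti; rewrite nrm_ge0 andbT.
apply/ler_addgt0Pl => e e0; rewrite addr0.
have k0 : 0 < 20 * K ^+ 2 + 1 by have := sqr_ge0 K; lra.
apply: (le_trans (main (e / (20 * K ^+ 2 + 1)) (divr_gt0 e0 k0))).
have -> : 20 * (e / (20 * K ^+ 2 + 1)) * K ^+ 2 = e * (20 * K ^+ 2) / (20 * K ^+ 2 + 1) by field; rewrite lt0r_neq0.
by rewrite ler_pdivrMr// ler_wpM2l ?ltW// ltrDl.
Qed.

End Goursat.

(** * The character exp(2 pi i z) *)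

Section Exponentials.
Context {R : realType}.
Local Notation C := (Cplx R).
Local Notation RtoC t := ((t : R)%:C : C).

Definition ee (z : C) : C := cexp (twopii * z).

Lemma eeD x y : ee (x + y) = ee x * ee y.
Proof. by rewrite /ee mulrDr cexpD. Qed.
Lemma ee0 : ee 0 = 1.
Proof. by rewrite /ee mulr0 cexp0. Qed.
Lemma eeN x : ee (- x) = (ee x)^-1.
Proof. by rewrite /ee mulrN cexpN. Qed.
Lemma eeB x y : ee (x - y) = ee x / ee y.
Proof. by rewrite eeD eeN. Qed.
Lemma ee_neq0 x : ee x != 0.
Proof. exact: cexp_neq0. Qed.
Lemma eeMn x n : ee (x *+ n) = ee x ^+ n.
Proof. by elim: n => [|n IH]; rewrite ?mulr0n ?ee0 ?expr0// mulrS eeD IH exprS. Qed.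
Lemma eeMz x (n : int) : ee (n%:~R * x) = ee x ^ n.
Proof.
case: n => n; first by rewrite mulrC -pmulrn mulr_natr eeMn.
by rewrite NegzE mulrNz mulNr eeN -pmulrn mulrC mulr_natr eeMn -exprnN.
Qed.

Lemma twopii_neq0 : twopii != 0 :> C.
Proof.
rewrite -nrm_gt0; apply: lt_le_trans (nrmIm _) => /=.
by rewrite normr_gt0 mulf_neq0 ?lt0r_neq0 ?pi_gt0.
Qed.

Lemma ReIm_twopii (z : C) :
  complex.Re (twopii * z : C) = - (2 * pi * complex.Im z) /\
  complex.Im (twopii * z : C) = 2 * pi * complex.Re z.
Proof. by rewrite cReM cImM /= !mul0r sub0r add0r. Qed.

Lemma nrm_ee (z : C) : nrm (ee z) = expR (- (2 * pi * complex.Im z)).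
Proof. by rewrite /ee nrm_cexp (ReIm_twopii z).1. Qed.

Lemma ee_real (t : R) : ee (RtoC t) = cos (2 * pi * t) +i* sin (2 * pi * t).
Proof.
rewrite /ee /cexp (ReIm_twopii (RtoC t)).1 (ReIm_twopii (RtoC t)).2 /=.
by rewrite mulr0 oppr0 expR0 !mul1r.
Qed.

Lemma ee1 : ee 1 = 1.
Proof.
have E : 2 * pi = pi + pi :> R by ring.
apply: complex_ext; rewrite /ee mulr1 /= expR0 mul1r E.
  by rewrite cosD cospi sinpi; ring.
by rewrite sinD cospi sinpi; ring.
Qed.

Lemma ee_int (n : int) : ee n%:~R = 1.
Proof. by rewrite -[n%:~R]mulr1 eeMz ee1 exp1rz. Qed.

Lemma ee_eq1 (z : C) : ee z = 1 -> exists n : int, z = n%:~R.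
Proof.
move=> H.
have Im0 : complex.Im z = 0.
  have := nrm_ee z; rewrite H nrm1 => h; have := expR_inj (etrans (expR0 R) h).
  by move=> h2; have pp := pi_gt0 R; apply: (mulfI (lt0r_neq0 pp)); lra.
set x := complex.Re z; pose n := Num.floor x; pose r := x - n%:~R.
have zE : z = RtoC x by apply: complex_ext => //=.
have rE : ee (RtoC r) = 1.
  by rewrite /r rmorphB rmorph_int eeB ee_int divr1 /= -zE.
have r01 : 0 <= r < 1.
  have h1 := floor_le_tmp x; have h2 := lt_succ_floor x.
  by rewrite intrD in h2; rewrite /r /n; apply/andP; split; lra.
suff r0 : r = 0.
  exists n; rewrite zE; move/eqP: r0; rewrite subr_eq0 => /eqP ->.
  by rewrite rmorph_int.
rewrite ee_real in rE.
have S : sin (2 * pi * r) = 0 := congr1 (@complex.Im R) rE.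
have Co : cos (2 * pi * r) = 1 := congr1 (@complex.Re R) rE.
move: r01 => /andP[r0 r1]; apply/eqP; rewrite eq_le r0 andbT leNgt; apply/negP => rp.
have pp := pi_gt0 R.
have [rh|rh|rh] := ltgtP r (1/2).
- have : 0 < sin (2 * pi * r).
    by apply: sin_gt0_pi; apply/andP; split; nra.
  by rewrite S ltxx.
- have : 0 < sin (2 * pi * r - pi).
    by apply: sin_gt0_pi; apply/andP; split; nra.
  by rewrite sinB sinpi cospi mulr0 subr0 S mul0r ltxx.
- move: Co; rewrite rh (_ : 2 * pi * (1/2) = pi) ?cospi; last by field.
  lra.
Qed.

Lemma cderiv_ee (a z : C) : cderiv (fun x => ee (a * x)) z (twopii * a * ee (a * z)).
Proof.
move=> e e0; set c := twopii * a.
have c0 : 0 < nrm c + 1 by rewrite ltr_wpDl// nrm_ge0.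
have [d d0 H] := cderiv_cexp (c * z) (divr_gt0 e0 c0).
exists (d / (nrm c + 1)); first exact: divr_gt0.
move=> h; rewrite ltr_pdivlMr// => hd.
have hc : nrm (c * h) <= nrm h * (nrm c + 1).
  by rewrite nrmM mulrC ler_wpM2l ?nrm_ge0// lerDl.
have := H (c * h) (le_lt_trans hc hd).
rewrite /ee !(mulrA twopii) -/c mulrDr [c * h * _]mulrAC [c * cexp _ * h]mulrC => /le_trans; apply.
by rewrite -mulrA ler_wpM2l ?(ltW e0)// mulrC ler_pdivrMr.
Qed.

Lemma diff_ee (a z : C) : differentiable (fun x : C => ee (a * x) : C) z.
Proof. exact: cderiv_diff (cderiv_ee a z). Qed.

Lemma cont_ee (a : C) : continuous (fun x : C => ee (a * x) : C).
Proof. by move=> z; exact: diff_cont (diff_ee a z). Qed.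

Lemma cont_RtoC : continuous (fun t : R => RtoC t).
Proof.
apply/contR => x e e0; apply/nearR; exists e => // y.
by rewrite -rmorphB nrm_real.
Qed.

Lemma cont_comp_RtoC (f : C -> C) : continuous f -> continuous (fun t : R => f (RtoC t)).
Proof. move=> cf x; exact: (@continuous_comp _ _ _ (fun t : R => RtoC t) f x (@cont_RtoC x) (cf _)). Qed.

Lemma cont_eeR (a : C) : continuous (fun t : R => ee (a * RtoC t)).
Proof. exact: (cont_comp_RtoC (@cont_ee a)). Qed.

Lemma cint_ee (k : int) : cint (fun t => ee (k%:~R * RtoC t)) = (k == 0)%:R.
Proof.
have [->|k0] := eqVneq k 0.
  rewrite -(cint_cst 1); apply: eq_cint => t; by rewrite mul0r ee0.
have c0 : twopii * k%:~R != 0 :> C by rewrite mulf_neq0 ?twopii_neq0// intr_eq0.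
have dP x : cderiv (fun x => ee (k%:~R * x) / (twopii * k%:~R)) x (ee (k%:~R * x) : C).
  move=> e e0; have c0' : 0 < nrm (twopii * k%:~R : C) by rewrite nrm_gt0.
  have [d d0 H] := @cderiv_ee k%:~R x _ (mulr_gt0 e0 c0'); exists d => // h /H.
  set u := ee _; set v := ee _ => h2.
  rewrite (_ : _ - _ = (u - v - h * (twopii * k%:~R * v)) / (twopii * k%:~R)); last by move: c0; move: (twopii * _) => c c0; field.
  by rewrite nrmM nrmV ler_pdivrMr// [leRHS]mulrAC.
have := cint_prim 0 1 (@cont_ee k%:~R) dP.
rewrite mul1r add0r mulr1 mulr0 ee_int ee0 subrr => h; rewrite /= mulr0n -h.
by apply: eq_cint => t; rewrite add0r mulr1.
Qed.

End Exponentials.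

Section Log.
Context {R : realType}.
Local Notation C := (Cplx R).

Lemma cexp_surj (x : C) : x != 0 -> exists l, cexp l = x.
Proof.
move=> x0; have n0 : 0 < nrm x by rewrite nrm_gt0.
pose a := complex.Re x / nrm x; pose b := complex.Im x / nrm x.
have ab : a ^+ 2 + b ^+ 2 = 1.
  rewrite /a /b !exprMn -mulrDl exprVn (_ : _ + _ = nrm x ^+ 2).
    by rewrite divff// expf_neq0// lt0r_neq0.
  by case: (x) => c d; rewrite /nrm sqr_sqrtr// addr_ge0 ?sqr_ge0.
have a1 : -1 <= a <= 1.
  have := sqr_ge0 b => b2; apply/andP; split; nra.
have ca : cos (acos a) = a by apply: acosK; rewrite in_itv.
have sa : sin (acos a) = Num.sqrt (1 - a ^+ 2) by exact: sin_acos.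
have bs : Num.sqrt (1 - a ^+ 2) = `|b|.
  by rewrite -ab addrC addKr sqrtr_sqr.
have [t [ct st]] : exists t, cos t = a /\ sin t = b.
  have [b0|b0] := ger0P b.
    by exists (acos a); rewrite ca sa bs ger0_norm.
  by exists (- acos a); rewrite cosN sinN ca sa bs ltr0_norm// opprK.
exists (ln (nrm x) +i* t); apply: complex_ext; rewrite /= lnK ?posrE// ?ct ?st.
  by rewrite /a mulrC divfK// lt0r_neq0.
by rewrite /b mulrC divfK// lt0r_neq0.
Qed.

Lemma ee_surj (x : C) : x != 0 -> exists l, ee l = x.
Proof.
move=> /cexp_surj[l <-]; exists (l / twopii).
by rewrite /ee mulrC divfK ?twopii_neq0.
Qed.

End Log.

(** * Fourier coefficients determine a periodic entire function *)

Section Fourier.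
Context {R : realType}.
Local Notation C := (Cplx R).
Local Notation RtoC t := ((t : R)%:C : C).
Local Notation ek k t := (ee ((k : int)%:~R * RtoC t)).

Lemma cont_conj (g : R -> C) : continuous g -> continuous (fun t => (g t)^*%C : C).
Proof.
move=> /contR H; apply/contR => x e /(H x); apply: filterS => t.
suff -> : nrm ((g t)^*%C - (g x)^*%C) = nrm (g t - g x) by [].
by case: (g t) => a b; case: (g x) => c d; rewrite /nrm /= -opprD sqrrN.
Qed.

Lemma cint_conj (g : R -> C) : continuous g ->
  cint (fun t => (g t)^*%C : C) = (cint g)^*%C :> C.
Proof.
move=> cg; apply: complex_ext => /=.
  by congr rint; apply/funext => t; case: (g t).
rewrite -mulN1r -rintZ; last exact: cont_Im.
by congr rint; apply/funext => t; case: (g t) => a b /=; rewrite mulN1r.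
Qed.

Lemma cont_sum (I : Type) (r : seq I) (g : I -> R -> C) :
  (forall i, continuous (g i)) -> continuous (fun t => \sum_(i <- r) g i t).
Proof.
move=> cg; elim: r => [|i r IH].
  rewrite (_ : (fun t => _) = (fun=> 0)); first exact: cst_continuous.
  by apply/funext => t; rewrite big_nil.
rewrite (_ : (fun t => _) = (fun t => g i t + \sum_(j <- r) g j t)).
  exact: (ccontD (cg i) IH).
by apply/funext => t; rewrite big_cons.
Qed.

Lemma cint_sum (I : Type) (r : seq I) (g : I -> R -> C) : (forall i, continuous (g i)) ->
  cint (fun t => \sum_(i <- r) g i t) = \sum_(i <- r) cint (g i).
Proof.
move=> cg; elim: r => [|i r IH].
  by rewrite big_nil -[RHS](cint_cst 0); apply: eq_cint => t; rewrite big_nil.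
rewrite big_cons -IH -(cintD (cg i) (@cont_sum _ r _ cg)).
by apply: eq_cint => t; rewrite big_cons.
Qed.

Lemma ek_conj (k : int) (t : R) : (ek k t)^*%C = ek (- k) t :> C.
Proof.
have -> : k%:~R * RtoC t = RtoC (k%:~R * t) by rewrite (rmorphM (real_complex R)) (rmorph_int (real_complex R)).
have -> : (- k)%:~R * RtoC t = RtoC (- (k%:~R * t)) by rewrite (rmorphN (real_complex R)) (rmorphM (real_complex R)) (rmorph_int (real_complex R)) mulrNz mulNr.
by rewrite !ee_real mulrN cosN sinN.
Qed.

Lemma ekD (k l : int) (t : R) : ek (k + l) t = ek k t * ek l t.
Proof. by rewrite intrD mulrDl eeD. Qed.

(** If infinitely many Fourier coefficients of h equal al, then the square norm of h
minus al times the sum of M of these characters is the square norm of h minus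
M |al|^2; it is nonnegative for all M only if al = 0. *)
Lemma bessel (h : R -> C) (kap : nat -> int) (al : C) : continuous h -> injective kap ->
  (forall j, cint (fun t => h t * ek (- kap j) t) = al) -> al = 0.
Proof.
move=> ch ki H.
have cek k : continuous (fun t : R => ek k t) by exact: cont_eeR.
have chc : continuous (fun t => (h t)^*%C : C) := cont_conj ch.
pose s M t : C := \sum_(j < M) ek (kap j) t.
pose sc M t : C := \sum_(j < M) ek (- kap j) t.
have cs M : continuous (s M) by apply: (@cont_sum _ _ (fun j t => ek (kap (nat_of_ord j)) t)) => j; exact: cek.
have csc M : continuous (sc M) by apply: (@cont_sum _ _ (fun j t => ek (- kap (nat_of_ord j)) t)) => j; exact: cek.
have scE M t : (s M t)^*%C = sc M t :> C.
  by rewrite /s rmorph_sum /sc; apply: eq_bigr => j _; exact: ek_conj.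
have I1 M : cint (fun t => h t * sc M t) = M%:R * al.
  rewrite (_ : (fun t => _) = (fun t => \sum_(j < M) h t * ek (- kap j) t)); last first.
    by apply/funext => t; rewrite /sc mulr_sumr.
  rewrite (@cint_sum _ _ (fun j t => h t * ek (- kap (nat_of_ord j)) t)); last first.
    by move=> j; exact: (ccontM ch (@cek (- kap j))).
  by rewrite (eq_bigr (fun=> al)) // sumr_const card_ord mulr_natl.
have I2 M : cint (fun t => (h t)^*%C * s M t : C) = M%:R * al^*%C.
  rewrite -[RHS](_ : (M%:R * al)^*%C = _); last by rewrite (rmorphM (@conjc R)) (rmorph_nat (@conjc R)).
  rewrite -I1 -cint_conj; last exact: (ccontM ch (csc M)).
  by apply: eq_cint => t; rewrite -scE (rmorphM (@conjc R)) /= conjcK.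
have I3 M : cint (fun t => s M t * sc M t) = M%:R.
  rewrite (_ : (fun t => _) = (fun t => \sum_(j < M) s M t * ek (- kap j) t)); last first.
    by apply/funext => t; rewrite /sc mulr_sumr.
  rewrite (@cint_sum _ _ (fun j t => s M t * ek (- kap (nat_of_ord j)) t)); last first.
    by move=> j; exact: (ccontM (cs M) (@cek (- kap j))).
  rewrite (eq_bigr (fun=> 1)) ?sumr_const ?card_ord // => j _.
  rewrite (_ : (fun t => _) = (fun t => \sum_(i < M) ek (kap i - kap j) t)); last first.
    by apply/funext => t; rewrite /s mulr_suml; apply: eq_bigr => i _; rewrite ekD.
  rewrite (@cint_sum _ _ (fun i t => ek (kap (nat_of_ord i) - kap j) t)); last first.
    by move=> i; exact: cek.
  rewrite (bigD1 j) //= subrr cint_ee eqxx big1 ?addr0// => i ij.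
  rewrite cint_ee subr_eq0 (_ : _ == _ = false)//.
  by apply/negbTE; apply: contra ij => /eqP/ki/val_inj ->.
pose A := complex.Re (cint (fun t => h t * (h t)^*%C : C)).
have key (M : nat) : M%:R * nrm al ^+ 2 <= A.
  pose g t : C := h t - al * s M t.
  have cg : continuous g := ccontB ch (@contZ _ _ al (cs M)).
  have : 0 <= complex.Re (cint (fun t => g t * (g t)^*%C : C)).
    apply: rint_ge0 => t _; case: (g t) => a b /=.
    by rewrite mulrN opprK -!expr2 addr_ge0 ?sqr_ge0.
  have -> : cint (fun t => g t * (g t)^*%C : C) =
      cint (fun t => h t * (h t)^*%C : C) - M%:R * (al * al^*%C).
    transitivity (cint (fun t => ((h t * (h t)^*%C : C) - al^*%C * (h t * sc M t))
       - (al * ((h t)^*%C * s M t) - (al * al^*%C) * (s M t * sc M t)))).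
      by apply: eq_cint => t; rewrite /g rmorphB rmorphM /= scE; ring.
    have c1 := ccontM ch chc; have c2 := ccontM ch (csc M).
    have c3 := ccontM chc (cs M); have c4 := ccontM (cs M) (csc M).
    rewrite (cintB (ccontB c1 (contZ c2)) (ccontB (contZ c3) (contZ c4))).
    rewrite (cintB c1 (contZ c2)) (cintB (contZ c3) (contZ c4)).
    rewrite (cintZ _ c2) (cintZ _ c3) (cintZ _ c4) I1 I2 I3; ring.
  rewrite cReB -/A subr_ge0; apply: le_trans.
  have -> : al * al^*%C = RtoC (nrm al ^+ 2).
    case: (al) => a b; rewrite /nrm sqr_sqrtr ?addr_ge0 ?sqr_ge0//.
    by apply: complex_ext => /=; ring.
  by rewrite cReM /= mulr0 subr0 -(rmorph_nat (real_complex R)).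
apply/eqP; rewrite -nrm_eq0; apply/negPn/negP => n0.
have p0 : 0 < nrm al ^+ 2 by rewrite exprn_gt0// lt_def n0 nrm_ge0.
have := key (Num.truncn (A / nrm al ^+ 2)).+1.
by apply/negP; rewrite -ltNge -ltr_pdivrMr//; exact: truncnS_gt.
Qed.

End Fourier.

Section FourierUniq.
Context {R : realType}.
Local Notation C := (Cplx R).
Local Notation RtoC t := ((t : R)%:C : C).
Local Notation ek k t := (ee ((k : int)%:~R * RtoC t)).

Definition entire (f : C -> C) := forall x, differentiable (f : C -> C) x.

Lemma entire_cont f : entire f -> continuous (f : C -> C).
Proof. by move=> ef x; exact: diff_cont. Qed.

Lemma entireM f g : entire f -> entire g -> entire (fun x => f x * g x).
Proof. by move=> ef eg x; exact: (differentiableM (ef x) (eg x)). Qed.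

Lemma entire_comp f g : entire f -> entire g -> entire (fun x => f (g x)).
Proof. by move=> ef eg x; exact: (differentiable_comp (eg x) (ef _)). Qed.

Lemma entireD f g : entire f -> entire g -> entire (fun x => f x + g x).
Proof. by move=> ef eg x; exact: (differentiableD (ef x) (eg x)). Qed.

Lemma entire_cst (c : C) : entire (fun=> c).
Proof. by move=> x; exact: differentiable_cst. Qed.

Lemma entire_id : entire id.
Proof. by move=> x; apply/derivable1_diffP; exact: derivable_id. Qed.

Lemma entire_ee a : entire (fun x => ee (a * x)).
Proof. by move=> x; exact: diff_ee. Qed.

Lemma entire_shift (w : C) (f : C -> C) : entire f -> entire (fun x => f (w + x)).
Proof.
move=> ef; apply: (entire_comp ef); apply: entireD; [exact: entire_cst|exact: entire_id].
Qed.

Lemma entire_sum (I : finType) (g : I -> C -> C) : (forall i, entire (g i)) ->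
  entire (fun z => \sum_i g i z).
Proof.
move=> eg; elim: (index_enum I) => [|k s IH].
  rewrite (_ : (fun z => _) = (fun=> 0)); first exact: entire_cst.
  by apply/funext => z; rewrite big_nil.
rewrite (_ : (fun z => _) = (fun z => g k z + \sum_(i <- s) g i z)); first exact: entireD.
by apply/funext => z; rewrite big_cons.
Qed.

(** Goursat's theorem for the parallelogram with sides 1 and w: by periodicity the
two sides parallel to w cancel. *)
Lemma mean_shift (f : C -> C) (w : C) : entire f -> (forall z, f (z + 1) = f z) ->
  cint (fun t => f (w + RtoC t)) = cint (fun t => f (RtoC t)).
Proof.
move=> ef per.
have := goursat 0 1 w ef; rewrite /circulation !add0r.
have -> : seg f 1 w = seg f 0 w.
  rewrite /seg; congr (_ * _); apply: eq_cint => t.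
  by rewrite addrC per add0r.
have E (a b c : C) : a + b - c - b = a - c by ring.
rewrite E => /eqP; rewrite subr_eq0 => /eqP.
rewrite /seg !mul1r => h.
transitivity (cint (fun t => f (w + RtoC t * 1))).
  by apply: eq_cint => t; rewrite mulr1.
rewrite -h; apply: eq_cint => t; by rewrite add0r mulr1.
Qed.

Definition slope (f : C -> C) (l : C) (s : C) : C :=
  if s == 0 then l else (f s - f 0) / s.

Lemma slope_cont (f : C -> C) (l : C) : cderiv f 0 l ->
  {for 0, continuous (slope f l : C -> C)}.
Proof.
move=> df; apply/(cvgC (nbhs_filter _)) => e e0.
have e20 : 0 < e / 2 by lra.
have [d d0 H] := df _ e20; apply/nearC; exists d => // h; rewrite subr0 => hd.
rewrite /slope eqxx; case: eqVneq => [|h0]; first by rewrite subrr nrm0.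
have hp : 0 < nrm h by rewrite nrm_gt0.
have := H h hd; rewrite add0r => {}H.
rewrite (_ : _ - l = (f h - f 0 - h * l) / h); last by field.
rewrite nrmM nrmV; apply: (@le_lt_trans _ _ (e / 2)); last lra.
by rewrite ler_pdivrMr.
Qed.

(** The quotient h = (f - f(0)) / (e - 1) extends continuously to the real line, e
being the character of period 1. From h (e - 1) = f - f(0) the coefficients of h
satisfy hk (k - 1) = hk k for k <> 0 and hk (-1) - hk 0 = - f(0). They are thus
constant on the nonnegative and on the negative integers, hence zero by Bessel's
inequality, and f(0) = 0. *)
Lemma fourier_uniq0 (f : C -> C) : entire f -> (forall z, f (z + 1) = f z) ->
  (forall k : int, cint (fun t => f (RtoC t) * ek (- k) t) = 0) -> f 0 = 0.
Proof.
move=> ef per H.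
have [l dl] := diff_cderiv (ef 0).
have de : cderiv ee (0 : C) twopii.
  have := @cderiv_ee R 1 0; rewrite mulr1 mul1r ee0 mulr1.
  by under eq_fun do rewrite mul1r.
pose h (t : R) : C := if ee (RtoC t) == 1 then l / twopii
  else (f (RtoC t) - f 0) / (ee (RtoC t) - 1).
have fint (z : C) (n : int) : f (n%:~R + z) = f z.
  have nat_ (m : nat) y : f (m%:R + y) = f y.
    elim: m y => [|m IH] y; first by rewrite add0r.
    by rewrite -natr1 -addrA IH addrC per.
  case: n => m; first by rewrite -pmulrn nat_.
  by rewrite NegzE mulrNz -pmulrn -(nat_ m.+1) addNKr.
(* At the zeros of e - 1, the integers, the right-hand side vanishes by
   periodicity, whatever the value of h. *)
have chv t : h t * (ee (RtoC t) - 1) = f (RtoC t) - f 0.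
  rewrite /h; case: eqVneq => [e1|e1]; last by rewrite divfK// subr_eq0.
  have [n ->] := ee_eq1 e1; by rewrite ee_int subrr mulr0 -[n%:~R]addr0 fint subrr.
have cf := entire_cont ef.
have cfR : continuous (fun t : R => f (RtoC t)) := cont_comp_RtoC cf.
have ceR : continuous (fun t : R => ee (RtoC t) : C).
  have := @cont_eeR R 1; by under eq_fun do rewrite mul1r.
(* Near 0, h is the quotient of the difference quotients of f and of e. *)
have ch0 : {for 0, continuous (h : R -> C)}.
  have c1 : {for 0, continuous (fun s : C => slope f l s / slope ee twopii s)}.
    apply: (continuousM (slope_cont dl)); apply: continuousV (slope_cont de).
    by rewrite /slope eqxx twopii_neq0.
  have c2 : {for (0 : R), continuous (fun t : R => slope f l (RtoC t) / slope ee twopii (RtoC t))}.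
    by apply: (@continuous_comp _ _ _ (fun t : R => RtoC t)
      (fun s : C => slope f l s / slope ee twopii s) 0 (@cont_RtoC R 0)); rewrite rmorph0.
  move/(cvgC (nbhs_filter _)): c2 => c2; apply/(cvgC (nbhs_filter _)) => e /c2/nearR[d d0 {}c2].
  apply/nearR; exists (Num.min d 1); first by rewrite lt_min d0 ltr01.
  move=> t; rewrite lt_min => /andP[td t1]; have := c2 t td.
  suff E s : `|s| < 1 -> h s = slope f l (RtoC s) / slope ee twopii (RtoC s).
    by rewrite !E ?normr0// -[t]subr0.
  move=> s1; rewrite /h /slope ee0.
  have -> : (ee (RtoC s) == 1) = (RtoC s == 0).
    apply/eqP/eqP => [/ee_eq1[n nE]|->]; last exact: ee0.
    suff n0 : n = 0 by rewrite nE n0.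
    have : RtoC s = RtoC n%:~R by rewrite nE (rmorph_int (real_complex R)).
    move/complexI => sE; move: s1; rewrite sE -intr_norm -[1]/(1%:~R) ltr_int.
    by case: (n) => -[].
  case: eqVneq => // s0; rewrite invf_div mulrA divfK//.
have ch : continuous (h : R -> C).
  move=> x; have [e1|e1] := eqVneq (ee (RtoC x)) 1.
    have [n nE] := ee_eq1 e1.
    have xE : x = n%:~R.
      by apply: (@complexI R); rewrite (rmorph_int (real_complex R)).
    have hs s : h (n%:~R + s) = h s.
      have nR : RtoC (n%:~R + s) = n%:~R + RtoC s.
        by rewrite (rmorphD (real_complex R)) (rmorph_int (real_complex R)).
      by rewrite /h nR eeD ee_int mul1r fint.
    move/(cvgC (nbhs_filter _)): ch0 => ch0; apply/(cvgC (nbhs_filter _)) => e /ch0/nearR[d d0 {}ch0].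
    apply/nearR; exists d => // t tx; have := ch0 (t - x); rewrite subr0 => /(_ tx).
    by rewrite -(hs (t - x)) -(hs 0) -xE addr0 [x + (t - x)]addrC subrK.
  have e1' : ee (RtoC x) - 1 != 0 by rewrite subr_eq0.
  have c1 : {for x, continuous (fun t : R => (f (RtoC t) - f 0) / (ee (RtoC t) - 1))}.
    apply: (continuousM (ccontB cfR (@cst_continuous _ _ _) (x := x))).
    by apply: continuousV (ccontB ceR (@cst_continuous _ _ _) (x := x)).
  have n0 : 0 < nrm (ee (RtoC x) - 1) by rewrite nrm_gt0.
  have /contR/(_ x _ n0)/nearR[d d0 D] := ceR.
  have E t : `|t - x| < d -> h t = (f (RtoC t) - f 0) / (ee (RtoC t) - 1).
    move=> /D; rewrite /h; case: eqVneq => // ->.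
    by rewrite nrmBC ltxx.
  move/(cvgC (nbhs_filter _)): c1 => c1; apply/(cvgC (nbhs_filter _)) => e /c1/nearR[d' d'0 {}c1].
  apply/nearR; exists (Num.min d d'); first by rewrite lt_min d0 d'0.
  move=> t; rewrite lt_min => /andP[td td']; have := c1 t td'.
  by rewrite !E// subrr normr0.
have cek k : continuous (fun t : R => ek k t) by exact: cont_eeR.
pose hk (k : int) := cint (fun t => h t * ek (- k) t).
have rec (k : int) : hk (k - 1) - hk k = - (k == 0)%:R * f 0.
  rewrite /hk -(cintB (ccontM ch (@cek _)) (ccontM ch (@cek _))).
  transitivity (cint (fun t => f (RtoC t) * ek (- k) t - f 0 * ek (- k) t)).
    apply: eq_cint => t; rewrite -mulrBl -chv opprB addrC ekD mul1r; ring.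
  rewrite (cintB (ccontM cfR (@cek _)) (contZ (@cek _))) H (cintZ _ (@cek _)) cint_ee.
  by rewrite oppr_eq0 sub0r mulNr mulrC.
have pos (j : nat) : hk j%:Z = hk 0.
  elim: j => [|j IH] //; have := rec j.+1%:Z.
  by rewrite /= oppr0 mul0r (_ : j.+1%:Z - 1 = j%:Z) ?IH => [/eqP|]; [rewrite subr_eq0 => /eqP|lia].
have neg (j : nat) : hk (- j%:Z - 1) = hk (-1).
  elim: j => [|j IH]; first by rewrite oppr0 sub0r.
  have := rec (- j.+1%:Z); rewrite oppr_eq0 /= oppr0 mul0r (_ : - j.+1%:Z = - j%:Z - 1); last by lia.
  by rewrite IH => /eqP; rewrite subr_eq0 => /eqP.
(* Infinitely many coefficients equal hk 0, and infinitely many equal hk (-1).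
   *)
have z0 : hk 0 = 0.
  apply: (@bessel _ h (fun j => j%:Z)) => //; by move=> i j [].
have z1 : hk (-1) = 0.
  apply: (@bessel _ h (fun j => - j%:Z - 1)) => //; by move=> i j; lia.
have := rec 0; rewrite eqxx sub0r z0 z1 subrr mulN1r => e0; by rewrite -[LHS]opprK -e0 oppr0.
Qed.

(** A translate of f has the same Fourier coefficients up to nonzero factors, which
reduces every point to the origin. *)
Theorem fourier_uniq (f : C -> C) : entire f -> (forall z, f (z + 1) = f z) ->
  (forall k : int, cint (fun t => f (RtoC t) * ek (- k) t) = 0) -> forall z, f z = 0.
Proof.
move=> ef per H z; rewrite -[z]addr0.
apply: (@fourier_uniq0 (fun x => f (z + x))); first exact: entire_shift.
  by move=> x; rewrite addrA per.
move=> k.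
pose g x := f x * ee ((- k)%:~R * x).
have eg : entire g by apply: entireM => //; exact: entire_ee.
have pg x : g (x + 1) = g x by rewrite /g per mulrDr eeD mulr1 ee_int mulr1.
have := mean_shift z eg pg; rewrite /g H => h0.
transitivity (ee (k%:~R * z) * cint (fun t => f (z + RtoC t) * ee ((- k)%:~R * (z + RtoC t)))).
  rewrite -cintZ.
    apply: eq_cint => t; rewrite mulrDr eeD mulrCA; congr (_ * _).
    by rewrite mulrA -eeD -mulrDl -intrD subrr mul0r ee0 mul1r.
  exact: (cont_comp_RtoC (entire_cont (entire_shift z eg))).
by rewrite h0 mulr0.
Qed.

End FourierUniq.

(** * Symmetric sums over the integers *)

Section ZSum.
Context {R : realType}.
Local Notation C := (Cplx R).

Definition wsum (a : int -> C) (N : nat) : C := \sum_(k < N.*2.+1) a (k%:Z - N%:Z).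

(** Limit of symmetric partial sums, the convention of the series theta_bar; all
series below converge geometrically, so no other summation would differ. *)
Definition zsum (a : int -> C) : C := limn (wsum a).

Lemma wsum0 a : wsum a 0 = a 0.
Proof. by rewrite /wsum /= big_ord_recl big_ord0 addr0; congr a. Qed.

Lemma wsumS a N : wsum a N.+1 = wsum a N + (a N.+1%:Z + a (- N.+1%:Z)).
Proof.
rewrite /wsum doubleS big_ord_recl big_ord_recr /= [LHS]addrC -[LHS]addrA; congr (_ + _).
  apply: eq_bigr => i _; congr a; rewrite /bump/=; lia.
by congr (a _ + a _); rewrite ?/bump /=; lia.
Qed.

Lemma eq_zsum a a' : a =1 a' -> zsum a = zsum a'.
Proof. by move=> /funext ->. Qed.

Lemma zsum_opp (a : int -> C) : zsum (fun m => a (- m)) = zsum a.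
Proof.
rewrite /zsum; congr (limn _); apply/funext => N; elim: N => [|N IH].
  by rewrite !wsum0 oppr0.
by rewrite !wsumS IH opprK [a (- _) + _]addrC.
Qed.

Variable b : R.
Hypothesis b1 : 1 < b.
Let b0 : 0 < b. Proof. exact: lt_trans b1. Qed.

(** The constant of the tail estimate [wsum_tail], the same for all series. *)
Definition tailc : R := 4 * (b / (b - 1)).

Lemma tailc_ge0 : 0 <= tailc.
Proof. by rewrite /tailc mulr_ge0// divr_ge0// ?subr_ge0 ltW. Qed.

(** Geometric decay with an explicit constant K, in terms of which sums, tails and
double series are bounded linearly. *)
Definition zdecay (K : R) (a : int -> C) := forall m, nrm (a m) <= K / b ^+ `|m|%N.

Lemma zdecay_ge0 K a : zdecay K a -> 0 <= K.
Proof. by move=> /(_ 0); rewrite absz0 expr0 divr1; apply: le_trans; exact: nrm_ge0. Qed.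

Lemma wsum_step K a N : zdecay K a -> nrm (wsum a N.+1 - wsum a N) <= 2 * K / b ^+ N.
Proof.
move=> aK; rewrite wsumS addrAC subrr add0r; apply: (le_trans (nrmD _ _)).
have h1 := aK N.+1%:Z; have := aK (- N.+1%:Z); rewrite abszN absz_nat in h1 * => h2.
have K0 := zdecay_ge0 aK.
have E : K / b ^+ N.+1 <= K / b ^+ N.
  by rewrite ler_wpM2l// lef_pV2 ?posrE ?exprn_gt0// ler_weXn2l ?ltW.
by rewrite mulr2n mulrDl mul1r mulrDl lerD// (le_trans _ E).
Qed.

Lemma geom_cvg0 (u : nat -> C) (l : C) (K : R) :
  (forall N, nrm (u N - l) <= K / b ^+ N) -> u @ \oo --> l.
Proof.
move=> H; apply/cvgC => e e0.
have K0 : 0 <= K by have := H 0; rewrite expr0 divr1; apply: le_trans; exact: nrm_ge0.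
have be : 0 < b - 1 by rewrite subr_gt0.
have bern N : 1 + N%:R * (b - 1) <= b ^+ N.
  elim: N => [|N IH]; first by rewrite mul0r addr0 expr0.
  have h := ler_wpM2l (ltW b0) IH; rewrite exprS; apply: le_trans h.
  rewrite -natr1 -subr_ge0 (_ : _ - _ = N%:R * (b - 1) ^+ 2); last by ring.
  by rewrite mulr_ge0 ?sqr_ge0.
exists (Num.truncn (K / e / (b - 1))).+1 => // N /= hN; apply: (le_lt_trans (H N)).
rewrite ltr_pdivrMr ?exprn_gt0// [e * _]mulrC -ltr_pdivrMr//.
apply: lt_le_trans (bern N); rewrite -ltrBlDl.
apply: (@lt_le_trans _ _ ((Num.truncn (K / e / (b - 1))).+1%:R * (b - 1))); last first.
  by rewrite ler_wpM2r ?(ltW be)// ler_nat.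
apply: (@le_lt_trans _ _ (K / e)); first by rewrite gerBl.
by rewrite -ltr_pdivrMr//; exact: truncnS_gt.
Qed.

Lemma lim_geom (u : nat -> C) (l : C) (K : R) :
  (forall N, nrm (u N - l) <= K / b ^+ N) -> limn u = l.
Proof. by move=> /geom_cvg0; apply: cvg_lim; exact: norm_hausdorff. Qed.

Lemma wsum_tail K a N : zdecay K a -> nrm (wsum a N - zsum a) <= tailc * K / b ^+ N.
Proof.
move=> aK; have [l lP] := geom_cauchy b1 (fun k => wsum_step k aK).
rewrite /zsum (lim_geom lP); apply: (le_trans (lP N)).
by rewrite le_eqVlt; apply/orP; left; apply/eqP; rewrite /tailc; ring.
Qed.

Lemma zsumP K a l : (forall N, nrm (wsum a N - l) <= K / b ^+ N) -> zsum a = l.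
Proof. exact: lim_geom. Qed.

Lemma zsum_bound K a : zdecay K a -> nrm (zsum a) <= (tailc + 1) * K.
Proof.
move=> aK; have := wsum_tail 0 aK; rewrite expr0 divr1 wsum0 => h.
have := aK 0; rewrite absz0 expr0 divr1 => h0.
have -> : zsum a = a 0 - (a 0 - zsum a) by ring.
by apply: (le_trans (nrmB _ _)); lra.
Qed.

Lemma wsum_bound K a N : zdecay K a -> nrm (wsum a N) <= (2 * tailc + 1) * K.
Proof.
move=> aK; have h := wsum_tail N aK; have h0 := zsum_bound aK.
have K0 := zdecay_ge0 aK.
have h1 : tailc * K / b ^+ N <= tailc * K.
  rewrite ler_pdivrMr ?exprn_gt0//; apply: ler_peMr; first exact: mulr_ge0 tailc_ge0 K0.
  by rewrite exprn_ege1// ltW.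
have -> : wsum a N = (wsum a N - zsum a) + zsum a by ring.
by apply: (le_trans (nrmD _ _)); lra.
Qed.

Lemma zdecayD K L a a' : zdecay K a -> zdecay L a' -> zdecay (K + L) (fun m => a m + a' m).
Proof. by move=> aK bL m; apply: (le_trans (nrmD _ _)); rewrite mulrDl lerD. Qed.

Lemma zdecayZ K a c : zdecay K a -> zdecay (nrm c * K) (fun m => c * a m).
Proof. by move=> aK m; rewrite nrmM -mulrA ler_wpM2l ?nrm_ge0. Qed.

Lemma zsumD K L a a' : zdecay K a -> zdecay L a' ->
  zsum (fun m => a m + a' m) = zsum a + zsum a'.
Proof.
move=> aK bL; apply: (@zsumP (tailc * K + tailc * L)) => N.
rewrite /wsum big_split /= -!/(wsum _ _).
rewrite (_ : _ - _ = (wsum a N - zsum a) + (wsum a' N - zsum a')); last by rewrite /wsum; ring.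
apply: (le_trans (nrmD _ _)); rewrite mulrDl; apply: lerD; exact: wsum_tail.
Qed.

Lemma zsumZ K a c : zdecay K a -> zsum (fun m => c * a m) = c * zsum a.
Proof.
move=> aK; apply: (@zsumP (nrm c * (tailc * K))) => N.
have -> : wsum (fun m => c * a m) N = c * wsum a N by rewrite /wsum mulr_sumr.
rewrite -mulrBr nrmM -mulrA ler_wpM2l ?nrm_ge0//; exact: wsum_tail.
Qed.

Lemma zsumB K L a a' : zdecay K a -> zdecay L a' ->
  zsum (fun m => a m - a' m) = zsum a - zsum a'.
Proof.
move=> aK bL; rewrite -mulN1r -(zsumZ _ bL) -(zsumD aK (zdecayZ _ bL)).
by apply: eq_zsum => m; rewrite mulN1r.
Qed.

(** Shifting the index changes a symmetric partial sum by two boundary terms, which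
tend to 0. *)
Lemma zsum_shift K a : zdecay K a -> zsum (fun m => a (m + 1)) = zsum a.
Proof.
move=> aK; apply: (@zsumP ((tailc + 2) * K)) => N.
have E : wsum (fun m => a (m + 1)) N = wsum a N + a (N%:Z + 1) - a (- N%:Z).
  elim: N => [|N IH]; first by rewrite !wsum0 oppr0 !add0r; ring.
  rewrite !wsumS IH.
  have -> : - N.+1%:Z + 1 = - N%:Z by lia.
  have -> : N%:Z + 1 = N.+1%:Z by lia.
  ring.
rewrite E (_ : _ - zsum a = (wsum a N - zsum a) + (a (N%:Z + 1) - a (- N%:Z))); last by ring.
have K0 := zdecay_ge0 aK; have p2 : 0 < b ^+ N by rewrite exprn_gt0.
apply: (le_trans (nrmD _ _)); rewrite (_ : (tailc + 2) * K = tailc * K + (K + K)); last by ring.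
rewrite mulrDl lerD//; first exact: wsum_tail.
apply: (le_trans (nrmB _ _)); rewrite mulrDl lerD//; last first.
  by have := aK (- N%:Z); rewrite abszN absz_nat.
apply: (le_trans (aK _)); rewrite (_ : `|(N%:Z + 1)%R|%N = N.+1); last by lia.
by rewrite ler_wpM2l// lef_pV2 ?posrE ?exprn_gt0// ler_weXn2l ?ltW.
Qed.

Lemma zsum_shiftn K a (n : int) : (forall n, exists K, zdecay K (fun m => a (m + n))) ->
  zdecay K a -> zsum (fun m => a (m + n)) = zsum a.
Proof.
move=> aD aK.
have pos (j : nat) : zsum (fun m => a (m + j%:Z)) = zsum a.
  elim: j => [|j IH]; first by apply: eq_zsum => m; rewrite addr0.
  have [K' K'P] := aD j%:Z; rewrite -IH -(zsum_shift K'P).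
  by apply: eq_zsum => m; congr a; lia.
have neg (j : nat) : zsum (fun m => a (m - j%:Z)) = zsum a.
  elim: j => [|j IH]; first by apply: eq_zsum => m; rewrite subr0.
  have [K' K'P] := aD (- j.+1%:Z); rewrite -IH -(zsum_shift K'P).
  by apply: eq_zsum => m; congr a; lia.
by case: n => j; [exact: pos|rewrite NegzE; exact: neg].
Qed.

(** Both iterated sums are limits of the partial sums over the squares
|m| <= N, |n| <= N. *)
Lemma zsum_swap K (t : int -> int -> C) :
  (forall m n, nrm (t m n) <= K / b ^+ `|m|%N / b ^+ `|n|%N) ->
  zsum (fun m => zsum (t m)) = zsum (fun n => zsum (fun m => t m n)).
Proof.
move=> tK.
have half (s : int -> int -> C) : (forall m n, nrm (s m n) <= K / b ^+ `|m|%N / b ^+ `|n|%N) ->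
    forall N, nrm (wsum (fun m => wsum (s m) N) N - zsum (fun m => zsum (s m))) <= (tailc * (tailc + 1) + (2 * tailc + 1) * tailc) * K / b ^+ N.
  move=> sK N.
  have s1 m : zdecay (K / b ^+ `|m|%N) (s m) by move=> n; exact: sK.
  have s2 : zdecay ((tailc + 1) * K) (fun m => zsum (s m)).
    by move=> m; apply: (le_trans (zsum_bound (s1 m))); rewrite mulrA.
  have s3 : zdecay (tailc * K / b ^+ N) (fun m => wsum (s m) N - zsum (s m)).
    move=> m; apply: (le_trans (wsum_tail N (s1 m))).
    by rewrite mulrA mulrAC.
  have -> : wsum (fun m => wsum (s m) N) N - zsum (fun m => zsum (s m)) =
     wsum (fun m => wsum (s m) N - zsum (s m)) N +
     (wsum (fun m => zsum (s m)) N - zsum (fun m => zsum (s m))).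
    have -> : wsum (fun m => wsum (s m) N - zsum (s m)) N =
      wsum (fun m => wsum (s m) N) N - wsum (fun m => zsum (s m)) N.
      by rewrite /wsum sumrB.
    ring.
  apply: (le_trans (nrmD _ _)).
  have := wsum_bound N s3; have := wsum_tail N s2; move: (nrm _) (nrm _) => x y h1 h2.
  apply: (le_trans (lerD h2 h1)); rewrite le_eqVlt; apply/orP; left; apply/eqP.
  by field; rewrite expf_neq0// lt0r_neq0.
have h1 := half t tK.
have h2 := half (fun n m => t m n) (fun n m => _).
have {h2} H2 N : nrm (wsum (fun m => wsum (t m) N) N -
    zsum (fun n => zsum (fun m => t m n))) <= (tailc * (tailc + 1) + (2 * tailc + 1) * tailc) * K / b ^+ N.
  have -> : wsum (fun m => wsum (t m) N) N = wsum (fun n => wsum (fun m => t m n) N) N.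
    by rewrite /wsum exchange_big.
  by apply: h2 => n m; rewrite mulrAC; exact: tK.
by rewrite -(lim_geom h1) -(lim_geom H2).
Qed.

End ZSum.
Arguments zdecay {R} b K a.

(** * Laurent series with rapidly decreasing coefficients *)

Section Laurent.
Context {R : realType}.
Local Notation C := (Cplx R).
Local Notation RtoC t := ((t : R)%:C : C).

Let b12 : (1 : R) < 2. Proof. by rewrite ltr1n. Qed.
Let tailc2 : tailc 2 = 8 :> R. Proof. by rewrite /tailc; field. Qed.

(** Decay faster than any geometric sequence: the coefficients of the Laurent series
in e(w) that converge for every complex w. *)
Definition rapid (a : int -> C) := forall r : R, 0 < r ->
  exists K, forall m, nrm (a m) * r ^+ `|m|%N <= K.

Definition geom_bounded (r : R) (b : int -> C) := exists2 D, 0 <= D & forall m, nrm (b m) <= D * r ^+ `|m|%N.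

Lemma rapid_decay a : rapid a -> exists K, zdecay 2 K a.
Proof.
move=> /(_ 2 ltac:(by []))[K H]; exists K => m.
by rewrite ler_pdivlMr ?exprn_gt0.
Qed.

Lemma rapidM a b r : 0 < r -> rapid a -> geom_bounded r b -> rapid (fun m => a m * b m).
Proof.
move=> r0 ra [D D0 bD] s s0; have [K H] := ra (r * s) (mulr_gt0 r0 s0).
exists (K * D) => m; rewrite nrmM.
apply: (@le_trans _ _ (nrm (a m) * (D * r ^+ `|m|%N) * s ^+ `|m|%N)).
  by rewrite ler_wpM2r ?exprn_ge0 ?(ltW s0)// ler_wpM2l ?nrm_ge0.
rewrite (_ : _ * _ = nrm (a m) * (r * s) ^+ `|m|%N * D); last by rewrite exprMn; ring.
by rewrite ler_wpM2r.
Qed.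

Lemma geombM r s a b : 0 <= r -> 0 <= s -> geom_bounded r a -> geom_bounded s b ->
  geom_bounded (r * s) (fun m => a m * b m).
Proof.
move=> r0 s0 [D D0 aD] [E E0 bE]; exists (D * E); first exact: mulr_ge0.
move=> m; rewrite nrmM exprMn mulrACA.
by apply: ler_pM; rewrite ?nrm_ge0.
Qed.

Lemma nrm_exprz (x : C) (m : int) : nrm (x ^ m) <= (nrm x + nrm x^-1) ^+ `|m|%N.
Proof.
have n1 := nrm_ge0 x; have n2 := nrm_ge0 x^-1.
case: m => m; first by rewrite -exprnP nrmX /= lerXn2r ?nnegrE; lra.
by rewrite NegzE -exprz_inv -exprnP nrmX abszN absz_nat lerXn2r ?nnegrE; lra.
Qed.

Lemma geomb_ee (w : C) : geom_bounded (nrm (ee w) + nrm (ee w)^-1) (fun m => ee (m%:~R * w)).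
Proof. by exists 1 => // m; rewrite mul1r eeMz nrm_exprz. Qed.

Lemma ee_rate_gt0 (w : C) : 0 < nrm (ee w) + nrm (ee w)^-1.
Proof. by rewrite ltr_wpDr ?nrm_ge0// nrm_gt0 ee_neq0. Qed.

Lemma geomb_cst (c : C) : geom_bounded 1 (fun=> c).
Proof. by exists (nrm c); [exact: nrm_ge0|move=> m; rewrite expr1n mulr1]. Qed.

Definition laurent (a : int -> C) (w : C) : C := zsum (fun m => a m * ee (m%:~R * w)).

Lemma rapid_ee a w : rapid a -> rapid (fun m => a m * ee (m%:~R * w)).
Proof. by move=> ra; apply: rapidM ra (geomb_ee w); exact: ee_rate_gt0. Qed.

Lemma nrm_int (m : int) : nrm (m%:~R : C) = `|m|%N%:R.
Proof.
rewrite -(rmorph_int (real_complex R)) nrm_real -intr_norm -abszE.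
by rewrite -pmulrn.
Qed.

Lemma geomb_int : geom_bounded 2 (fun m => m%:~R : C).
Proof.
exists 1 => // m; rewrite mul1r nrm_int -natrX ler_nat; apply: ltnW; exact: ltn_expl.
Qed.

Lemma pow_taylor (x : C) (r : R) n : 1 <= r -> nrm x <= r ->
  nrm (x ^+ n - 1 - n%:R * (x - 1)) <= n%:R ^+ 2 * r ^+ n * nrm (x - 1) ^+ 2.
Proof.
move=> r1 xr; have r0 : 0 <= r by lra.
elim: n => [|n IH].
  by rewrite expr0 subrr mul0r subrr nrm0 expr0n /= !mul0r.
rewrite (_ : _ - _ = x * (x ^+ n - 1 - n%:R * (x - 1)) + n%:R * (x - 1) ^+ 2); last first.
  by rewrite exprS -natr1; ring.
apply: (le_trans (nrmD _ _)); rewrite (nrmM x) (nrmM n%:R) nrmX.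
have nn : nrm (n%:R : C) = n%:R by have := nrm_int n; rewrite -pmulrn.
rewrite nn; set y := nrm (x - 1) ^+ 2 in IH *.
have y0 : 0 <= y by rewrite exprn_ge0 ?nrm_ge0.
have rn : 1 <= r ^+ n.+1 by exact: exprn_ege1.
apply: (@le_trans _ _ (r * (n%:R ^+ 2 * r ^+ n * y) + n%:R * r ^+ n.+1 * y)).
  apply: lerD; first by apply: ler_pM; rewrite ?nrm_ge0.
  by rewrite ler_wpM2r// ler_peMr.
have -> : r * (n%:R ^+ 2 * r ^+ n * y) = n%:R ^+ 2 * r ^+ n.+1 * y by rewrite [r ^+ n.+1]exprS; ring.
rewrite -!mulrDl ler_wpM2r// ler_wpM2r ?exprn_ge0//.
rewrite -natr1; have : 0 <= n%:R :> R by []. nra.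
Qed.

Lemma nat_sq_le (n : nat) : (n%:R : R) ^+ 2 * 2 ^+ n + n%:R <= 2 * 8 ^+ n.
Proof.
have h : (n%:R : R) <= 2 ^+ n by rewrite -natrX ler_nat ltnW// ltn_expl.
have p1 : 1 <= (2 : R) ^+ n by rewrite exprn_ege1// ler1n.
have -> : (8 : R) ^+ n = 2 ^+ n * 2 ^+ n * 2 ^+ n by rewrite -!exprMn; congr (_ ^+ _); ring.
have n0 : 0 <= n%:R :> R by [].
move: (2 ^+ n) (n%:R) h p1 n0 => x y h p1 n0.
rewrite expr2; have : y * y <= x * x by apply: ler_pM.
nra.
Qed.

(** The remainder is uniform in m up to the factor 8^|m|, which rapidly decreasing
coefficients absorb; this justifies termwise differentiation in
[cderiv_laurent]. *)
Lemma ee_taylor (e : R) : 0 < e -> exists2 d : R, 0 < d & forall h, nrm h < d ->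
  forall m : int, nrm (ee (m%:~R * h) - 1 - h * (twopii * m%:~R)) <= 8 ^+ `|m|%N * (e * nrm h).
Proof.
move=> e0; pose c := nrm (twopii : C) + 1.
have c0 : 0 < c by rewrite /c ltr_wpDl ?nrm_ge0.
have e20 : 0 < Num.min (e / 4) 1 by rewrite lt_min; apply/andP; split; lra.
have dE := @cderiv_ee R 1 0.
have [d d0 H] := dE _ e20.
exists (Num.min d (Num.min (e / 4 / c ^+ 2) c^-1)).
  by rewrite !lt_min d0 invr_gt0 c0 divr_gt0 ?exprn_gt0//; lra.
have nat_case (h : C) : nrm h < Num.min d (Num.min (e / 4 / c ^+ 2) c^-1) ->
   forall n : nat, nrm (ee (n%:R * h) - 1 - h * (twopii * n%:R)) <= 8 ^+ n * (e * nrm h).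
  rewrite !lt_min => /and3P[hd h2 h3] n.
  have := H h hd; rewrite add0r !mul1r ee0 !mulr1 => {}H.
  have nh := nrm_ge0 h.
  have H1 : nrm (ee h - 1 - h * twopii) <= e / 4 * nrm h.
    by apply: (le_trans H); rewrite ler_wpM2r// ge_min lexx.
  have H2 : nrm (ee h - 1 - h * twopii) <= nrm h.
    by apply: (le_trans H); rewrite -[leRHS]mul1r ler_wpM2r// ge_min lexx orbT.
  have H3 : nrm (ee h - 1) <= c * nrm h.
    rewrite (_ : ee h - 1 = (ee h - 1 - h * twopii) + h * twopii); last by ring.
    by apply: (le_trans (nrmD _ _)); rewrite nrmM /c; lra.
  have H4 : nrm (ee h) <= 2.
    rewrite (_ : ee h = (ee h - 1) + 1); last by ring.
    apply: (le_trans (nrmD _ _)); rewrite nrm1.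
    have : c * nrm h < 1 by rewrite mulrC -ltr_pdivlMr// mul1r.
    lra.
  rewrite mulr_natl eeMn.
  rewrite (_ : _ - _ = (ee h ^+ n - 1 - n%:R * (ee h - 1)) + n%:R * (ee h - 1 - h * twopii)); last by ring.
  apply: (le_trans (nrmD _ _)).
  have T := @pow_taylor (ee h) 2 n _ H4.
  have {}T := T ltac:(by rewrite ler1n).
  have nn : nrm (n%:R : C) = n%:R by have := nrm_int n; rewrite -pmulrn.
  rewrite [in X in _ + X]nrmM nn.
  have B : nrm (ee h - 1) ^+ 2 <= e / 4 * nrm h.
    apply: (@le_trans _ _ ((c * nrm h) ^+ 2)).
      by rewrite lerXn2r ?nnegrE ?nrm_ge0// mulr_ge0 ?nrm_ge0// ltW.
    rewrite exprMn expr2 [nrm h ^+ 2]expr2 mulrA ler_wpM2r//.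
    by rewrite -expr2 mulrC -ler_pdivlMr ?exprn_gt0// ltW.
  have S := nat_sq_le n.
  have p0 : 0 <= (n%:R : R) ^+ 2 * 2 ^+ n by rewrite mulr_ge0 ?exprn_ge0.
  apply: (le_trans (lerD (le_trans T (ler_wpM2l p0 B)) (ler_wpM2l (ler0n R n) H1))).
  rewrite -mulrDl; have eh : 0 <= e / 4 * nrm h by rewrite mulr_ge0// ltW// divr_gt0.
  apply: (le_trans (ler_wpM2r eh S)).
  have -> : 2 * 8 ^+ n * (e / 4 * nrm h) = 8 ^+ n * (e * nrm h) / 2 by field.
  rewrite ler_pdivrMr// ler_peMr ?ler1n// mulr_ge0 ?exprn_ge0// mulr_ge0// ltW//.
move=> h hd m; case: m => n; first by rewrite -pmulrn absz_nat; exact: nat_case.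
rewrite NegzE mulrNz abszN absz_nat -pmulrn.
have := nat_case (- h); rewrite nrmN => /(_ hd n.+1).
rewrite (_ : n.+1%:R * - h = - n.+1%:R * h); last by ring.
by rewrite (_ : - h * (twopii * n.+1%:R) = h * (twopii * - n.+1%:R)); last by ring.
Qed.

(** With coefficients decaying faster than 16^(-|m|), the termwise remainder
8^|m| e |h| still sums to a multiple of e |h|. *)
Lemma cderiv_laurent (a : int -> C) (w : C) : rapid a ->
  cderiv (laurent a) w (laurent (fun m => a m * (twopii * m%:~R)) w).
Proof.
move=> ra e e0.
have rw := rapid_ee w ra.
have [K HK] := rw 16 ltac:(by []).
have K0 : 0 <= K by apply: le_trans (HK 0); rewrite mulr_ge0 ?nrm_ge0.
have K1 : 0 < 9 * K + 1 by lra.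
have [d d0 H] := ee_taylor (divr_gt0 e0 K1); exists d => // h /H {}H.
have [K2 D2] := rapid_decay (rapid_ee (w + h) ra).
have [K3 D3] := rapid_decay rw.
have gi : geom_bounded (1 * 2) (fun m => twopii * m%:~R : C).
  by apply: geombM; [| |exact: geomb_cst|exact: geomb_int].
have ra' : rapid (fun m => a m * (twopii * m%:~R)) by apply: rapidM gi; rewrite ?mul1r.
have [K4 D4] := rapid_decay (rapid_ee w ra').
have D23 : zdecay 2 (K2 + nrm (-1) * K3) (fun m => a m * ee (m%:~R * (w + h)) - a m * ee (m%:~R * w)).
  by have := zdecayD D2 (zdecayZ (-1) D3); under eq_fun do rewrite mulN1r.
rewrite /laurent -(zsumZ b12 h D4) -(zsumB b12 D2 D3) -(zsumB b12 D23 (zdecayZ h D4)).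
have D5 : zdecay 2 (K * (e / (9 * K + 1) * nrm h)) (fun m => a m * ee (m%:~R * (w + h)) -
    a m * ee (m%:~R * w) - h * (a m * (twopii * m%:~R) * ee (m%:~R * w))).
  move=> m; rewrite ler_pdivlMr ?exprn_gt0//.
  rewrite mulrDr eeD (_ : _ - _ - _ = (a m * ee (m%:~R * w)) *
    (ee (m%:~R * h) - 1 - h * (twopii * m%:~R))); last by ring.
  rewrite (nrmM (a m * ee (m%:~R * w))) -[leLHS]mulrA.
  have eh : 0 <= e / (9 * K + 1) * nrm h by rewrite mulr_ge0 ?nrm_ge0// ltW// divr_gt0.
  apply: (@le_trans _ _ (nrm (a m * ee (m%:~R * w)) *
     (8 ^+ `|m|%N * (e / (9 * K + 1) * nrm h) * 2 ^+ `|m|%N))).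
    by apply: ler_wpM2l; rewrite ?nrm_ge0//; apply: ler_wpM2r; rewrite ?exprn_ge0.
  have -> : nrm (a m * ee (m%:~R * w)) * (8 ^+ `|m|%N * (e / (9 * K + 1) * nrm h) * 2 ^+ `|m|%N)
    = nrm (a m * ee (m%:~R * w)) * 16 ^+ `|m|%N * (e / (9 * K + 1) * nrm h).
    have -> : (16 : R) ^+ `|m|%N = 8 ^+ `|m|%N * 2 ^+ `|m|%N.
      by rewrite -exprMn; congr (_ ^+ _); ring.
    ring.
  by rewrite ler_wpM2r.
apply: (le_trans (zsum_bound b12 D5)); rewrite tailc2 (_ : 8 + 1 = 9)//; last ring.
rewrite !mulrA ler_wpM2r ?nrm_ge0//.
by rewrite ler_pdivrMr// mulrDr mulr1 [e * _]mulrC lerDl ltW.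
Qed.

Lemma entire_laurent a : rapid a -> entire (laurent a).
Proof. by move=> ra x; exact: cderiv_diff (cderiv_laurent x ra). Qed.

Lemma laurent_per a z : laurent a (z + 1) = laurent a z.
Proof. by apply: eq_zsum => m; rewrite mulrDr eeD mulr1 ee_int mulr1. Qed.

(** The convergence is uniform on the real line, where every term with nonzero index
has mean 0. *)
Lemma mean_laurent a : rapid a -> cint (fun t => laurent a (RtoC t)) = a 0.
Proof.
move=> ra; have [K aK] := rapid_decay ra.
have K0 := zdecay_ge0 aK.
have cl : continuous (fun t : R => laurent a (RtoC t)).
  by apply: cont_comp_RtoC; apply: entire_cont; exact: entire_laurent.
have ceR m : continuous (fun t : R => a m * ee (m%:~R * RtoC t)).
  exact: (@contZ _ _ (a m) (@cont_eeR R m%:~R)).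
have dk (t : R) : zdecay 2 K (fun m => a m * ee (m%:~R * RtoC t)).
  move=> m; rewrite nrmM eeMz (_ : nrm (ee (RtoC t) ^ m) = 1) ?mulr1//.
  have n1 : nrm (ee (RtoC t)) = 1 by rewrite nrm_ee /= mulr0 oppr0 expR0.
  case: m => m; first by rewrite -exprnP nrmX n1 expr1n.
  by rewrite NegzE -exprz_inv -exprnP nrmX nrmV n1 invr1 expr1n.
pose pN N t := wsum (fun m => a m * ee (m%:~R * RtoC t)) N.
have cN N : continuous (pN N).
  exact: (@cont_sum R _ (index_enum 'I_(N.*2.+1)) _ (fun k => @ceR (k%:Z - N%:Z))).
have iN N : cint (pN N) = a 0.
  elim: N => [|N IH].
    rewrite -(cint_cst (a 0)); apply: eq_cint => t.
    by rewrite /pN wsum0 mul0r ee0 mulr1.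
  transitivity (cint (fun t => pN N t + (a N.+1%:Z * ee (N.+1%:Z%:~R * RtoC t) +
      a (- N.+1%:Z) * ee ((- N.+1%:Z)%:~R * RtoC t)))).
    by apply: eq_cint => t; rewrite /pN wsumS.
  rewrite (cintD (cN N) (ccontD (ceR _) (ceR _))) (cintD (ceR _) (ceR _)).
  rewrite !(cintZ _ (@cont_eeR R _)) !cint_ee oppr_eq0 /= !mulr0 addr0 addr0.
  exact: IH.
apply/eqP; rewrite -subr_eq0 -nrm_eq0; apply/eqP/le_anti; rewrite nrm_ge0 andbT.
apply/ler_addgt0Pl => e e0; rewrite addr0.
pose N := (Num.truncn (16 * K / e)).+1.
rewrite -(iN N) -(cintB cl (cN N)).
apply: (@le_trans _ _ (2 * (8 * K / 2 ^+ N))).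
  apply: cint_bound; first exact: (ccontB cl (cN N)).
  by move=> t _; rewrite nrmBC; rewrite -tailc2; exact: (wsum_tail b12).
rewrite mulrA ler_pdivrMr ?exprn_gt0// [e * _]mulrC -ler_pdivrMr// mulrA (_ : 2 * 8 = 16); last by ring.
apply: (le_trans (ltW (truncnS_gt _))); rewrite -natrX ler_nat.
by apply: ltnW; exact: ltn_expl.
Qed.

End Laurent.

Section RapidShift.
Context {R : realType}.
Local Notation C := (Cplx R).

Lemma rapid_shift (a : int -> C) n : rapid a -> rapid (fun m => a (m + n)).
Proof.
move=> ra r r0; have r1 : 0 < r + 1 by lra.
have [K H] := ra _ r1; exists (K * (r + 1) ^+ `|n|%N) => m.
apply: (@le_trans _ _ (nrm (a (m + n)) * (r + 1) ^+ `|(m + n)%R|%N * (r + 1) ^+ `|n|%N)).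
  rewrite -mulrA -exprD ler_wpM2l ?nrm_ge0//.
  apply: (@le_trans _ _ ((r + 1) ^+ `|m|%N)).
    by rewrite lerXn2r ?nnegrE; lra.
  by rewrite ler_weXn2l; [|lra|lia].
by rewrite ler_wpM2r ?exprn_ge0 ?(ltW r1).
Qed.

Lemma rapid_opp (a : int -> C) : rapid a -> rapid (fun m => a (- m)).
Proof. by move=> ra r /ra[K H]; exists K => m; rewrite -abszN. Qed.

Lemma rapid_refl (a : int -> C) n : rapid a -> rapid (fun m => a (n - m)).
Proof.
move=> /(@rapid_shift _ n)/rapid_opp ra r /ra[K H]; exists K => m.
by rewrite addrC.
Qed.

Lemma zsum_refl (a : int -> C) n : rapid a -> zsum (fun m => a (n - m)) = zsum a.
Proof.
move=> ra; have [K D] := rapid_decay ra.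
rewrite -(zsum_opp (fun m => a (n - m))) -(@zsum_shiftn _ _ (ltr1n _ 2) _ _ n _ D).
  by apply: eq_zsum => m; rewrite opprK addrC.
by move=> k; apply: rapid_decay; exact: rapid_shift.
Qed.

Lemma zsum_shift_rapid (a : int -> C) n : rapid a -> zsum (fun m => a (m + n)) = zsum a.
Proof.
move=> ra; have [K D] := rapid_decay ra.
rewrite (@zsum_shiftn _ _ (ltr1n _ 2) _ _ n _ D)// => k; apply: rapid_decay; exact: rapid_shift.
Qed.

Lemma rapidMb (a b : int -> C) (D : R) : rapid a -> (forall m, nrm (b m) <= D) ->
  rapid (fun m => a m * b m).
Proof.
move=> ra bD; apply: (@rapidM _ _ _ 1) => //; exists D => [|m].
  by apply: le_trans (bD 0); exact: nrm_ge0.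
by rewrite expr1n mulr1.
Qed.

Lemma rapidD (a b : int -> C) : rapid a -> rapid b -> rapid (fun m => a m + b m).
Proof.
move=> ra rb r r0; have [K H] := ra r r0; have [L H'] := rb r r0; exists (K + L) => m.
apply: (le_trans (ler_wpM2r _ (nrmD _ _))); first by rewrite exprn_ge0// ltW.
by rewrite mulrDl lerD.
Qed.

Lemma zsumD_rapid (a b : int -> C) : rapid a -> rapid b ->
  zsum (fun m => a m + b m) = zsum a + zsum b.
Proof.
move=> /rapid_decay[K ?] /rapid_decay[L ?]; apply: (zsumD (ltr1n _ 2)); eassumption.
Qed.

Lemma zsumZ_rapid (a : int -> C) c : rapid a -> zsum (fun m => c * a m) = c * zsum a.
Proof. move=> /rapid_decay[K ?]; apply: (zsumZ (ltr1n _ 2)); eassumption. Qed.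

Lemma zsumB_rapid (a b : int -> C) : rapid a -> rapid b ->
  zsum (fun m => a m - b m) = zsum a - zsum b.
Proof.
move=> /rapid_decay[K ?] /rapid_decay[L ?]; apply: (zsumB (ltr1n _ 2)); eassumption.
Qed.

End RapidShift.

(** * The theta function *)

Section Theta.
Context {R : realType}.
Local Notation C := (Cplx R).
Local Notation RtoC t := ((t : R)%:C : C).
Variable tau : C.
Hypothesis tau_gt0 : 0 < complex.Im tau.

(** (-1)^m q^(m (m + 1) / 2) with q = e(tau); the term m/2 of the exponent produces
the sign. *)
Definition thc (m : int) : C := ee ((m%:~R ^+ 2 + m%:~R) / 2 * tau + m%:~R / 2).

Lemma ee_half : ee (1 / 2 : C) = -1.
Proof.
have -> : (1 / 2 : C) = RtoC 2^-1.
  by rewrite mul1r (fmorphV (real_complex R)) (rmorph_nat (real_complex R)).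
rewrite ee_real (_ : 2 * pi * 2^-1 = pi); last by field.
by rewrite cospi sinpi; apply: complex_ext; rewrite /= ?oppr0.
Qed.

Lemma thcS m : thc (m + 1) = - ee ((m + 1)%:~R * tau) * thc m.
Proof.
rewrite -mulN1r -ee_half /thc -!eeD; congr ee; by rewrite intrD; field.
Qed.

Lemma thc0 : thc 0 = 1.
Proof. by rewrite /thc expr0n /= add0r !mul0r addr0 ee0. Qed.

Lemma thc_refl m : thc (- m - 1) = - thc m.
Proof.
have -> : - thc m = ee (1 / 2 + (- m - 1)%:~R) * thc m.
  by rewrite eeD ee_half ee_int mulr1 mulN1r.
by rewrite /thc -eeD; congr ee; rewrite intrB intrN; field.
Qed.

(** Completing the square in the exponent bounds |c_m| r^|m| by its Gaussian
maximum. *)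
Lemma rapid_thc : rapid thc.
Proof.
move=> r r0.
pose s := 2 * pi * complex.Im tau; pose L := ln r.
have s0 : 0 < s by rewrite /s !mulr_gt0 ?pi_gt0.
exists (expR ((s / 2 + L) ^+ 2 / (2 * s))) => m.
have -> : r ^+ `|m|%N = expR (`|m|%N%:R * L) by rewrite expRM_natl lnK.
rewrite /thc nrm_ee -expRD ler_expR.
pose x : R := m%:~R.
have xE : m%:~R = RtoC x by rewrite (rmorph_int (real_complex R)).
have -> : complex.Im ((m%:~R ^+ 2 + m%:~R) / 2 * tau + m%:~R / 2 : C) =
    (x ^+ 2 + x) / 2 * complex.Im tau.
  have -> : (m%:~R ^+ 2 + m%:~R) / 2 * tau + m%:~R / 2 =
      RtoC ((x ^+ 2 + x) / 2) * tau + RtoC (x / 2) :> C.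
    rewrite xE !(rmorphM (real_complex R)) (rmorphD (real_complex R)) (rmorphXn (real_complex R)).
    by rewrite (fmorphV (real_complex R)) (rmorph_nat (real_complex R)).
  by rewrite cImD cImM /= mul0r !addr0.
have nx : `|m|%N%:R = `|x| :> R by rewrite /x -intr_norm -abszE -pmulrn.
rewrite nx.
have -> : - (2 * pi * ((x ^+ 2 + x) / 2 * complex.Im tau)) = - (s * ((x ^+ 2 + x) / 2)).
  by rewrite /s; field.
have h1 : - x <= `|x| by rewrite -normrN ler_norm.
have h2 : x ^+ 2 = `|x| ^+ 2 by rewrite real_normK ?num_real.
rewrite h2; move: `|x| h1 => y h1.
rewrite ler_pdivlMr; last by apply: mulr_gt0.
apply: (@le_trans _ _ ((- (s * ((y ^+ 2 - y) / 2)) + y * L) * (2 * s))).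
  apply: ler_wpM2r; first by rewrite mulr_ge0// ltW.
  rewrite lerD2r lerN2; apply: ler_wpM2l; first exact: ltW.
  by lra.
rewrite -subr_ge0 (_ : _ - _ = (s * y - (s / 2 + L)) ^+ 2); first exact: sqr_ge0.
by field.
Qed.

(** theta_bar translated by (tau + 1)/2, see [thf_theta_bar]; the translation moves
the zero of theta_bar to the origin. *)
Definition thf (z : C) : C := laurent thc z.

Lemma thf_theta_bar z : theta_bar tau (z + (tau + 1) / 2) = thf z.
Proof.
rewrite /theta_bar /thf /laurent /zsum; congr (limn _); apply/funext => N.
rewrite /wsum; apply: eq_bigr => k _ /=.
rewrite /thc -eeD /ee; congr cexp; by field.
Qed.

Lemma entire_thf : entire thf.
Proof. exact: entire_laurent rapid_thc. Qed.

Lemma thf_per z : thf (z + 1) = thf z.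
Proof. exact: laurent_per. Qed.

Lemma thf_tau z : thf (z + tau) = - ee (- (z + tau)) * thf z.
Proof.
have [K D] := rapid_decay (rapid_ee z rapid_thc).
rewrite /thf /laurent -(zsumZ (ltr1n _ 2) _ D).
rewrite -(zsum_shift (ltr1n _ 2) (zdecayZ (- ee (- (z + tau))) D)).
apply: eq_zsum => m; rewrite thcS.
have -> : ee (- (z + tau)) = (ee z)^-1 * (ee tau)^-1 by rewrite eeN eeD invfM.
rewrite intrD !mulrDl !mulrDr !eeD !mul1r; field.
by rewrite !ee_neq0.
Qed.

Lemma thf_opp z : thf (- z) = - ee z * thf z.
Proof.
have [K D] := rapid_decay (rapid_ee (- z) rapid_thc).
have [K2 D2] := rapid_decay (rapid_ee z rapid_thc).
have D' : zdecay 2 K (fun m => thc (- m) * ee ((- m)%:~R * - z)).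
  by move=> m; have := D (- m); rewrite abszN.
rewrite /thf /laurent -zsum_opp -(zsum_shift (ltr1n _ 2) D') -(zsumZ (ltr1n _ 2) _ D2).
apply: eq_zsum => m.
have -> : thc (- (m + 1)) = - thc m by rewrite opprD thc_refl.
have -> : (- (m + 1))%:~R * - z = m%:~R * z + z by rewrite intrN mulrNN intrD mulrDl mul1r.
by rewrite eeD; ring.
Qed.

Lemma thf0 : thf 0 = 0.
Proof.
have := thf_opp 0; rewrite oppr0 ee0 mulN1r => h.
have : 2 * thf 0 = 0 by rewrite mulr2n mulrDl mul1r {1}h addNr.
by move/eqP; rewrite mulf_eq0 pnatr_eq0 /= => /eqP.
Qed.

Lemma per_int (T : Type) (F : C -> T) : (forall z, F (z + 1) = F z) ->
  forall z (n : int), F (z + n%:~R) = F z.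
Proof.
move=> per z n.
have nat_ (m : nat) y : F (y + m%:R) = F y.
  elim: m y => [|m IH] y; first by rewrite addr0.
  by rewrite -natr1 addrA per IH.
case: n => m; first by rewrite -pmulrn nat_.
by rewrite NegzE mulrNz -pmulrn -(nat_ m.+1 (z - m.+1%:R)) subrK.
Qed.

Lemma thf_tau_eq0 z : (thf (z + tau) == 0) = (thf z == 0).
Proof. by rewrite thf_tau mulf_eq0 oppr_eq0 (negbTE (ee_neq0 _)). Qed.

(** The quasi-periodicity factors never vanish, so the set of zeros is invariant
under the lattice. *)
Lemma thf_lattice z w : Lambda tau w -> (thf (z + w) == 0) = (thf z == 0).
Proof.
move=> [a [b ->]]; rewrite addrCA addrC (per_int thf_per).
have nat_ (m : nat) y : (thf (y + tau *+ m) == 0) = (thf y == 0).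
  elim: m y => [|m IH] y; first by rewrite mulr0n addr0.
  by rewrite mulrSr addrA thf_tau_eq0 IH.
case: b => m; first by rewrite -pmulrn mulr_natr nat_.
by rewrite NegzE mulrNz -pmulrn mulrN mulr_natr -(nat_ m.+1) subrK.
Qed.

Lemma thf_Lambda w : Lambda tau w -> thf w = 0.
Proof. by move=> Lw; apply/eqP; rewrite -[w]add0r thf_lattice// thf0. Qed.

End Theta.

(** * The zeros of the theta function *)

Section Zeros.
Context {R : realType}.
Local Notation C := (Cplx R).
Local Notation RtoC t := ((t : R)%:C : C).
Variable tau : C.
Hypothesis tau_gt0 : 0 < complex.Im tau.
Local Notation thc := (thc tau).
Local Notation f := (thf tau).
Local Notation r := (nrm (ee tau)).

Let r0 : 0 < r. Proof. by rewrite nrm_gt0 ee_neq0. Qed.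
Let r1 : r < 1.
Proof. by rewrite nrm_ee -expR0 ltr_expR oppr_lt0 !mulr_gt0// pi_gt0. Qed.

Section Kernel.
Variable s : R.
Hypothesis s1 : `|s| < 1.
Hypothesis s0 : s != 0.
Local Notation u := (ee (RtoC s)).

Let u1 : nrm u = 1. Proof. by rewrite nrm_ee /= mulr0 oppr0 expR0. Qed.

Let un1 : 1 - u != 0.
Proof.
rewrite subr_eq0 eq_sym; apply/eqP => /ee_eq1[n].
rewrite -(rmorph_int (real_complex R)) => /complexI sE.
by move: s1 s0; rewrite sE -intr_norm -[1]/(1%:~R) ltr_int intr_eq0; case: (n) => -[].
Qed.

(** The coefficients 1 / (1 - q^m u), with u = e(s) on the unit circle and q = e(tau),
of a Laurent series in the spirit of Kronecker's function. They are bounded, but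
do not decay for m positive; their differences [kap] do. *)
Definition pole (m : int) : C := (1 - ee (m%:~R * tau) * u)^-1.

Lemma nrm_qu (m : int) : nrm (ee (m%:~R * tau) * u) = r ^ m.
Proof.
rewrite nrmM u1 mulr1 eeMz; case: m => m; first by rewrite -!exprnP nrmX.
by rewrite NegzE -!exprz_inv -!exprnP nrmX nrmV.
Qed.

Lemma pole_pos (m : nat) : 1 - r <= nrm (1 - ee (m.+1%:Z%:~R * tau) * u).
Proof.
have := nrmD (1 - ee (m.+1%:Z%:~R * tau) * u) (ee (m.+1%:Z%:~R * tau) * u).
rewrite subrK nrm1 nrm_qu -exprnP => h.
have : r ^+ m.+1 <= r by rewrite exprS ler_piMr ?(ltW r0)// exprn_ile1// ltW.
lra.
Qed.

Lemma pole_neg (m : nat) : (1 - r) / r ^+ m.+1 <= nrm (1 - ee ((- m.+1%:Z)%:~R * tau) * u).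
Proof.
have := nrmB 1 (1 - ee ((- m.+1%:Z)%:~R * tau) * u).
rewrite opprB addrCA subrr addr0 nrm_qu nrm1 -exprz_inv -exprnP => h.
have p0 : 0 < r ^+ m.+1 by rewrite exprn_gt0.
have : r ^+ m.+1 <= r by rewrite exprS ler_piMr ?(ltW r0)// exprn_ile1// ltW.
move=> h2; rewrite exprVn in h; rewrite mulrBl mul1r.
have h3 : 1 <= r / r ^+ m.+1 by rewrite ler_pdivlMr// mul1r.
lra.
Qed.

Lemma pole_ne0 (m : int) : 1 - ee (m%:~R * tau) * u != 0.
Proof.
case: m => [[|m]|m]; first by rewrite mul0r ee0 mul1r.
  by rewrite -nrm_gt0; apply: lt_le_trans (pole_pos m); rewrite subr_gt0.
rewrite NegzE -nrm_gt0; apply: lt_le_trans (pole_neg m).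
by rewrite divr_gt0 ?exprn_gt0// subr_gt0.
Qed.

Lemma nrm_pole_neg (m : nat) : nrm (pole (- m.+1%:Z)) <= r ^+ m.+1 / (1 - r).
Proof.
rewrite /pole nrmV -[leRHS]invrK invf_div lef_pV2 ?posrE; first exact: pole_neg.
  by rewrite nrm_gt0 pole_ne0.
by rewrite divr_gt0 ?exprn_gt0// subr_gt0.
Qed.

Lemma nrm_pole_n0 (m : int) : m != 0 -> nrm (pole m) <= (1 - r)^-1.
Proof.
case: m => [[|m]|m] // _.
  by rewrite /pole nrmV lef_pV2 ?posrE ?subr_gt0// ?nrm_gt0 ?pole_ne0//; exact: pole_pos.
rewrite NegzE; apply: (le_trans (nrm_pole_neg m)); rewrite ler_piMl ?invr_ge0 ?subr_ge0 ?(ltW r1)//.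
by rewrite exprn_ile1 ?ltW.
Qed.

Let D := (1 - r)^-1 + nrm (1 - u)^-1.
Let D0 : 0 <= D. Proof. by rewrite addr_ge0 ?nrm_ge0// invr_ge0 subr_ge0 ltW. Qed.

Lemma nrm_pole (m : int) : nrm (pole m) <= D.
Proof.
have [->|/nrm_pole_n0 h] := eqVneq m 0.
  by rewrite /pole mul0r ee0 mul1r lerDr invr_ge0 subr_ge0 ltW.
by apply: (le_trans h); rewrite lerDl nrm_ge0.
Qed.

Definition kap (m : int) : C := pole m - pole (m - 1).

(** For m positive pole m tends to 1 and for m negative to 0, in both cases at rate
r^|m|, so the differences decay on both sides. *)
Lemma kap_decay : exists2 E, 0 <= E & forall m, nrm (kap m) <= E * r ^+ `|m|%N.
Proof.
have rr : 0 < 1 - r by rewrite subr_gt0.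
have d2 : 0 <= D ^+ 2 by rewrite exprn_ge0.
have e1 : 0 <= 2 * D ^+ 2 / r by rewrite divr_ge0 ?mulr_ge0 ?(ltW r0).
have e2 : 0 <= 2 / (1 - r) by rewrite divr_ge0// ltW.
have e3 : 0 <= 2 * D by exact: mulr_ge0.
have [le1 le2] : 2 * D ^+ 2 / r <= 2 * D ^+ 2 / r + 2 / (1 - r) + 2 * D /\
    2 / (1 - r) <= 2 * D ^+ 2 / r + 2 / (1 - r) + 2 * D.
  by move: e1 e2 e3; move: (_ / r) (2 / _) (2 * D) => x y z; lra.
exists (2 * D ^+ 2 / r + 2 / (1 - r) + 2 * D).
  by apply: addr_ge0; [exact: addr_ge0|exact: mulr_ge0].
case=> [[|m]|m].
- rewrite absz0 expr0 mulr1 /kap; apply: (le_trans (nrmB _ _)).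
  have := nrm_pole 0; have := nrm_pole (0 - 1); lra.
- rewrite absz_nat /kap.
  have E : m.+1%:Z - 1 = m%:Z by rewrite -addn1 PoszD addrK.
  rewrite E.
  have -> : pole m.+1%:Z - pole m%:Z = pole m.+1%:Z * pole m%:Z *
     (ee (m.+1%:Z%:~R * tau) * u - ee (m%:Z%:~R * tau) * u).
    by rewrite /pole; field; rewrite !pole_ne0.
  rewrite !(nrmM (_ * _)) (nrmM (pole _)).
  apply: (@le_trans _ _ (D * D * (2 * r ^+ m.+1 / r))).
    apply: ler_pM; rewrite ?mulr_ge0 ?nrm_ge0//.
      by apply: ler_pM; rewrite ?nrm_ge0// nrm_pole.
    apply: (le_trans (nrmB _ _)); rewrite !nrm_qu -!exprnP exprS.
    have : r * r ^+ m <= r ^+ m by rewrite ler_piMl ?exprn_ge0// ltW.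
    have -> : 2 * (r * r ^+ m) / r = 2 * r ^+ m by field; rewrite lt0r_neq0.
    lra.
  rewrite (_ : D * D * _ = 2 * D ^+ 2 / r * r ^+ m.+1); last by ring.
  by rewrite ler_wpM2r ?exprn_ge0 ?(ltW r0).
- rewrite NegzE abszN absz_nat /kap.
  have -> : - m.+1%:Z - 1 = - m.+2%:Z by rewrite -opprD -PoszD addn1.
  apply: (le_trans (nrmB _ _)); apply: (le_trans (lerD (nrm_pole_neg _) (nrm_pole_neg _))).
  apply: (@le_trans _ _ (2 / (1 - r) * r ^+ m.+1)); last first.
    by rewrite ler_wpM2r ?exprn_ge0 ?(ltW r0).
  have : r ^+ m.+2 / (1 - r) <= r ^+ m.+1 / (1 - r).
    by rewrite ler_wpM2r ?invr_ge0 ?(ltW rr)// exprS ler_piMl ?exprn_ge0 ?(ltW r0)// ltW.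
  have -> : 2 / (1 - r) * r ^+ m.+1 = r ^+ m.+1 / (1 - r) + r ^+ m.+1 / (1 - r) by ring.
  by rewrite lerD2l.
Qed.

(** The coefficients of the formal product of the pole series and the theta series. *)
Definition kersum (N : int) : C := zsum (fun m => thc (N - m) * pole m).

Lemma rapid_kersum N : rapid (fun m => thc (N - m) * pole m).
Proof. by apply: rapidMb nrm_pole; apply: rapid_refl; exact: rapid_thc. Qed.

(** Since c_(N-m) = - q^(N-m) c_(N-1-m), the combination of S_N and S_(N-1) has the
factor 1 - q^m u in its numerator, which cancels the denominator; what remains is
the sum of all c_m, that is theta(0) = 0. *)
Lemma kersum_rec N : kersum N = - u * ee (N%:~R * tau) * kersum (N - 1).
Proof.
(* Up to a reflection of the index, this sum is the value of theta at 0. *)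
have z0 : zsum (fun m => thc (N - m)) = 0.
  rewrite (zsum_refl N (rapid_thc tau_gt0)) -[RHS](thf0 tau_gt0) /thf /laurent.
  by apply: eq_zsum => m; rewrite mulr0 ee0 mulr1.
have -> : - u * ee (N%:~R * tau) * kersum (N - 1) =
    zsum (fun m => (- u * ee (N%:~R * tau)) * (thc (N - 1 - m) * pole m)).
  by rewrite zsumZ_rapid//; exact: rapid_kersum.
apply/eqP; rewrite -subr_eq0 -z0 /kersum -zsumB_rapid; last 2 first.
- exact: rapid_kersum.
- have := rapidMb (rapid_kersum (N - 1)) (b := fun=> - u * ee (N%:~R * tau)) (fun=> lexx _).
  by under eq_fun do rewrite mulrC.
apply/eqP; apply: eq_zsum => m.
have -> : thc (N - m) = - ee ((N - m)%:~R * tau) * thc (N - 1 - m).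
  have -> : N - m = (N - 1 - m) + 1 by ring.
  exact: thcS.
have -> : ee ((N - m)%:~R * tau) = ee (N%:~R * tau) / ee (m%:~R * tau).
  by rewrite intrB mulrBl eeB.
have := pole_ne0 m; have := ee_neq0 (m%:~R * tau); rewrite /pole.
move: (ee (m%:~R * tau)) => q q0 p0; field.
by rewrite q0 p0.
Qed.

(** u^N c_N obeys the same first-order recurrence as S_N. *)
Lemma kersumE N : kersum N = ee (N%:~R * RtoC s) * thc N * kersum 0.
Proof.
have rec n : kersum (n + 1) = ee ((n + 1)%:~R * RtoC s) * thc (n + 1) * kersum 0 <->
    kersum n = ee (n%:~R * RtoC s) * thc n * kersum 0.
  rewrite kersum_rec addrK thcS intrD [(_ + 1) * RtoC s]mulrDl mul1r eeD.
  set e := ee (_ * tau); have e0 : e != 0 by exact: ee_neq0.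
  have uu : u != 0 by exact: ee_neq0.
  split => [h|->]; last by ring.
  by apply: (mulfI (mulf_neq0 uu e0)); apply: oppr_inj; rewrite -!mulNr h; ring.
case: N => n.
  elim: n => [|n IH]; first by rewrite mul0r ee0 thc0 !mul1r.
  by have := (rec n%:Z).2 IH; rewrite -PoszD addn1.
rewrite NegzE; elim: n => [|n IH].
  by apply: (rec (- 1)).1; rewrite addNr mul0r ee0 thc0 !mul1r.
apply: (rec (- n.+2%:Z)).1; have -> : - n.+2%:Z + 1 = - n.+1%:Z by rewrite -[n.+2]addn1 PoszD opprD subrK.
  exact: IH.
Qed.

(** Multiplying theta(z) by the series with coefficients kap m in e(z) gives the
series with coefficients S_N - S_(N-1), by exchanging the summations. As
S_N = u^N c_N S_0, this is S_0 (1 - e(z)) theta(z + s): the zero z of theta moves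
to z + s. The bound on Im z makes the kernel series converge. *)
Lemma kernel_zero (z : C) : `|complex.Im z| < complex.Im tau -> f z = 0 ->
  kersum 0 * (1 - ee z) * f (z + RtoC s) = 0.
Proof.
move=> hz fz; have pp := pi_gt0 R.
pose g := expR (2 * pi * `|complex.Im z|).
have gz (m : int) : nrm (ee (m%:~R * z)) <= g ^+ `|m|%N.
  have g1 : nrm (ee z) <= g.
    by rewrite nrm_ee ler_expR -mulrN ler_wpM2l ?mulr_ge0 ?(ltW pp)// -normrN ler_norm.
  have g2 : (nrm (ee z))^-1 <= g.
    by rewrite nrm_ee -expRN opprK ler_expR ler_wpM2l ?mulr_ge0 ?(ltW pp)// ler_norm.
  rewrite eeMz; case: m => m; first by rewrite -exprnP nrmX lerXn2r ?nnegrE ?nrm_ge0 ?expR_ge0.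
  by rewrite NegzE -exprz_inv -exprnP nrmX nrmV abszN lerXn2r ?nnegrE ?invr_ge0 ?nrm_ge0 ?expR_ge0.
pose b := expR (pi * (complex.Im tau - `|complex.Im z|)).
have b1 : 1 < b by rewrite /b expR_gt1 mulr_gt0// subr_gt0.
have b0 : 0 < b by exact: expR_gt0.
have rgb : r * g = b^-1 * b^-1.
  by rewrite nrm_ee /g /b -!expRN -!expRD; congr expR; ring.
have [E E0 kE] := kap_decay.
have [K KP] := rapid_ee z (rapid_thc tau_gt0) b0.
have K0 : 0 <= K by apply: le_trans (KP 0); rewrite mulr_ge0 ?nrm_ge0// exprn_ge0// ltW.
pose t (m N : int) := kap m * (thc (N - m) * ee (N%:~R * z)).
(* Splitting e(N z) as e(m z) e((N - m) z), the first factor goes with kap m,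
   whose rate r times g is b^-2, and the second with c_(N-m); one b^(-|m|) is
   spent on replacing N - m by N. *)
have tb m N : nrm (t m N) <= E * K / b ^+ `|m|%N / b ^+ `|N|%N.
  have -> : t m N = (kap m * ee (m%:~R * z)) * (thc (N - m) * ee ((N - m)%:~R * z)).
    rewrite /t (_ : N%:~R * z = m%:~R * z + (N - m)%:~R * z) ?eeD; first by ring.
    by rewrite intrB; ring.
  rewrite nrmM; set P := nrm (_ * _); set Q := nrm (_ * _).
  have P0 : 0 <= P by exact: nrm_ge0.
  have Q0 : 0 <= Q by exact: nrm_ge0.
  have bm k : 0 < b ^+ k by rewrite exprn_gt0.
  have hP : P * (b ^+ `|m|%N * b ^+ `|m|%N) <= E.
    have h : P <= E * (r * g) ^+ `|m|%N.
      by rewrite /P nrmM exprMn mulrA ler_pM ?nrm_ge0.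
    apply: (le_trans (ler_wpM2r _ h)); first by rewrite mulr_ge0// ltW.
    by rewrite rgb exprMn -mulrA mulrACA -!exprMn mulVf ?lt0r_neq0// mulr1 expr1n mulr1.
  have hQ : Q * b ^+ `|(N - m)%R|%N <= K by exact: KP.
  rewrite ler_pdivlMr// ler_pdivlMr//.
  have hb : b ^+ `|N|%N <= b ^+ `|m|%N * b ^+ `|(N - m)%R|%N.
    rewrite -exprD ler_weXn2l ?(ltW b1)//.
    by clear; lia.
  apply: (@le_trans _ _ (P * Q * (b ^+ `|m|%N * b ^+ `|(N - m)%R|%N) * b ^+ `|m|%N)).
    by rewrite ler_wpM2r ?(ltW (bm _))// ler_wpM2l// mulr_ge0.
  have -> : P * Q * (b ^+ `|m|%N * b ^+ `|(N - m)%R|%N) * b ^+ `|m|%N =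
    (P * (b ^+ `|m|%N * b ^+ `|m|%N)) * (Q * b ^+ `|(N - m)%R|%N) by ring.
  by rewrite ler_pM// mulr_ge0// ?mulr_ge0// ltW.
have := zsum_swap b1 tb.
have -> : (fun m => zsum (t m)) = (fun=> 0).
  apply/funext => m; rewrite /t.
  transitivity (zsum (fun N => (kap m * ee (m%:~R * z)) * (thc (N - m) * ee ((N - m)%:~R * z)))).
    apply: eq_zsum => N.
    rewrite (_ : N%:~R * z = m%:~R * z + (N - m)%:~R * z) ?eeD; first by ring.
    by rewrite intrB; ring.
  have rc := rapid_ee z (rapid_thc tau_gt0).
  rewrite (zsumZ_rapid _ (rapid_shift (- m) rc)) (zsum_shift_rapid (- m) rc).
  by rewrite -/(laurent _ _) -/(thf tau z) fz mulr0.
have -> : zsum (fun=> 0) = 0 :> C.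
  rewrite -[RHS](mul0r (zsum thc)) -(zsumZ_rapid _ (rapid_thc tau_gt0)).
  by apply: eq_zsum => m; rewrite mul0r.
have inner N : zsum (fun m => t m N) = ee (N%:~R * z) * (kersum N - kersum (N - 1)).
  have rS := rapid_shift (-1) (rapid_kersum (N - 1)).
  rewrite /kersum -(zsum_shift_rapid (-1) (rapid_kersum (N - 1))) -(zsumB_rapid (rapid_kersum N) rS).
  rewrite -zsumZ_rapid; last first.
    move=> e e0; have [K1 H1] := rapidD (rapid_kersum N) (rapidMb rS (b := fun=> -1) (fun=> lexx _)) e0.
    by exists K1 => m; have := H1 m; rewrite mulrN1.
  apply: eq_zsum => m; rewrite /t /kap (_ : N - 1 - (m - 1) = N - m); last by ring.
  ring.
have -> : (fun N => zsum (fun m => t m N)) = (fun N => ee (N%:~R * z) * (kersum N - kersum (N - 1))).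
  exact/funext.
have rs := rapid_ee (z + RtoC s) (rapid_thc tau_gt0).
have rs' := rapidMb rs (b := fun=> - ee z) (fun=> lexx _).
have rs'' := rapid_shift (-1) rs'.
move=> h; rewrite [RHS]h.
transitivity (kersum 0 * (f (z + RtoC s) + - ee z * f (z + RtoC s))); first by ring.
rewrite /thf /laurent -[in X in _ + X](zsumZ_rapid _ rs).
have -> : zsum (fun m => - ee z * (thc m * ee (m%:~R * (z + RtoC s)))) =
   zsum (fun m => (thc (m - 1) * ee ((m - 1)%:~R * (z + RtoC s))) * - ee z).
  rewrite (zsum_shift_rapid (-1) rs'); by apply: eq_zsum => m; rewrite mulrC.
rewrite -(zsumD_rapid rs rs'') -(zsumZ_rapid _ (rapidD rs rs'')).
apply: eq_zsum => N; rewrite (kersumE N) (kersumE (N - 1)) !mulrDr !eeD.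
have -> : (N - 1)%:~R * z = N%:~R * z - z by rewrite intrB; ring.
rewrite eeB; field; exact: ee_neq0.
Qed.

End Kernel.
End Zeros.

Section ZeroSet.
Context {R : realType}.
Local Notation C := (Cplx R).
Local Notation RtoC t := ((t : R)%:C : C).
Variable tau : C.
Hypothesis tau_gt0 : 0 < complex.Im tau.
Local Notation thc := (thc tau).
Local Notation f := (thf tau).
Local Notation r := (nrm (ee tau)).

Lemma zsum_delta (c : C) : zsum (fun m => if m == 0 then c else 0) = c.
Proof.
apply: (@zsumP _ 2 (ltr1n _ 2) 0) => N; rewrite mul0r.
suff -> : wsum (fun m : int => if m == 0 then c else 0) N = c by rewrite subrr nrm0.
by elim: N => [|N IH]; rewrite ?wsum0// wsumS IH /= !addr0.
Qed.

(** As s tends to 0 the term m = 0, which is 1 / (1 - u), tends to infinity while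
the other terms stay bounded. *)
Lemma kersum0_neq0 : exists2 d : R, 0 < d & d <= 1 /\ forall s : R, `|s| < d -> s != 0 ->
  kersum tau s 0 != 0.
Proof.
have r1 : r < 1.
  by rewrite nrm_ee -expR0 ltr_expR oppr_lt0 !mulr_gt0// pi_gt0.
have [K D] := rapid_decay (rapid_opp (rapid_thc tau_gt0)).
have K0 := zdecay_ge0 D.
pose M := (tailc 2 + 1) * (K / (1 - r)).
have M0 : 0 <= M.
  by rewrite mulr_ge0 ?addr_ge0 ?tailc_ge0 ?ltr1n// divr_ge0// subr_ge0 ltW.
have M1 : 0 < (M + 1)^-1 by rewrite invr_gt0 ltr_wpDl.
have ceR : continuous (fun t : R => ee (RtoC t) : C).
  have := @cont_eeR R 1; by under eq_fun do rewrite mul1r.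
have /contR/(_ 0 _ M1)/nearR[d d0 H] := ceR.
exists (Num.min d 1); first by rewrite lt_min d0 ltr01.
split=> [|s]; first by rewrite ge_min lexx orbT.
rewrite lt_min => /andP[sd s1] s0.
have := H s; rewrite subr0 => /(_ sd); rewrite rmorph0 ee0 => {}H.
(* The terms of nonzero index; M bounds their sum for every s considered. *)
pose a2 (m : int) := if m == 0 then 0 else thc (0 - m) * pole tau s m.
have D2 : zdecay 2 (K / (1 - r)) a2.
  move=> m; rewrite /a2; case: eqVneq => m0.
    by rewrite nrm0 divr_ge0 ?exprn_ge0// divr_ge0// subr_ge0 ltW.
  rewrite nrmM mulrAC; apply: ler_pM; rewrite ?nrm_ge0//.
    by rewrite sub0r; exact: D.
  exact: nrm_pole_n0.
have D1 : zdecay 2 (nrm (pole tau s 0)) (fun m : int => if m == 0 then pole tau s 0 else 0).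
  move=> m; case: eqVneq => [->|_]; first by rewrite absz0 expr0 divr1.
  by rewrite nrm0 divr_ge0 ?exprn_ge0 ?nrm_ge0.
have -> : kersum tau s 0 = pole tau s 0 + zsum a2.
  rewrite -{1}(zsum_delta (pole tau s 0)) -(zsumD (ltr1n _ 2) D1 D2).
  apply: eq_zsum => m; rewrite /a2; case: (eqVneq m 0) => [->|m0]; last by rewrite [RHS]add0r.
  by rewrite subrr thc0 mul1r addr0.
have := zsum_bound (ltr1n _ 2) D2; rewrite -/M => h.
apply/eqP => /eqP; rewrite addr_eq0 => /eqP pE.
have : nrm (pole tau s 0) <= M by rewrite pE nrmN.
rewrite /pole mul0r ee0 mul1r nrmV nrmBC; set y := nrm _ in H * => h2.
have y0 : 0 < y.
  rewrite lt_def nrm_ge0 andbT nrm_eq0 subr_eq0; apply/eqP => e1.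
  have := @pole_ne0 _ _ tau_gt0 s s1 s0 0.
  by rewrite mul0r ee0 mul1r e1 subrr eqxx.
have : M + 1 < y^-1 by rewrite -[M + 1]invrK ltf_pV2 ?posrE.
lra.
Qed.

Lemma propagate : exists2 d : R, 0 < d & forall z, `|complex.Im z| < complex.Im tau ->
  ee z != 1 -> f z = 0 -> forall s, `|s| < d -> f (z + RtoC s) = 0.
Proof.
have [d d0 [d1 H]] := kersum0_neq0; exists d => // z hz z1 fz s sd.
have [->|s0] := eqVneq s 0; first by rewrite rmorph0 addr0.
have := kernel_zero tau_gt0 (lt_le_trans sd d1) s0 hz fz => /eqP.
rewrite !mulf_eq0 (negbTE (H s sd s0)) subr_eq0 eq_sym (negbTE z1) /= => /eqP//.
Qed.

(** The step d of [propagate] is the same at every point, so finitely many steps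
reach any t. *)
Lemma propagate_line (z : C) (t : R) : `|complex.Im z| < complex.Im tau ->
  (forall l : R, 0 <= l <= 1 -> ee (z + RtoC (l * t)) != 1) -> f z = 0 ->
  f (z + RtoC t) = 0.
Proof.
move=> hz hl fz; have [d d0 H] := propagate.
pose N := (Num.truncn (`|t| / d)).+1.
have N0 : 0 < N%:R :> R by [].
have step : `|t / N%:R| < d.
  rewrite normrM normfV [`|N%:R|]ger0_norm// ltr_pdivrMr// mulrC -ltr_pdivrMr//.
  exact: truncnS_gt.
have main k : (k <= N)%N -> f (z + RtoC (k%:R / N%:R * t)) = 0.
  elim: k => [|k IH] kN; first by rewrite !mul0r rmorph0 addr0.
  have -> : z + RtoC (k.+1%:R / N%:R * t) = z + RtoC (k%:R / N%:R * t) + RtoC (t / N%:R).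
    by rewrite -addrA -(rmorphD (real_complex R)) -natr1; congr (z + RtoC _); field; rewrite lt0r_neq0.
  apply: H => //; last by apply: IH; exact: ltnW.
    by rewrite cImD /= addr0.
  by apply: hl; rewrite divr_ge0//= ler_pdivrMr// mul1r ler_nat ltnW.
by have := main N (leqnn _); rewrite divff ?lt0r_neq0// mul1r.
Qed.

(** The mean of theta over any horizontal segment of length 1 is its constant
coefficient 1. *)
Lemma mean_zero (z : C) : (forall t : R, 0 <= t <= 1 -> f (z + RtoC t) = 0) -> False.
Proof.
move=> H; have ef := entire_thf tau_gt0.
have := mean_shift z ef (@thf_per _ tau); rewrite [RHS](mean_laurent (rapid_thc tau_gt0)) thc0.
have cf : continuous (fun t : R => f (z + RtoC t)).
  by apply: (cont_comp_RtoC (f := fun x => f (z + x))); apply: entire_cont; exact: entire_shift.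
have := @cint_bound _ _ 0 cf; rewrite mulr0 => hb h1.
have : nrm (cint (fun t : R => f (z + RtoC t))) <= 0.
  by apply: hb => t t01; rewrite H// nrm0.
by rewrite h1 nrm1 ler10.
Qed.

(** A zero off the integers spreads along its horizontal line. If the line is not
real it carries no integer and theta vanishes on a full period; if it is, the zero
is first moved into ]0, 1[ and spreads over that interval. Both contradict
[mean_zero]. *)
Lemma strip_zero (z : C) : `|complex.Im z| < complex.Im tau -> f z = 0 -> ee z = 1.
Proof.
move=> hz fz; apply/eqP/negPn/negP => z1.
have [Im0|Im0] := eqVneq (complex.Im z) 0; last first.
  apply: (@mean_zero z) => t _; apply: propagate_line => // l _.
  apply/eqP => /ee_eq1[n nE]; have := congr1 (@complex.Im R) nE.
  rewrite cImD /= addr0 => I0; move/eqP: Im0; rewrite I0.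
  by rewrite -(rmorph_int (real_complex R)).
set x := complex.Re z.
have zE : z = RtoC x by apply: complex_ext => //=.
pose n := Num.floor x; pose y := x - n%:~R.
have yE : RtoC y = z - n%:~R.
  by rewrite /y (rmorphB (real_complex R)) (rmorph_int (real_complex R)) zE.
have fy : f (RtoC y) = 0.
  by rewrite yE -[- _]mulrNz (per_int (@thf_per _ tau)).
have ey : ee (RtoC y) != 1 by rewrite yE eeB ee_int divr1.
have y01 : 0 < y < 1.
  have h1 := floor_le_tmp x; have h2 := lt_succ_floor x.
  have y0 : y != 0 by apply: contra ey => /eqP ->; rewrite rmorph0 ee0.
  rewrite intrD in h2; rewrite lt_def y0 /y /n; apply/andP; split; lra.
apply: (@mean_zero 0) => t /andP[t0 t1]; rewrite add0r.
have [->|tn0] := eqVneq t 0; first by rewrite rmorph0 (thf0 tau_gt0).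
have [->|tn1] := eqVneq t 1.
  by rewrite rmorph1 -[1]add0r thf_per (thf0 tau_gt0).
have -> : RtoC t = RtoC y + RtoC (t - y).
  by rewrite -(rmorphD (real_complex R)) addrC subrK.
apply: propagate_line => //; first by rewrite /= normr0.
move=> l /andP[l0 l1]; rewrite -(rmorphD (real_complex R)).
have tt : 0 < t < 1 by rewrite !lt_def t0 tn0 eq_sym tn1 t1.
have w01 : 0 < y + l * (t - y) < 1.
  move: y01 tt => /andP[a1 a2] /andP[b1 b2].
  have [yt|ty] := lerP y t.
    have h1 : 0 <= l * (t - y) by rewrite mulr_ge0 ?subr_ge0.
    have h2 : l * (t - y) <= t - y by rewrite ler_piMl ?subr_ge0.
    by apply/andP; split; lra.
  have h1 : 0 <= l * (y - t) by rewrite mulr_ge0 ?subr_ge0 ?(ltW ty).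
  have h2 : l * (y - t) <= y - t by rewrite ler_piMl ?subr_ge0 ?(ltW ty).
  by apply/andP; split; lra.
apply/eqP => /ee_eq1[k]; rewrite -(rmorph_int (real_complex R)) => /complexI kE.
by move: w01; rewrite kE -[1]/(1%:~R) ltr_int ltr0z; case: (k) => -[].
Qed.

(** Subtracting a multiple of tau brings a zero into the strip |Im z| < Im tau, where
it must be an integer. *)
Theorem thf_eq0 (z : C) : f z = 0 <-> Lambda tau z.
Proof.
split; last exact: thf_Lambda.
move=> fz; pose y := complex.Im z / complex.Im tau; pose n := Num.floor y.
have Ln : Lambda tau (tau * (- n)%:~R) by exists 0, (- n); rewrite add0r.
have fw : f (z + tau * (- n)%:~R) = 0.
  by apply/eqP; rewrite thf_lattice// fz.
have ImE : complex.Im (z + tau * (- n)%:~R : C) = (y - n%:~R) * complex.Im tau.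
  rewrite cImD mulrNz -(rmorph_int (real_complex R)) mulrN cImN cImM /= mulr0 add0r.
  by rewrite mulrBl /y divfK ?lt0r_neq0// [n%:~R * _]mulrC.
have [|k kE] := @ee_eq1 _ (z + tau * (- n)%:~R).
  apply: strip_zero => //; rewrite ImE.
  have h1 := floor_le_tmp y; have h2 := lt_succ_floor y; rewrite intrD in h2.
  rewrite normrM [`|complex.Im tau|]gtr0_norm// gtr_pMl// ger0_norm; rewrite /n; lra.
exists k, n; rewrite -kE mulrNz mulrN; ring.
Qed.

End ZeroSet.

(** * Matrix-valued series *)

Section MatrixSeries.
Context {R : realType} {n : nat}.
Local Notation C := (Cplx R).
Local Notation M := 'M[C]_n.

Definition mzsum (A : int -> M) : M := \matrix_(i, j) zsum (fun m => A m i j).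
Definition mrapid (A : int -> M) := forall i j, rapid (fun m => A m i j).

Lemma mzsumE A i j : mzsum A i j = zsum (fun m => A m i j).
Proof. exact: mxE. Qed.

Lemma rapid_sum (I : Type) (s : seq I) (a : I -> int -> C) : (forall i, rapid (a i)) ->
  rapid (fun m => \sum_(i <- s) a i m).
Proof.
move=> ra; elim: s => [|i s IH] r r0.
  by exists 0 => m; rewrite big_nil nrm0 mul0r.
have [K H] := rapidD (ra i) IH r0; exists K => m; rewrite big_cons; exact: H.
Qed.

Lemma rapidZ (a : int -> C) (c : C) : rapid a -> rapid (fun m => a m * c).
Proof. by move=> ra; apply: (rapidMb ra (b := fun=> c) (fun=> lexx _)). Qed.

Lemma zsum_sum_rapid (I : Type) (s : seq I) (a : I -> int -> C) : (forall i, rapid (a i)) ->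
  zsum (fun m => \sum_(i <- s) a i m) = \sum_(i <- s) zsum (a i).
Proof.
move=> ra; elim: s => [|i s IH].
  rewrite big_nil; apply: (@zsumP _ 2 (ltr1n _ 2) 0) => N.
  by rewrite /wsum big1 ?subrr ?nrm0 ?mul0r// => j _; exact: big_nil.
rewrite big_cons -IH -(zsumD_rapid (ra i) (rapid_sum s ra)).
by apply: eq_zsum => m; rewrite big_cons.
Qed.

Lemma lin_entry (L : M -> M) (X : M) i j : linear L ->
  L X i j = \sum_k \sum_l X k l * L (delta_mx k l) i j.
Proof.
move=> linL; pose L' : {linear M -> M} := HB.pack L (GRing.isLinear.Build _ _ _ _ L linL).
rewrite -[L]/(L' : M -> M) {1}[X]matrix_sum_delta linear_sum summxE; apply: eq_bigr => k _.
rewrite linear_sum summxE; apply: eq_bigr => l _.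
by rewrite linearZ mxE.
Qed.

Lemma mzsum_lin (L : M -> M) A : linear L -> mrapid A ->
  mzsum (fun m => L (A m)) = L (mzsum A).
Proof.
move=> linL rA; apply/matrixP => i j; rewrite mxE lin_entry//.
rewrite (_ : (fun m => _) = (fun m => \sum_k \sum_l A m k l * L (delta_mx k l) i j)); last first.
  by apply/funext => m; rewrite lin_entry.
have r1 k l : rapid (fun m => A m k l * L (delta_mx k l) i j) by apply: rapidZ; exact: rA.
rewrite zsum_sum_rapid => [|k]; last exact: rapid_sum.
apply: eq_bigr => k _; rewrite zsum_sum_rapid//; apply: eq_bigr => l _.
rewrite mxE mulrC -zsumZ_rapid; last exact: rA.
by apply: eq_zsum => m; rewrite mulrC.
Qed.

Lemma mzsum_shift A : mrapid A -> mzsum (fun m => A (m + 1)) = mzsum A.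
Proof.
by move=> rA; apply/matrixP => i j; rewrite !mxE (zsum_shift_rapid 1 (rA i j)).
Qed.

Lemma eq_mzsum A A' : A =1 A' -> mzsum A = mzsum A'.
Proof. by move=> /funext ->. Qed.

(** Submultiplicative, which is what the growth of the powers of B requires. *)
Definition mxn (X : M) : R := \sum_i \sum_j nrm (X i j).

Lemma mxn_ge0 X : 0 <= mxn X.
Proof. by apply: sumr_ge0 => i _; apply: sumr_ge0 => j _; exact: nrm_ge0. Qed.

Lemma nrm_mxn (X : M) i j : nrm (X i j) <= mxn X.
Proof.
rewrite /mxn (bigD1 i)//= (bigD1 j)//= -addrA lerDl addr_ge0//.
  by apply: sumr_ge0 => ? _; exact: nrm_ge0.
by apply: sumr_ge0 => ? _; apply: sumr_ge0 => ? _; exact: nrm_ge0.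
Qed.

Lemma mxnM (X Y : M) : mxn (X *m Y) <= mxn X * mxn Y.
Proof.
rewrite /mxn mulr_suml; apply: ler_sum => i _.
apply: (@le_trans _ _ (\sum_j \sum_k nrm (X i k) * nrm (Y k j))).
  apply: ler_sum => j _; rewrite mxE; apply: (le_trans (nrm_sum _ _ _)).
  by apply: ler_sum => k _; rewrite nrmM.
rewrite exchange_big mulr_suml /=; apply: ler_sum => k _.
rewrite -mulr_sumr ler_wpM2l ?nrm_ge0// [leRHS](bigD1 k)//= lerDl.
by apply: sumr_ge0 => ? _; apply: sumr_ge0 => ? _; exact: nrm_ge0.
Qed.

Variables (B Bi : M).
Hypothesis BBi : B *m Bi = 1%:M.
Let BiB : Bi *m B = 1%:M. Proof. exact: mulmx1C. Qed.

(** B^(- m) X B^m for m in Z, as iterated conjugation, when Bi is the inverse of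
B. *)
Definition adpow (m : int) (X : M) : M :=
  match m with
  | Posz k => iter k (fun Y => Bi *m Y *m B) X
  | Negz k => iter k.+1 (fun Y => B *m Y *m Bi) X
  end.

Lemma conjK X : B *m (Bi *m X *m B) *m Bi = X.
Proof. by rewrite !mulmxA BBi mul1mx -mulmxA BBi mulmx1. Qed.

Lemma conjVK X : Bi *m (B *m X *m Bi) *m B = X.
Proof. by rewrite !mulmxA BiB mul1mx -mulmxA BiB mulmx1. Qed.

Lemma adpowS m X : adpow (m + 1) X = Bi *m adpow m X *m B.
Proof.
case: m => k; first by rewrite -PoszD addn1.
case: k => [|k]; first by rewrite NegzE addNr /= conjVK.
rewrite NegzE (_ : - k.+2%:Z + 1 = Negz k); first by rewrite /= conjVK.
by rewrite NegzE -[k.+2]addn1 PoszD opprD subrK.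
Qed.

Lemma adpow0 X : adpow 0 X = X.
Proof. by []. Qed.

Lemma adpowB1 m X : adpow (m - 1) X = B *m adpow m X *m Bi.
Proof. by rewrite -[in RHS](subrK 1 m) adpowS conjK. Qed.

Lemma adpow_lin m : linear (adpow m).
Proof.
have h (P Q : M) k : linear (iter k (fun Y => P *m Y *m Q)).
  elim: k => [|k IH] c X Y //=.
  by rewrite IH mulmxDr mulmxDl -scalemxAr -scalemxAl.
by case: m => k; exact: h.
Qed.

Lemma adpow_comm (P Q : M) m X : P *m B = B *m P -> Q *m B = B *m Q ->
  adpow m (P *m X *m Q) = P *m adpow m X *m Q.
Proof.
move=> PB QB.
have cV (Z : M) : Z *m B = B *m Z -> Z *m Bi = Bi *m Z.
  by move=> h; rewrite -[LHS]mul1mx -BiB !mulmxA -(mulmxA Bi B) -h !mulmxA -mulmxA BBi mulmx1.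
have PBi := cV _ PB; have QBi := cV _ QB.
have it (U V : M) k : P *m U = U *m P -> Q *m V = V *m Q ->
    iter k (fun Y => U *m Y *m V) (P *m X *m Q) = P *m iter k (fun Y => U *m Y *m V) X *m Q.
  move=> PU QV; elim: k => [|k IH] //; rewrite !iterS IH; move: (iter _ _ _) => Z.
  by rewrite !mulmxA -PU -!(mulmxA _ Q) QV !mulmxA.
by case: m => k; apply: it.
Qed.

Lemma adpow_bound X i j : geom_bounded (mxn Bi * mxn B + 1) (fun m => adpow m X i j).
Proof.
exists (mxn X) => [|m]; first exact: mxn_ge0.
apply: (le_trans (nrm_mxn _ _ _)); set rho := _ + 1.
have h (P Q : M) k : mxn P * mxn Q <= rho -> mxn (iter k (fun Y => P *m Y *m Q) X) <= mxn X * rho ^+ k.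
  move=> PQ; elim: k => [|k IH] /=; first by rewrite mulr1.
  apply: (le_trans (mxnM _ _)); apply: (le_trans (ler_wpM2r (mxn_ge0 _) (mxnM _ _))).
  rewrite mulrAC exprSr mulrA mulrC; apply: ler_pM => //; rewrite ?mulr_ge0 ?mxn_ge0//.
have h1 : mxn Bi * mxn B <= rho by rewrite lerDl.
by case: m => k; apply: h; rewrite // mulrC.
Qed.

End MatrixSeries.
(* Conversion would otherwise unfold the series when matrix entries are
   compared. *)
#[global] Opaque adpow mzsum.

(** * The theta operators F(w) *)

Section EigInSub.
Variables (K : fieldType) (V : lmodType K) (T : V -> V) (W : V -> Prop).
Hypothesis WT : forall X a, W X -> W (T X - a *: X).

(** If the product of the operators T - a over s annihilates X, the last nonzero
vector obtained by applying the factors one after the other is an eigenvector, and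
it has not left the stable subspace W. *)
Lemma eig_in_sub (s : seq K) (X : V) : X != 0 -> W X ->
  foldl (fun X a => T X - a *: X) X s = 0 ->
  exists a Y, [/\ a \in s, Y != 0, W Y & T Y = a *: Y].
Proof.
elim: s X => [|a s IH] X X0 WX /=; first by move=> X00; rewrite X00 eqxx in X0.
have [/eqP|Z0] := eqVneq (T X - a *: X) 0.
  by rewrite subr_eq0 => /eqP TX _; exists a, X; rewrite mem_head.
by move=> /(IH _ Z0 (WT a WX))[b [Y [bs Y0 WY TY]]]; exists b, Y; rewrite in_cons bs orbT.
Qed.

End EigInSub.

Section Fop.
Context {R : realType} {n : nat}.
Local Notation C := (Cplx R).
Local Notation M := 'M[C]_n.
Variable tau : C.
Hypothesis tau_gt0 : 0 < complex.Im tau.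
Variable B : M.
Hypothesis B_unit : B \in unitmx.
Local Notation Bi := (invmx B).
Local Notation thc := (thc tau).

Let BBi : B *m Bi = 1%:M. Proof. exact: mulmxV. Qed.
Let BiB : Bi *m B = 1%:M. Proof. exact: mulVmx. Qed.

(** The theta series in which e(m w) is twisted by the m-th power of the conjugation
X |-> B^-1 X B. *)
Definition Fop (w : C) (X : M) : M :=
  mzsum (fun m => (thc m * ee (m%:~R * w)) *: adpow B Bi m X).

Lemma mx_linE (c : C) (P Q : M) i j : (c *: P + Q) i j = c * P i j + Q i j.
Proof. by rewrite !mxE. Qed.

Lemma rapid_coef X i j : rapid (fun m => thc m * adpow B Bi m X i j).
Proof.
apply: rapidM (rapid_thc tau_gt0) (adpow_bound _ _ X i j).
by rewrite ltr_wpDl// mulr_ge0 ?mxn_ge0.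
Qed.

Lemma Fop_entry w X i j : Fop w X i j = laurent (fun m => thc m * adpow B Bi m X i j) w.
Proof. by rewrite [LHS]mzsumE; apply: eq_zsum => m; rewrite mxE mulrAC. Qed.

Lemma FopE w X : Fop w X = mzsum (fun m => (thc m * ee (m%:~R * w)) *: adpow B Bi m X).
Proof. by []. Qed.

Opaque Fop.

Lemma mrapid_Fop w X : mrapid (fun m => (thc m * ee (m%:~R * w)) *: adpow B Bi m X).
Proof.
move=> i j r r0; have [K H] := rapid_ee w (rapid_coef X i j) r0; exists K => m.
by rewrite mxE mulrAC.
Qed.

Lemma laurent_lin w c (a b : int -> C) : rapid a -> rapid b ->
  laurent (fun m => c * a m + b m) w = c * laurent a w + laurent b w.
Proof.
move=> ra rb; rewrite /laurent -(zsumZ_rapid c (rapid_ee w ra)) -zsumD_rapid.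
- by apply: eq_zsum => m; ring.
- move=> r r0; have [K H] := rapidZ c (rapid_ee w ra) r0; exists K => m.
  by rewrite [c * _]mulrC.
- exact: rapid_ee.
Qed.

Lemma Fop_lin w : linear (Fop w).
Proof.
move=> c X Y; apply/matrixP => i j.
have h0 := mx_linE c (Fop w X) (Fop w Y) i j.
have h1 := Fop_entry w X i j.
have h2 := Fop_entry w Y i j.
have h3 := Fop_entry w (c *: X + Y) i j.
have e : (fun m => thc m * adpow B Bi m (c *: X + Y) i j) =
    (fun m => c * (thc m * adpow B Bi m X i j) + thc m * adpow B Bi m Y i j).
  apply/funext => m; rewrite adpow_lin mx_linE.
  by rewrite mulrDr mulrCA.
rewrite e (laurent_lin w c (rapid_coef X i j) (rapid_coef Y i j)) in h3.
rewrite h3 h0; exact: (esym (congr2 (fun x y => c * x + y) h1 h2)).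
Qed.

Lemma Fop_per w X : Fop (w + 1) X = Fop w X.
Proof.
apply/matrixP => i j.
have h1 := Fop_entry (w + 1) X i j.
have h2 := Fop_entry w X i j.
rewrite laurent_per in h1.
exact: (etrans h1 (esym h2)).
Qed.

Lemma mul_lin (P Q : M) : linear (fun X => P *m X *m Q).
Proof. by move=> c X Y; rewrite mulmxDr mulmxDl -scalemxAr -scalemxAl. Qed.

Lemma Fop_comm w (P Q : M) X : P *m B = B *m P -> Q *m B = B *m Q ->
  Fop w (P *m X *m Q) = P *m Fop w X *m Q.
Proof.
move=> PB QB; have h := mzsum_lin (mul_lin P Q) (mrapid_Fop w X).
rewrite -(FopE w X) in h; rewrite -h (FopE w (P *m X *m Q)).
apply: eq_mzsum => m; rewrite (adpow_comm BBi m X PB QB).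
by rewrite -scalemxAr -scalemxAl.
Qed.

(** Replacing m by m + 1 in the series conjugates X by B once more and multiplies the
coefficient by - e((m + 1) tau). *)
Lemma Fop_tau w X : Fop (w + tau) X *m B = (- ee (- (w + tau))) *: (B *m Fop w X).
Proof.
have rs : mrapid (fun m => (thc (m + 1) * ee ((m + 1)%:~R * w)) *: adpow B Bi (m + 1) X).
  by move=> i j; exact: (rapid_shift 1 (mrapid_Fop w X i j)).
have lin : linear (fun Y : M => (- ee (- (w + tau))) *: (B *m Y *m Bi)).
  by move=> c Y Z; rewrite (mul_lin B Bi) scalerDr !scalerA mulrC.
have h1 := mzsum_lin lin rs.
have h2 := mzsum_shift (mrapid_Fop w X); rewrite -(FopE w X) in h2.
rewrite h2 in h1.
suff h3 : Fop (w + tau) X = (- ee (- (w + tau))) *: (B *m Fop w X *m Bi).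
  by rewrite h3 -scalemxAl -mulmxA BiB mulmx1.
rewrite -h1 (FopE (w + tau) X); apply: eq_mzsum => m.
rewrite (adpowS BBi) -scalemxAr -scalemxAl scalerA (conjK BBi); congr (_ *: _).
rewrite thcS; have -> : ee (- (w + tau)) = (ee w)^-1 * (ee tau)^-1 by rewrite eeN eeD invfM.
rewrite intrD !mulrDl !mulrDr !eeD !mul1r; field.
by rewrite !ee_neq0.
Qed.

(** On Y conjugation is multiplication by beta/alpha = e(mu), so the series becomes
the scalar theta series at w + mu. *)
Lemma Fop_eig w mu (al be : C) Y : al != 0 -> B *m Y = al *: Y -> Y *m B = be *: Y ->
  ee mu = be / al -> be != 0 -> Fop w Y = thf tau (w + mu) *: Y.
Proof.
move=> al0 BY YB muE be0.
have BiY : Bi *m Y = al^-1 *: Y.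
  by rewrite -[LHS](scalerK al0) scalemxAr -BY mulmxA BiB mul1mx.
have YBi : Y *m Bi = be^-1 *: Y.
  by rewrite -[LHS](scalerK be0) scalemxAl -YB -mulmxA BBi mulmx1.
have ad m : adpow B Bi m Y = ee (m%:~R * mu) *: Y.
  have up k : adpow B Bi k Y = ee (k%:~R * mu) *: Y -> adpow B Bi (k + 1) Y = ee ((k + 1)%:~R * mu) *: Y.
    move=> IH; rewrite (adpowS BBi) IH -scalemxAr -scalemxAl BiY -scalemxAl YB !scalerA.
    by rewrite intrD mulrDl mul1r eeD muE; congr (_ *: _); ring.
  have dn k : adpow B Bi k Y = ee (k%:~R * mu) *: Y -> adpow B Bi (k - 1) Y = ee ((k - 1)%:~R * mu) *: Y.
    move=> IH; rewrite (adpowB1 BBi) IH -scalemxAr -scalemxAl BY -scalemxAl YBi !scalerA.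
    by rewrite intrB mulrBl mul1r eeB muE invf_div; congr (_ *: _); ring.
  case: m => k.
    elim: k => [|k IH]; first by rewrite adpow0 mul0r ee0 scale1r.
    by have := up k IH; rewrite -PoszD addn1.
  rewrite NegzE; elim: k => [|k IH].
    by have := dn 0; rewrite sub0r; apply; rewrite adpow0 mul0r ee0 scale1r.
  by have := dn _ IH; rewrite -opprD -PoszD addn1.
apply/matrixP => i j; have h := Fop_entry w Y i j.
apply: (etrans h); rewrite mxE /thf /laurent mulrC.
rewrite -(zsumZ_rapid _ (rapid_ee (w + mu) (rapid_thc tau_gt0))).
by apply: eq_zsum => m; rewrite ad mxE mulrDr eeD; ring.
Qed.

Lemma foldl_left (s : seq C) (X : M) :
  foldl (fun Y a => B *m Y - a *: Y) X s = (foldr (fun a P => P *m (B - a%:M)) 1%:M s) *m X.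
Proof.
elim: s X => [|a s IH] X /=; first by rewrite mul1mx.
by rewrite IH -mulmxA mulmxBl mul_scalar_mx.
Qed.

Lemma foldl_right (s : seq C) (X : M) :
  foldl (fun Y a => Y *m B - a *: Y) X s = X *m (foldr (fun a P => (B - a%:M) *m P) 1%:M s).
Proof.
elim: s X => [|a s IH] X /=; first by rewrite mulmx1.
by rewrite IH mulmxA mulmxBr mul_mx_scalar.
Qed.

End Fop.

Section CharRoots.
Context {R : realType}.
Local Notation C := (Cplx R).

(** Cayley-Hamilton, with the characteristic polynomial split into linear factors.
The product is written as a fold in both orders, matching the successive left and
right multiplications by B - a. *)
Lemma char_roots n (B : 'M[C]_n) : exists s : seq C,
  [/\ (forall a, eigenvalue B a <-> a \in s),
      foldr (fun a P => P *m (B - a%:M)) 1%:M s = 0 \/ n = 0 &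
      foldr (fun a P => (B - a%:M) *m P) 1%:M s = 0 \/ n = 0].
Proof.
case: n B => [|n] B.
  exists [::]; split; [|by right|by right].
  move=> a; split => // /eigenvalueP[v _ v0]; by rewrite (thinmx0 v) eqxx in v0.
have [s sE] : exists s : seq C, char_poly B = \prod_(z <- s) ('X - z%:P) :> {poly C}.
  have [s sE] := closed_field_poly_normal (char_poly B : {poly R[i]}).
  rewrite (monicP (char_poly_monic B)) scale1r in sE.
  by exists s; exact: sE.
exists s; split.
- move=> a; rewrite eigenvalue_root_char sE root_prod_XsubC //.
- left; have := Cayley_Hamilton B; rewrite sE => <-.
  elim: s {sE} => [|a s IH]; first by rewrite big_nil; exact: (esym (rmorph1 (horner_mx B))).
  have h : horner_mx B ('X - a%:P) = B - a%:M by rewrite rmorphB /= horner_mx_X horner_mx_C.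
  have E := rmorphM (horner_mx B) (\prod_(z <- s) ('X - z%:P)) ('X - a%:P).
  by rewrite big_cons mulrC; apply: etrans (esym E); rewrite /= -IH h.
- left; have := Cayley_Hamilton B; rewrite sE => <-.
  elim: s {sE} => [|a s IH]; first by rewrite big_nil; exact: (esym (rmorph1 (horner_mx B))).
  have h : horner_mx B ('X - a%:P) = B - a%:M by rewrite rmorphB /= horner_mx_X horner_mx_C.
  have E := rmorphM (horner_mx B) ('X - a%:P) (\prod_(z <- s) ('X - z%:P)).
  by rewrite big_cons; apply: etrans (esym E); rewrite /= -IH h.
Qed.

End CharRoots.

(** * Quasi-periodic matrix functions *)

Section FopInj.
Context {R : realType} {n : nat}.
Local Notation C := (Cplx R).
Local Notation M := 'M[C]_n.
Variable tau : C.
Hypothesis tau_gt0 : 0 < complex.Im tau.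
Variable B : M.
Hypothesis B_unit : B \in unitmx.

Lemma eigenvalue_neq0 a : eigenvalue B a -> a != 0.
Proof.
move=> /eigenvalueP[v vB v0]; apply: contraNneq v0 => a0.
by rewrite -[v]mulmx1 -(mulmxV B_unit) mulmxA vB a0 scale0r mul0mx.
Qed.

Lemma lin0 (V W : lmodType C) (F : V -> W) : linear F -> F 0 = 0.
Proof. by move=> lF; have := lF (-1) 0 0; rewrite scaler0 addr0 scaleN1r addNr. Qed.

(** The kernel of F(v) is stable under left and right multiplication by B. If it is
nonzero, it contains a common eigenvector Y of both, and F(v) Y = 0 says that theta
vanishes at v + log beta - log alpha, whence v is in Sigma. *)
Lemma Fop_inj v X : ~ Sigma tau B v -> Fop tau B v X = 0 -> X = 0.
Proof.
move=> vS FX; apply/eqP/negPn/negP => X0; apply: vS.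
have [s [sE sl sr]] := char_roots B.
have [n0|n0] := eqVneq n 0%N.
  have X00 : X = 0 by apply/matrixP => i j; exfalso; have := ltn_ord i; rewrite [X in (_ < X)%N]n0.
  by rewrite X00 eqxx in X0.
case: sl => [sl|/eqP]; last by rewrite (negbTE n0).
case: sr => [sr|/eqP]; last by rewrite (negbTE n0).
have linF := Fop_lin tau_gt0 B v.
have FBl Y : Fop tau B v (B *m Y) = B *m Fop tau B v Y.
  have := Fop_comm tau_gt0 B_unit v Y (erefl (B *m B)) (etrans (mul1mx B) (esym (mulmx1 B))).
  by rewrite !mulmx1.
have FBr Y : Fop tau B v (Y *m B) = Fop tau B v Y *m B.
  have := Fop_comm tau_gt0 B_unit v Y (etrans (mul1mx B) (esym (mulmx1 B))) (erefl (B *m B)).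
  by rewrite !mul1mx.
have linB (Y Z : M) a : Fop tau B v Y = 0 -> Fop tau B v Z = 0 -> Fop tau B v (Y - a *: Z) = 0.
  by move=> FY FZ; rewrite addrC -scaleNr linF FY FZ scaler0 addr0.
have [a [Y [as_ Y0 FY BY]]] := @eig_in_sub C M (mulmx B) (fun Y => Fop tau B v Y = 0)
  (fun Y a FY => linB _ _ a (etrans (FBl Y) (etrans (congr1 (mulmx B) FY) (mulmx0 _ B))) FY)
  s X X0 FX (etrans (foldl_left B s X) (etrans (congr1 (mulmx^~ X) sl) (mul0mx _ X))).
have [b [Z [bs Z0 [FZ BZ] ZB]]] := @eig_in_sub C M (mulmx^~ B)
  (fun Y => Fop tau B v Y = 0 /\ B *m Y = a *: Y)
  (fun Y b FY => conj (linB _ _ b (etrans (FBr Y) (etrans (congr1 (mulmx^~ B) FY.1) (mul0mx _ B))) FY.1)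
     (etrans (mulmxBr _ _ _) (etrans (congr2 (fun P Q => P - Q)
        (etrans (mulmxA _ _ _) (etrans (congr1 (mulmx^~ B) FY.2) (esym (scalemxAl _ _ _))))
        (etrans (esym (scalemxAr _ _ _)) (etrans (congr1 (fun P => b *: P) FY.2)
            (etrans (scalerA _ _ _) (etrans (congr1 (fun c => c *: Y) (mulrC b a)) (esym (scalerA _ _ _)))))))
        (esym (scalerBr _ _ _)))))
  s Y Y0 (conj FY BY) (etrans (foldl_right B s Y) (etrans (congr1 (mulmx Y) sr) (mulmx0 _ Y))).
have ea := (sE a).2 as_; have eb := (sE b).2 bs.
have a0 := eigenvalue_neq0 ea; have b0 := eigenvalue_neq0 eb.
have [la laE] := ee_surj a0; have [lb lbE] := ee_surj b0.
have muE : ee (lb - la) = b / a by rewrite eeB laE lbE.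
have := Fop_eig tau_gt0 B_unit v a0 BZ ZB muE b0; rewrite FZ => /esym/eqP.
rewrite scaler_eq0 (negbTE Z0) orbF => /eqP/(thf_eq0 tau_gt0) L.
exists la, lb, (v + (lb - la)); split.
- by rewrite -[cexp _]/(ee la) laE.
- by rewrite -[cexp _]/(ee lb) lbE.
- exact: L.
- ring.
Qed.

End FopInj.

Section MatFourier.
Context {R : realType} {n : nat}.
Local Notation C := (Cplx R).
Local Notation RtoC t := ((t : R)%:C : C).
Local Notation M := 'M[C]_n.
Local Notation ek k t := (ee ((k : int)%:~R * RtoC t)).

Definition mx_entire (Phi : C -> M) := forall i j, entire (fun z => Phi z i j).

Lemma hol_lin (L : M -> M) Phi : linear L -> mx_entire Phi -> mx_entire (fun z => L (Phi z)).
Proof.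
move=> linL hP i j.
rewrite (_ : (fun z => _) = (fun z => \sum_k \sum_l Phi z k l * L (delta_mx k l) i j)); last first.
  by apply/funext => z; rewrite lin_entry.
apply: (entire_sum) => k; apply: (entire_sum) => l; apply: entireM; [exact: hP|exact: entire_cst].
Qed.

Definition mcoef (k : int) (Phi : C -> M) : M :=
  \matrix_(i, j) cint (fun t => Phi (RtoC t) i j * ek (- k) t).

Lemma mcoefE k Phi i j : mcoef k Phi i j = cint (fun t => Phi (RtoC t) i j * ek (- k) t).
Proof. exact: mxE. Qed.

Lemma cont_entry Phi i j k : mx_entire Phi -> continuous (fun t : R => Phi (RtoC t) i j * ek k t).
Proof.
move=> hP; apply: (@ccontM _ _ (fun t : R => Phi (RtoC t) i j) (fun t : R => ek k t)).
  exact: (cont_comp_RtoC (entire_cont (hP i j))).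
exact: cont_eeR.
Qed.

Lemma mcoef_lin k (L : M -> M) Phi : linear L -> mx_entire Phi ->
  mcoef k (fun z => L (Phi z)) = L (mcoef k Phi).
Proof.
move=> linL hP; apply/matrixP => i j; rewrite mcoefE lin_entry//.
transitivity (cint (fun t => \sum_p \sum_q L (delta_mx p q) i j * (Phi (RtoC t) p q * ek (- k) t))).
  apply: eq_cint => t; rewrite lin_entry// mulr_suml; apply: eq_bigr => p _.
  by rewrite mulr_suml; apply: eq_bigr => q _; rewrite mulrAC mulrC.
have c0 p q := @cont_entry Phi p q (- k) hP.
have c1 p q : continuous (fun t : R => L (delta_mx p q) i j * (Phi (RtoC t) p q * ek (- k) t)).
  exact: (@contZ _ _ _ (c0 p q)).
rewrite (@cint_sum _ _ _ (fun p t => \sum_q L (delta_mx p q) i j * (Phi (RtoC t) p q * ek (- k) t))); last first.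
  by move=> p; exact: (@cont_sum R _ (index_enum 'I_n) _ (c1 p)).
apply: eq_bigr => p _.
rewrite (@cint_sum _ _ _ (fun q t => L (delta_mx p q) i j * (Phi (RtoC t) p q * ek (- k) t)) (c1 p)).
by apply: eq_bigr => q _; rewrite (cintZ _ (c0 p q)) mcoefE mulrC.
Qed.

Variable tau : C.
Variable B : M.
Hypothesis B_unit : B \in unitmx.
Local Notation Bi := (invmx B).

(** Theta functions of degree d with values in matrices; Sol_(B,v,tau) is the case
d = 1, see [SolP]. *)
Definition qper (d : nat) (ka : C) (Phi : C -> M) :=
  [/\ mx_entire Phi, forall z, Phi (z + 1) = Phi z &
     forall z, Phi (z + tau) *m B = (ka * ee (- (d%:R * z))) *: (B *m Phi z)].

(** The Fourier coefficients may be computed on the line Im z = Im tau as well, and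
the functional equation compares the values on the two lines. *)
Lemma mcoef_rec d ka Phi k : qper d ka Phi ->
  mcoef k Phi = (ka * ee (- (k%:~R * tau))) *: (B *m mcoef (k + d%:Z) Phi *m Bi).
Proof.
move=> [hP per qp].
have qp' z : Phi (z + tau) = (ka * ee (- (d%:R * z))) *: (B *m Phi z *m Bi).
  by rewrite scalemxAl -qp mulmxK.
have linB : linear (fun X : M => B *m X *m Bi) by exact: mul_lin.
rewrite -(mcoef_lin (k + d%:Z) linB hP); apply/matrixP => i j.
rewrite mcoefE mxE mcoefE.
pose g x := Phi x i j * ee ((- k)%:~R * x).
have eg : entire g by apply: entireM; [exact: hP|exact: entire_ee].
have pg x : g (x + 1) = g x by rewrite /g per mulrDr eeD mulr1 ee_int mulr1.
rewrite -(mean_shift tau eg pg) -cintZ; last exact: (@cont_entry _ i j _ (hol_lin linB hP)).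
apply: eq_cint => t; rewrite /g [tau + _]addrC qp' mxE mulrDr eeD.
rewrite !intrN intrD !mulNr mulrDl opprD !eeD; ring.
Qed.

(** By [mcoef_rec], d consecutive vanishing coefficients force all coefficients to
vanish. *)
Lemma qper_uniq d ka Phi : (0 < d)%N -> ka != 0 -> qper d ka Phi ->
  (forall k : nat, (k < d)%N -> mcoef k Phi = 0) -> forall z, Phi z = 0.
Proof.
move=> d0 ka0 qP H.
have [hP per _] := qP.
have up (k : int) : mcoef k Phi = 0 -> mcoef (k + d%:Z) Phi = 0.
  rewrite (mcoef_rec k qP) => /eqP; rewrite scaler_eq0 mulf_eq0 (negbTE ka0) (negbTE (ee_neq0 _)) /=.
  move=> /eqP h; rewrite -[LHS]mul1mx -(mulVmx B_unit) -mulmxA -[B *m _]mulmx1 -(mulVmx B_unit).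
  by rewrite [_ *m (_ *m B)]mulmxA h mul0mx mulmx0.
have dn (k : int) : mcoef (k + d%:Z) Phi = 0 -> mcoef k Phi = 0.
  by move=> h; rewrite (mcoef_rec k qP) h mulmx0 mul0mx scaler0.
have all0 (k : int) : mcoef k Phi = 0.
  rewrite (divz_eq k d).
  have d0' : d%:Z != 0 by rewrite eqz_nat -lt0n.
  have m0 : mcoef (k %% d)%Z Phi = 0.
    have := modz_ge0 k d0'; have := ltz_pmod k (d := d) d0.
    by case: (k %% d)%Z => // r rd _; apply: H.
  move: (k %/ d)%Z (k %% d)%Z m0 => q r m0.
  case: q => q.
    elim: q => [|q IH]; first by rewrite mul0r add0r.
    have := up _ IH; rewrite (_ : _ + _ + _ = q.+1%:Z * d%:Z + r)//.
    by rewrite -addn1 PoszD; ring.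
  rewrite NegzE; elim: q => [|q IH]; apply: dn.
    by rewrite (_ : _ + _ + _ = r)//; ring.
  rewrite (_ : _ + _ + _ = - q.+1%:Z * d%:Z + r)//.
  by rewrite -[q.+2]addn1 PoszD; ring.
move=> z; apply/matrixP => i j; rewrite [RHS]mxE.
apply: (fourier_uniq (hP i j)) => [x|k]; first by rewrite per.
by rewrite -mcoefE all0 mxE.
Qed.

End MatFourier.

(** * Differentiability of matrix expressions *)

Section DiffMx.
Context {R : realType}.
Local Notation C := (Cplx R).

Lemma diff_mxE (V : normedModType C) m n (F : V -> 'M[C]_(m, n)) (p : V) :
  (forall i j, differentiable (fun z => F z i j : C) p) -> differentiable F p.
Proof.
move=> dF.
have -> : F = \sum_(i < m) \sum_(j < n) (fun z => F z i j *: (delta_mx i j : 'M[C]_(m, n))).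
  apply/funext => z; rewrite {1}[F z]matrix_sum_delta fct_sumE; apply: eq_bigr => i _.
  by rewrite fct_sumE.
apply: differentiable_sum => i; apply: differentiable_sum => j.
exact: differentiableZl.
Qed.

Lemma diff_entry (V : normedModType C) m n (F : V -> 'M[C]_(m, n)) (p : V) i j :
  differentiable F p -> differentiable (fun z => F z i j : C) p.
Proof.
move=> dF; exact: (differentiable_comp dF (differentiable_coord _ i j)).
Qed.

End DiffMx.

Section DiffTools.
Context {R : realType}.
Local Notation C := (Cplx R).

(** r is defined on the whole plane but given by a formula on its domain only;
differentiability must be transported along an equality of germs. *)
Lemma differentiable_near (V W : normedModType C) (f g : V -> W) x :
  (\forall z \near x, f z = g z) -> differentiable g x -> differentiable f x.
Proof.
move=> fg dg; have fgx : f x = g x by exact: nbhs_singleton fg.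
have /diff_locallyP[cg Eg] := dg.
have E : f \o shift x = cst (f x) + 'd g x +o_ 0 id.
  apply/eqaddoP => e e0; move: Eg => /eqaddoP/(_ _ e0) Eg.
  rewrite (near_shift 0 x) subr0 in fg.
  near=> h.
  have -> : ((f \o shift x - (cst (f x) + 'd g x)) : V -> W) h =
            ((g \o shift x - (cst (g x) + 'd g x)) : V -> W) h.
    by rewrite /= !fctE /= fgx; congr (_ - _); near: h.
  by near: h.
apply/diff_locallyP; rewrite (diff_unique cg E); split; [exact: cg|exact: E].
Unshelve. all: by end_near. Qed.

Section Closure.
Variables (V : normedModType C) (p : V).
Implicit Types f g : V -> C.

Lemma differentiable_bigsum (I : Type) (s : seq I) (f : I -> V -> C) :
  (forall i, differentiable (f i) p) -> differentiable (fun z => \sum_(i <- s) f i z) p.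
Proof.
move=> df; elim: s => [|i s IH].
  rewrite (_ : (fun z => _) = cst 0); first exact: differentiable_cst.
  by apply/funext => z; rewrite big_nil.
rewrite (_ : (fun z => _) = f i + (fun z => \sum_(i <- s) f i z)); first exact: differentiableD.
by apply/funext => z; rewrite big_cons.
Qed.

Lemma differentiable_bigprod (I : Type) (s : seq I) (f : I -> V -> C) :
  (forall i, differentiable (f i) p) -> differentiable (fun z => \prod_(i <- s) f i z) p.
Proof.
move=> df; elim: s => [|i s IH].
  rewrite (_ : (fun z => _) = cst 1); first exact: differentiable_cst.
  by apply/funext => z; rewrite big_nil.
rewrite (_ : (fun z => _) = f i * (fun z => \prod_(i <- s) f i z)); first exact: differentiableM.
by apply/funext => z; rewrite big_cons.
Qed.

Lemma differentiable_det m (F : V -> 'M[C]_m) :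
  (forall i j, differentiable (fun z => F z i j : C) p) ->
  differentiable (fun z => \det (F z) : C) p.
Proof.
move=> dF.
apply: (@differentiable_bigsum _ _ (fun (s : {perm 'I_m}) z => (-1) ^+ s * \prod_i F z i (s i))) => s.
apply: (@differentiableM _ _ (cst ((-1) ^+ s)) (fun z => \prod_i F z i (s i))).
  exact: differentiable_cst.
exact: differentiable_bigprod.
Qed.

Lemma differentiable_adj m (F : V -> 'M[C]_m) i j :
  (forall i j, differentiable (fun z => F z i j : C) p) ->
  differentiable (fun z => (\adj (F z)) i j : C) p.
Proof.
move=> dF.
rewrite (_ : (fun z => _) = (fun z => (-1) ^+ (j + i) * \det (row' j (col' i (F z))))); last first.
  by apply/funext => z; rewrite mxE.
apply: (@differentiableM _ _ (cst ((-1) ^+ (j + i))) (fun z => \det (row' j (col' i (F z))))).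
  exact: differentiable_cst.
apply: differentiable_det => k l.
rewrite (_ : (fun z => _) = (fun z => F z (lift j k) (lift i l))); first exact: dF.
by apply/funext => z; rewrite !mxE.
Qed.

Lemma differentiable_mulmx m1 m2 m3 (F : V -> 'M[C]_(m1, m2)) (G : V -> 'M[C]_(m2, m3)) i j :
  (forall i j, differentiable (fun z => F z i j : C) p) ->
  (forall i j, differentiable (fun z => G z i j : C) p) ->
  differentiable (fun z => (F z *m G z) i j : C) p.
Proof.
move=> dF dG.
rewrite (_ : (fun z => _) = (fun z => \sum_k F z i k * G z k j)); last first.
  by apply/funext => z; rewrite mxE.
apply: (@differentiable_bigsum _ _ (fun k z => F z i k * G z k j)) => k.
exact: (differentiableM (dF i k) (dG k j)).
Qed.

End Closure.
End DiffTools.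

Lemma lin_inj_surj (K : fieldType) (V : vectType K) (f : V -> V) : linear f ->
  (forall x, f x = 0 -> x = 0) -> forall y, exists x, f x = y.
Proof.
move=> linf inj y.
pose f' : {linear V -> V} := HB.pack f (GRing.isLinear.Build _ _ _ _ f linf).
have k0 : lker (linfun f') == 0%VS.
  by apply/lker0P => a b; rewrite !lfunE /= => h; apply/eqP; rewrite -subr_eq0;
     apply/eqP/inj; rewrite -[f _]/(f' _) linearB /= h subrr.
exists ((linfun f')^-1%VF y).
by rewrite -[LHS]/(f' _) -[f' _](lfunE f') lker0_lfunVK.
Qed.

(** * The solution space *)

Section SolSpace.
Context {R : realType} {n : nat}.
Local Notation C := (Cplx R).
Local Notation M := 'M[C]_n.
Variable tau : C.
Hypothesis tau_gt0 : 0 < complex.Im tau.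
Variable B : M.
Hypothesis B_unit : B \in unitmx.

Lemma holP (Phi : C -> M) : holomorphic setT Phi <-> mx_entire Phi.
Proof.
split=> [[_ H] i j z|H]; first exact: (diff_entry _ _ (H z I)).
split=> [|z _]; first exact: openT.
by apply: diff_mxE => i j; exact: H.
Qed.

Lemma e_factorE v z : e_factor tau v z = - ee (- (v + tau)) * ee (- z).
Proof.
rewrite /e_factor [RHS]mulNr -eeD -opprD /ee mulrN -mulNr.
by congr (- cexp (_ * _)); ring.
Qed.

Lemma SolP v Phi : Sol tau B v Phi <-> qper tau B 1 (- ee (- (v + tau))) Phi.
Proof.
split=> [[/holP hP per qp]|[hP per qp]].
  by split=> // z; rewrite qp e_factorE mul1r.
split=> //; first exact/holP.
by move=> z; rewrite qp e_factorE mul1r.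
Qed.

Lemma qper_sub d ka Phi Psi : qper tau B d ka Phi -> qper tau B d ka Psi ->
  qper tau B d ka (fun z => Phi z - Psi z).
Proof.
move=> [h1 p1 q1] [h2 p2 q2]; split.
- move=> i j x; have := differentiableB (h1 i j x) (h2 i j x).
  by congr (differentiable _ _); apply/funext => z; rewrite !mxE.
- by move=> z; rewrite p1 p2.
- by move=> z; rewrite mulmxBl q1 q2 mulmxBr scalerBr.
Qed.

Lemma qper_lin d ka Phi Psi (c : C) : qper tau B d ka Phi -> qper tau B d ka Psi ->
  qper tau B d ka (fun z => c *: Phi z + Psi z).
Proof.
move=> [h1 p1 q1] [h2 p2 q2]; split.
- move=> i j x; have := differentiableD (differentiableZ c (h1 i j x)) (h2 i j x).
  by congr (differentiable _ _); apply/funext => z; rewrite !mxE.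
- by move=> z; rewrite p1 p2.
- by move=> z; rewrite mulmxDl -scalemxAl q1 q2 mulmxDr -scalemxAr scalerDr !scalerA mulrC.
Qed.

Lemma Fop_qper v a : qper tau B 1 (- ee (- (v + tau))) (fun z => Fop tau B (z + v) a).
Proof.
split.
- move=> i j; rewrite (_ : (fun z => _) = (fun z => laurent (fun m => thc tau m * adpow B (invmx B) m a i j) (v + z))).
    by apply: entire_shift; apply: entire_laurent; exact: rapid_coef.
  by apply/funext => z; rewrite [z + v]addrC; exact: Fop_entry.
- by move=> z; rewrite addrAC; exact: Fop_per.
- move=> z; rewrite addrAC; have := Fop_tau tau_gt0 B_unit (z + v) a.
  by rewrite (_ : - ee (- (z + v + tau)) = - ee (- (v + tau)) * ee (- (1%:R * z)))//
     mulNr -eeD; congr (- ee _); ring.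
Qed.

Variable v : C.
Hypothesis vS : ~ Sigma tau B v.

Lemma mcoef_sub k (Phi Psi : C -> M) : mx_entire Phi -> mx_entire Psi ->
  mcoef k (fun z => Phi z - Psi z) = mcoef k Phi - mcoef k Psi.
Proof.
move=> h1 h2; apply/matrixP => i j; rewrite !mxE.
rewrite -(cintB (@cont_entry _ _ _ i j (- k) h1) (@cont_entry _ _ _ i j (- k) h2)).
by apply: eq_cint => t; rewrite !mxE mulrBl.
Qed.

Lemma ka_neq0 : - ee (- (v + tau)) != 0.
Proof. by rewrite oppr_eq0 ee_neq0. Qed.

Lemma mcoef_linear (V : lmodType C) d ka (F : V -> C -> M) : (forall a, qper tau B d ka (F a)) ->
  (forall z, linear (F^~ z)) -> forall k, linear (fun a => mcoef k (F a)).
Proof.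
move=> qF linF k c X Y; apply/matrixP => i j.
have hX := let: And3 h _ _ := qF X in h; have hY := let: And3 h _ _ := qF Y in h.
rewrite mcoefE mx_linE !mcoefE -(cintZ c (@cont_entry _ _ _ i j (- k) hX)).
rewrite -(cintD (@contZ _ _ c (@cont_entry _ _ _ i j (- k) hX)) (@cont_entry _ _ _ i j (- k) hY)).
by apply: eq_cint => t; rewrite linF mx_linE mulrDl mulrA.
Qed.

(** A solution is determined by its Fourier coefficient of index 0, so taking this
coefficient is injective on the solutions z |-> F(z + v) a; as a ranges over Mat_n
the dimensions agree, and every value of the coefficient is attained by one of
them. *)
Lemma Sol_Fop Phi : Sol tau B v Phi -> exists a, Phi = (fun z => Fop tau B (z + v) a).
Proof.
move=> /SolP qP.
have linF z : linear (fun a => Fop tau B (z + v) a) by exact: Fop_lin.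
have linc := mcoef_linear (Fop_qper v) linF 0.
have [] := @lin_inj_surj _ _ (fun a => mcoef 0 (fun z => Fop tau B (z + v) a)) linc _ (mcoef 0 Phi).
  move=> a a0; apply: (Fop_inj tau_gt0 B_unit vS).
  have h := qper_uniq B_unit (ltn0Sn 0) ka_neq0 (Fop_qper v a).
  have := h _ 0; rewrite add0r; apply => k; rewrite ltnS leqn0 => /eqP ->; exact: a0.
move=> a aE; exists a; apply/funext => z; apply/eqP; rewrite -subr_eq0; apply/eqP.
have qs := qper_sub qP (Fop_qper v a).
apply: (qper_uniq B_unit (ltn0Sn 0) ka_neq0 qs) => k; rewrite ltnS leqn0 => /eqP ->.
have hP := let: And3 h _ _ := qP in h; have hF := let: And3 h _ _ := Fop_qper v a in h.
by rewrite (mcoef_sub 0 hP hF) aE subrr.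
Qed.

Lemma Fop_surj Z : exists a, Fop tau B v a = Z.
Proof.
apply: lin_inj_surj; first exact: Fop_lin.
by move=> X; exact: Fop_inj.
Qed.

Lemma res0_bij : set_bij (Sol tau B v) setT res0.
Proof.
split.
- by [].
- move=> Phi Psi; rewrite !inE => /Sol_Fop[a ->] /Sol_Fop[b ->]; rewrite /res0 !add0r => h.
  suff -> : a = b by [].
  apply/eqP; rewrite -subr_eq0; apply/eqP; apply: (Fop_inj tau_gt0 B_unit vS).
  have := Fop_lin tau_gt0 B v (-1) b a; rewrite !scaleN1r h addNr => <-.
  by congr Fop; rewrite addrC.
- move=> Z _; have [a <-] := Fop_surj Z.
  exists (fun z => Fop tau B (z + v) a); last by rewrite /res0 add0r.
  exact/SolP/Fop_qper.
Qed.

Definition sol (Z : M) : C -> M := res0_inv tau B v Z.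

Lemma Sol_solP Z : Sol tau B v (sol Z) /\ sol Z 0 = Z.
Proof. exact: (res0_invP res0_bij Z (sol Z)).2 erefl. Qed.

Lemma sol_uniq Phi : Sol tau B v Phi -> Phi = sol (Phi 0).
Proof. by move=> SP; apply: (res0_invP res0_bij (Phi 0) Phi).1. Qed.

Lemma sol_lin z : linear (sol^~ z).
Proof.
move=> c X Y /=.
have [S1 E1] := Sol_solP X; have [S2 E2] := Sol_solP Y.
have S3 : Sol tau B v (fun z => c *: sol X z + sol Y z).
  by apply/SolP; apply: qper_lin; exact/SolP.
by rewrite -{1}E1 -{1}E2 -(sol_uniq S3).
Qed.

Lemma sol_Fop a z : sol (Fop tau B v a) z = Fop tau B (z + v) a.
Proof.
have S : Sol tau B v (fun z => Fop tau B (z + v) a) by exact/SolP/Fop_qper.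
by have := sol_uniq S; rewrite add0r => <-.
Qed.

Lemma r_tildeE y Z : r_tilde tau B v y Z = (thf tau y)^-1 *: sol Z y.
Proof. by rewrite /r_tilde /= /ev thf_theta_bar. Qed.

Lemma r_tilde_lin y : linear (r_tilde tau B v y).
Proof.
move=> c X Y; rewrite !r_tildeE sol_lin scalerDr !scalerA.
by rewrite [_^-1 * c]mulrC -scalerA.
Qed.

End SolSpace.

(** * Duality and addition formula for the solutions *)

Section TraceForm.
Context {K : comNzRingType} {n : nat}.
Local Notation M := 'M[K]_n.

Lemma tr_delta (X : M) (i j : 'I_n) : \tr (X *m delta_mx j i) = X i j.
Proof.
rewrite /mxtrace (bigD1 i) //= mxE (bigD1 j) //= mxE !eqxx mulr1 big1 ?addr0.
  rewrite big1 ?addr0// => k ki; rewrite mxE big1// => l _.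
  by rewrite mxE (negbTE ki) andbF mulr0.
by move=> l lj; rewrite mxE (negbTE lj) mulr0.
Qed.

Lemma tr_ext (X Y : M) : (forall W, \tr (X *m W) = \tr (Y *m W)) -> X = Y.
Proof. by move=> H; apply/matrixP => i j; rewrite -!tr_delta H. Qed.

End TraceForm.

Section Dual.
Context {R : realType} {n : nat}.
Local Notation C := (Cplx R).
Local Notation M := 'M[C]_n.

Lemma tr_lin (Z : M) : linear (fun X : M => \tr (Z *m X) : C^o).
Proof. by move=> c X Y; rewrite mulmxDr -scalemxAr mxtraceD mxtraceZ. Qed.

Variable tau : C.
Hypothesis tau_gt0 : 0 < complex.Im tau.
Variable B : M.
Hypothesis B_unit : B \in unitmx.
Local Notation Bi := (invmx B).
Local Notation f := (thf tau).
Opaque sol ee thf.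
Local Notation sol v := (sol tau B v).

Lemma sol_hol v Z : ~ Sigma tau B v -> mx_entire (sol v Z).
Proof. by move=> vS; have [/SolP[h _ _] _] := Sol_solP tau_gt0 B_unit vS Z. Qed.

Lemma sol0 v Z : ~ Sigma tau B v -> sol v Z 0 = Z.
Proof. by move=> vS; have [_ h] := Sol_solP tau_gt0 B_unit vS Z. Qed.

Lemma sol_per v Z z : ~ Sigma tau B v -> sol v Z (z + 1) = sol v Z z.
Proof. by move=> vS; have [[_ h _] _] := Sol_solP tau_gt0 B_unit vS Z. Qed.

Lemma sol_tau v Z z : ~ Sigma tau B v ->
  sol v Z (z + tau) = (- ee (- (v + tau)) * ee (- z)) *: (B *m sol v Z z *m Bi).
Proof.
move=> vS; have [[_ _ h] _] := Sol_solP tau_gt0 B_unit vS Z.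
by rewrite scalemxAl -e_factorE -h mulmxK.
Qed.

Lemma qperI d ka Phi : mx_entire Phi -> (forall z, Phi (z + 1) = Phi z) ->
  (forall z, Phi (z + tau) = (ka * ee (- (d%:R * z))) *: (B *m Phi z *m Bi)) ->
  qper tau B d ka Phi.
Proof. by move=> hP p q; split=> // z; rewrite q -scalemxAl mulmxKV. Qed.

(** Conjugation by B commutes with the functional equation, so both sides are
solutions with the same value at 0. *)
Lemma sol_conj v Z z : ~ Sigma tau B v -> sol v (B *m Z *m Bi) z = B *m sol v Z z *m Bi.
Proof.
move=> vS.
have S : Sol tau B v (fun z => B *m sol v Z z *m Bi).
  apply/SolP/qperI.
  - exact: (hol_lin (mul_lin B Bi) (sol_hol Z vS)).
  - by move=> x; rewrite sol_per.
  - by move=> x; rewrite sol_tau// mul1r -scalemxAr -scalemxAl.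
have := sol_uniq tau_gt0 B_unit vS S; rewrite /= sol0// => h.
by rewrite -h.
Qed.

Lemma riesz (l : M -> C) : (forall c X Y, l (c *: X + Y) = c * l X + l Y) ->
  forall X, \tr ((\matrix_(i, j) l (delta_mx j i)) *m X) = l X.
Proof.
move=> linl X.
pose L : {linear M -> C^o} := HB.pack (l : M -> C^o)
  (GRing.isLinear.Build _ _ _ _ (l : M -> C^o) linl).
have E : l X = \sum_i \sum_j X i j * l (delta_mx i j).
  rewrite {1}(matrix_sum_delta X) -[LHS]/(L _) linear_sum; apply: eq_bigr => i _.
  rewrite linear_sum; apply: eq_bigr => j _; by rewrite linearZ.
rewrite E exchange_big /mxtrace; apply: eq_bigr => i _; rewrite mxE.
by apply: eq_bigr => j _; rewrite mxE mulrC.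
Qed.

Lemma hol_opp Phi : mx_entire Phi -> mx_entire (fun z : C => Phi (- z) : M).
Proof.
move=> hP i j; apply: (entire_comp (hP i j)) => z.
exact: differentiableN.
Qed.

Lemma hol_shift (x : C) Phi : mx_entire Phi -> mx_entire (fun z : C => Phi (x + z) : M).
Proof. by move=> hP i j; exact: (entire_shift x (hP i j)). Qed.

Lemma hol_scale g Phi : entire g -> mx_entire Phi -> mx_entire (fun z : C => g z *: Phi z : M).
Proof.
move=> eg hP i j; have := entireM eg (hP i j).
by congr entire; apply/funext => z; rewrite mxE.
Qed.

Lemma hol_add Phi Psi : mx_entire Phi -> mx_entire Psi -> mx_entire (fun z : C => Phi z + Psi z : M).
Proof.
move=> h1 h2 i j; have := entireD (h1 i j) (h2 i j).
by congr entire; apply/funext => z; rewrite mxE.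
Qed.

Lemma hol_mul Phi Psi : mx_entire Phi -> mx_entire Psi -> mx_entire (fun z : C => Phi z *m Psi z : M).
Proof.
move=> h1 h2 i j.
have := entire_sum (fun k => entireM (h1 i k) (h2 k j)).
by congr entire; apply/funext => z; rewrite mxE.
Qed.

(** For fixed Z, the right-hand side is a linear form in W, hence the trace against a
matrix depending on y. Testing its functional equation against every W, one finds
a solution for - u; its value at 0 is Z. *)
Lemma sol_dual u Z W y : ~ Sigma tau B u -> ~ Sigma tau B (- u) ->
  \tr (sol (- u) Z y *m W) = ee (- y) * \tr (Z *m sol u W (- y)).
Proof.
move=> uS uS'.
(* The right-hand side as a linear form; Md y is the matrix that represents it.
   *)
pose l (y : C) (X : M) : C := ee (- y) * \tr (Z *m sol u X (- y)).
have linl x c X Y : l x (c *: X + Y) = c * l x X + l x Y.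
  rewrite /l (sol_lin tau_gt0 B_unit uS) tr_lin.
  by rewrite mulrDr; congr (_ + _); rewrite mulrCA.
pose Md (y : C) : M := \matrix_(i, j) l y (delta_mx j i).
have MdW x X : \tr (Md x *m X) = l x X by exact: (riesz (linl x)).
have S : Sol tau B (- u) Md.
  apply/SolP; split.
  - move=> i j; pose L (X : M) : M := const_mx (\tr (Z *m X)).
    have linL : linear L.
      by move=> c X Y; apply/matrixP => p q; rewrite mx_linE !mxE tr_lin.
    have hL := hol_opp (hol_lin linL (sol_hol (delta_mx j i) uS)).
    have e1 : entire (fun z : C => ee (- z)).
      have -> : (fun z : C => ee (- z)) = (fun z => ee (-1 * z)) by apply/funext => z; rewrite mulN1r.
      exact: entire_ee.
    have := entireM e1 (hL i j).
    by congr entire; apply/funext => z; rewrite !mxE.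
  - move=> z.
    apply: (@tr_ext _ _ (Md (z + 1)) (Md z)) => X.
    apply: etrans (MdW (z + 1) X) (etrans _ (esym (MdW z X))).
    rewrite /l (opprD z 1).
    have h := sol_per X (- z - 1) uS; rewrite (subrK 1 (- z)) in h.
    by rewrite h eeD (eeN 1) ee1 invr1 mulr1.
  - move=> z; apply: tr_ext => X.
    rewrite -mulmxA MdW -scalemxAl mxtraceZ -mulmxA mxtrace_mulC -mulmxA MdW /l.
    have -> : B *m X = B *m (X *m B) *m Bi by rewrite !mulmxA mulmxK.
    rewrite sol_conj//; set Y := X *m B.
    have := sol_tau Y (- (z + tau)) uS; rewrite (_ : - (z + tau) + tau = - z); last by ring.
    move=> ->; rewrite -scalemxAr mxtraceZ !mulrA; congr (_ * _).
    rewrite mul1r !mulNr !mulrN -!eeD; rewrite mulNr opprK -eeD; congr ee; ring.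
have Md0 : Md 0 = Z.
  by apply: tr_ext => X; rewrite (MdW 0) /l oppr0 ee0 mul1r sol0.
have h := sol_uniq tau_gt0 B_unit uS' S; rewrite Md0 in h.
by rewrite -h (MdW y).
Qed.

Lemma conj_comb (c1 c2 : C) (X1 X2 : M) :
  B *m (c1 *: X1 + c2 *: X2) *m Bi = c1 *: (B *m X1 *m Bi) + c2 *: (B *m X2 *m Bi).
Proof. by rewrite mulmxDr mulmxDl -!scalemxAr -!scalemxAl. Qed.

Lemma comb_lin (c a b : C) (X1 X2 Y1 Y2 : M) :
  a *: (c *: X1 + X2) + b *: (c *: Y1 + Y2) = c *: (a *: X1 + b *: Y1) + (a *: X2 + b *: Y2).
Proof. by rewrite !scalerDr !scalerA addrACA [a * c]mulrC [b * c]mulrC. Qed.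

(** In the variable t all terms are quasi-periodic of degree 2. The combinations of
the shape of the right-hand side, with arbitrary matrices in the two slots, are
determined by these matrices, since theta(t) vanishes at 0 and theta(t + x) at - x.
They form a space of the dimension allowed by two Fourier coefficients, hence
exhaust all functions of degree 2. Evaluating the left-hand side at t = 0 and
t = - x identifies the two matrices. *)
Lemma sol_fay u v x Z1 Z2 t : ~ Lambda tau x ->
  ~ Sigma tau B u -> ~ Sigma tau B v -> ~ Sigma tau B (u + v) ->
  f x *: (sol v Z2 t *m sol u Z1 (x + t)) =
    f (t + x) *: sol (u + v) (Z2 *m sol u Z1 x) t +
    f t *: sol (u + v) ((f x / f (- x)) *: (sol v Z2 (- x) *m Z1)) (x + t).
Proof.
move=> xL uS vS wS; set w := u + v in wS *.
have fx : f x != 0 by apply/eqP => /(thf_eq0 tau_gt0).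
have fNx : f (- x) != 0 by rewrite (thf_opp tau_gt0); apply: mulf_neq0; rewrite // oppr_eq0 ee_neq0.
(* The product of the constants in the functional equations of any of the pairs
   of factors. *)
pose ka := ee (- (x + u + v + 2%:R * tau)).
have ka0 : ka != 0 by exact: ee_neq0.
pose s (p : M * M) t := f (t + x) *: sol w p.1 t + f t *: sol w p.2 (x + t).
have hf := entire_thf tau_gt0.
have hfx : entire (fun t => f (t + x)).
  have -> : (fun t => f (t + x)) = (fun t => f (x + t)) by apply/funext => z; rewrite addrC.
  exact: (entire_shift x hf).
have qs p : qper tau B 2 ka (s p).
  apply: qperI.
  - apply: hol_add; apply: hol_scale => //; first exact: sol_hol.
    by apply: hol_shift; exact: sol_hol.
  - move=> z; rewrite /s addrAC !thf_per (sol_per _ _ wS) addrA (sol_per _ _ wS).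
    reflexivity.
  - move=> z; rewrite /s addrAC addrA (thf_tau tau_gt0 (z + x)) (thf_tau tau_gt0 z).
    rewrite (sol_tau p.1 z wS) (sol_tau p.2 (x + z) wS).
    rewrite conj_comb scalerDr; congr (_ + _); rewrite [LHS]scalerA [RHS]scalerA; congr (_ *: _).
      rewrite !mulNr !mulrN opprK mulrAC [RHS]mulrC mulrC; congr (_ * _).
      by rewrite /ka -!eeD; congr ee; rewrite /w; ring.
    rewrite !mulNr !mulrN opprK mulrAC [RHS]mulrC mulrC; congr (_ * _).
    by rewrite /ka -!eeD; congr ee; rewrite /w; ring.
have qP : qper tau B 2 ka (fun t => f x *: (sol v Z2 t *m sol u Z1 (x + t))).
  apply: qperI.
  - apply: hol_scale; first exact: entire_cst.
    apply: hol_mul; first exact: sol_hol.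
    by apply: hol_shift; exact: sol_hol.
  - move=> z; rewrite (sol_per _ _ vS) addrA (sol_per _ _ uS).
    reflexivity.
  - move=> z; rewrite addrA (sol_tau _ _ uS) (sol_tau _ _ vS) -!scalemxAl -!scalemxAr -!scalemxAl !scalerA.
    rewrite !mulmxA (mulmxKV B_unit); congr (_ *: _).
    rewrite [RHS]mulrC -!mulrA; congr (_ * _).
    by rewrite !mulNr !mulrN opprK /ka -!eeD; congr ee; ring.
have lins z : linear (s^~ z).
  move=> c p q; rewrite /s /= !(sol_lin tau_gt0 B_unit wS); exact: comb_lin.
have s0 p : s p 0 = f x *: p.1.
  by rewrite /s add0r (thf0 tau_gt0) scale0r addr0 (sol0 _ wS).
have sx p : s p (- x) = f (- x) *: p.2.
  by rewrite /s addNr (thf0 tau_gt0) scale0r add0r subrr (sol0 _ wS).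
have lt2 k : (k < 2)%N -> k = 0%N \/ k = 1%N by case: k => [|[|k]]; auto.
have lin01 : linear (fun p => (mcoef 0 (s p), mcoef 1 (s p))).
  move=> c p q.
  exact: (congr2 pair (mcoef_linear qs lins 0 c p q) (mcoef_linear qs lins 1 c p q)).
(* Two coefficients determine a function of degree 2, and the family s p is
   injective in p, so some s p has the coefficients of the left-hand side. *)
have [|p pE] := lin_inj_surj lin01 _
    (mcoef 0 (fun t => f x *: (sol v Z2 t *m sol u Z1 (x + t))),
     mcoef 1 (fun t => f x *: (sol v Z2 t *m sol u Z1 (x + t)))).
  move=> p [p0 p1].
  have z0 := qper_uniq B_unit (isT : (0 < 2)%N) ka0 (qs p).
  have {}z0 : forall z, s p z = 0.
    by apply: z0 => k /lt2[]->.
  have := z0 0; rewrite s0 => /eqP; rewrite scaler_eq0 (negbTE fx) => /eqP e1.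
  have := z0 (- x); rewrite sx => /eqP; rewrite scaler_eq0 (negbTE fNx) => /eqP e2.
  by rewrite [p]surjective_pairing e1 e2.
case: pE => p0 p1.
have E t' : f x *: (sol v Z2 t' *m sol u Z1 (x + t')) = s p t'.
  apply/eqP; rewrite -subr_eq0; apply/eqP.
  apply: (qper_uniq B_unit (isT : (0 < 2)%N) ka0 (qper_sub qP (qs p))) => k /lt2 kE.
  have h1 := let: And3 h _ _ := qP in h; have h2 := let: And3 h _ _ := qs p in h.
  rewrite (mcoef_sub _ h1 h2); case: kE => ->; first by rewrite p0 subrr.
  by rewrite p1 subrr.
have := E 0; rewrite s0 addr0 (sol0 _ vS) => /(scalerI fx) ->.
have := E (- x); rewrite sx subrr (sol0 _ uS) => /(congr1 (fun X => (f (- x))^-1 *: X)).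
rewrite !scalerA (mulVf fNx) scale1r mulrC => ->.
exact: E.
Qed.

End Dual.

(** * Tensors as linear maps *)

Section TensorCalc.
Context {K : comNzRingType} {n : nat}.
Local Notation M := 'M[K]_n.
Local Notation dm p := (delta_mx p.1 p.2 : M).
Local Notation dmT p := (delta_mx p.2 p.1 : M).

Lemma lin_delta (V : lmodType K) (g : M -> V) X : linear g ->
  g X = \sum_(p : 'I_n * 'I_n) X p.1 p.2 *: g (dm p).
Proof.
move=> ling.
pose G : {linear M -> V} := HB.pack g (GRing.isLinear.Build _ _ _ _ g ling).
rewrite [in LHS](matrix_sum_delta X) pair_big /= -[LHS]/(G _) linear_sum.
by apply: eq_bigr => p _; rewrite linearZ.
Qed.

(** Invariance of the Casimir element sum of E_ji (x) E_ij: a linear map applied to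
the first factor can be moved to the second as its transpose for the trace
pairing. *)
Lemma casimir (V : lmodType K) (b : M -> M -> V) (phi phiT : M -> M) :
  (forall Y, linear (b^~ Y)) -> (forall X, linear (b X)) ->
  (forall X Y, \tr (phiT X *m Y) = \tr (X *m phi Y)) ->
  \sum_p b (phi (dmT p)) (dm p) = \sum_p b (dmT p) (phiT (dm p)).
Proof.
move=> bl br adj.
transitivity (\sum_p \sum_q phi (dmT p) q.1 q.2 *: b (dm q) (dm p)).
  by apply: eq_bigr => p _; exact: (@lin_delta _ (b^~ (dm p))).
transitivity (\sum_q \sum_p phiT (dm q) p.1 p.2 *: b (dmT q) (dm p)); last first.
  by apply: eq_bigr => q _; exact/esym/(@lin_delta _ (b (dmT q))).
rewrite exchange_big /= (reindex (fun p => (p.2, p.1))) /=; last first.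
  by exists (fun p => (p.2, p.1)) => -[].
apply: eq_bigr => -[i j] _; apply: eq_bigr => -[k l] _ /=; congr (_ *: _).
by rewrite -!tr_delta mxtrace_mulC -adj.
Qed.

Lemma tens_lift_hom (V : lmodType K) (b : M -> M -> V) (f : M -> M) :
  (forall X, linear (b X)) ->
  tens_lift b (hom_tens f) = \sum_p b (dmT p) (f (dm p)).
Proof.
move=> br; rewrite /tens_lift exchange_big pair_big /=; apply: eq_bigr => -[i j] _ /=.
rewrite [RHS]lin_delta// pair_big; apply: eq_bigr => -[k l] _ /=.
by rewrite hom_tensE.
Qed.

Lemma hom_tens_sum (f : M -> M) : hom_tens f = \sum_p (dmT p *t f (dm p)).
Proof. by rewrite /hom_tens pair_big. Qed.

Lemma tens_linl m p q r (Y : 'M[K]_(m, p)) : linear (fun X : 'M[K]_(q, r) => X *t Y).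
Proof. by move=> c X Z; apply/matrixP => i j; rewrite !mxE mulrDl mulrA. Qed.

Lemma tens_linr m p q r (X : 'M[K]_(m, p)) : linear (fun Y : 'M[K]_(q, r) => X *t Y).
Proof. by move=> c Y Z; apply/matrixP => i j; rewrite !mxE mulrDr mulrCA. Qed.

Lemma tensD m p q r (X : 'M[K]_(m, p)) (Y Z : 'M[K]_(q, r)) :
  X *t (Y + Z) = X *t Y + X *t Z.
Proof. by apply/matrixP => i j; rewrite !mxE mulrDr. Qed.

Lemma tensN m p q r (X : 'M[K]_(m, p)) (Y : 'M[K]_(q, r)) : X *t (- Y) = - (X *t Y).
Proof. by apply/matrixP => i j; rewrite !mxE mulrN. Qed.

Lemma lin_comp (U V W : lmodType K) (g : V -> W) (h : U -> V) :
  linear g -> linear h -> linear (fun x => g (h x)).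
Proof. by move=> lg lh c x y; rewrite lh lg. Qed.

Lemma mulmx_linl m p q (Y : 'M[K]_(p, q)) : linear (fun X : 'M[K]_(m, p) => X *m Y).
Proof. by move=> c X Z; rewrite mulmxDl -scalemxAl. Qed.

Lemma mulmx_linr m p q (X : 'M[K]_(m, p)) : linear (fun Y : 'M[K]_(p, q) => X *m Y).
Proof. by move=> c Y Z; rewrite mulmxDr -scalemxAr. Qed.

(** Exchanging the factors of a tensor transposes the corresponding linear map. *)
Lemma hom_tens_swap (f fT : M -> M) : linear f ->
  (forall X Y, \tr (fT X *m Y) = \tr (X *m f Y)) ->
  tens_swap (hom_tens f) = hom_tens fT.
Proof.
move=> lf adj; rewrite /tens_swap tens_lift_hom => [|X]; last exact: tens_linl.
rewrite [RHS]hom_tens_sum.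
rewrite -(@casimir _ (fun X Y : M => X *t Y) f fT)//; first last.
- exact: tens_linr.
- exact: tens_linl.
rewrite (reindex (fun p => (p.2, p.1))) //=.
by exists (fun p => (p.2, p.1)) => -[].
Qed.

(** The map X |-> P1 X Q1 has transpose X |-> Q1 X P1. *)
Lemma hom_tens_conj (P1 P2 Q1 Q2 : M) (f : M -> M) : linear f ->
  (P1 *t P2) *m hom_tens f *m (Q1 *t Q2) =
    hom_tens (fun Z => P2 *m f (Q1 *m Z *m P1) *m Q2).
Proof.
move=> lf; rewrite !hom_tens_sum mulmx_sumr mulmx_suml.
transitivity (\sum_p ((P1 *m dmT p *m Q1) *t (P2 *m f (dm p) *m Q2))).
  by apply: eq_bigr => p _; rewrite !tensmx_mul.
apply: (@casimir _ (fun X Y : M => X *t (P2 *m f Y *m Q2)) (fun X => P1 *m X *m Q1)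
   (fun X => Q1 *m X *m P1)).
- by move=> Y; exact: tens_linl.
- move=> X; apply: (lin_comp (tens_linr X)).
  by apply: (lin_comp (mulmx_linl Q2)); exact: (lin_comp (mulmx_linr P2)).
- by move=> X Y; rewrite -!mulmxA mxtrace_mulC !mulmxA.
Qed.

(** Each product of two tensors is brought to the form
sum of E_ji (x) E_lk (x) T(E_ij, E_kl) with T bilinear, by moving the matrix that
multiplies an elementary matrix across the Casimir element. The equation of tensors
follows from the one between the three maps T. *)
Lemma aybe_tens (f f' g g' p q qT : M -> M) :
  linear f -> linear f' -> linear g -> linear g' -> linear p -> linear q ->
  (forall X Y, \tr (qT X *m Y) = \tr (X *m q Y)) ->
  (forall X Y, g' (Y *m f X) = p (qT Y *m X) + g Y *m f' X) ->
  tens12 (hom_tens f) *m tens23 (hom_tens g') =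
    tens13 (hom_tens p) *m tens12 (hom_tens q) + tens23 (hom_tens g) *m tens13 (hom_tens f').
Proof.
move=> lf lf' lg lg' lp lq adj E.
have e12 h : tens12 (hom_tens h) = \sum_i (dmT i *t h (dm i) *t 1%:M).
  apply: tens_lift_hom => X.
  exact: (lin_comp (tens_linl _) (tens_linr X)).
have e23 h : tens23 (hom_tens h) = \sum_i (1%:M *t dmT i *t h (dm i)).
  by apply: tens_lift_hom => X; exact: tens_linr.
have e13 h : tens13 (hom_tens h) = \sum_i (dmT i *t 1%:M *t h (dm i)).
  by apply: tens_lift_hom => X; exact: tens_linr.
rewrite !e12 !e23 !e13 !mulmx_suml.
transitivity (\sum_i \sum_j (dmT i *t dmT j *t g' (dm j *m f (dm i)))).
  apply: eq_bigr => i _; rewrite mulmx_sumr.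
  transitivity (\sum_j (dmT i *t (f (dm i) *m dmT j) *t g' (dm j))).
    by apply: eq_bigr => j _; rewrite !tensmx_mul mulmx1 mul1mx.
  apply: (@casimir _ (fun X Y : M => dmT i *t X *t g' Y) (mulmx (f (dm i)))
    (mulmx^~ (f (dm i)))).
  - move=> Y; exact: (lin_comp (tens_linl _) (tens_linr _)).
  - move=> X; exact: (lin_comp (tens_linr _) lg').
  - by move=> X Y; rewrite mulmxA.
transitivity (\sum_i \sum_j (dmT i *t dmT j *t p (qT (dm j) *m dm i)) +
              \sum_i \sum_j (dmT i *t dmT j *t (g (dm j) *m f' (dm i)))).
  rewrite -big_split; apply: eq_bigr => i _; rewrite -big_split; apply: eq_bigr => j _ /=.
  by rewrite E tensD.
congr (_ + _); last first.
  rewrite exchange_big; apply: eq_bigr => j _; rewrite mulmx_sumr; apply: eq_bigr => i _.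
  by rewrite !tensmx_mul !mul1mx !mulmx1.
apply/esym.
transitivity (\sum_k \sum_i ((dmT k *m dmT i) *t q (dm i) *t p (dm k))).
  apply: eq_bigr => k _; rewrite mulmx_sumr; apply: eq_bigr => i _.
  by rewrite !tensmx_mul mul1mx mulmx1.
transitivity (\sum_i \sum_k (dmT k *t q (dm i) *t p (dmT i *m dm k))).
  rewrite exchange_big; apply: eq_bigr => i _.
  apply: (@casimir _ (fun X Y : M => X *t q (dm i) *t p Y) (mulmx^~ (dmT i))
    (mulmx (dmT i))).
  - move=> Y; exact: (lin_comp (tens_linl _) (tens_linl _)).
  - move=> X; exact: (lin_comp (tens_linr _) lp).
  - by move=> X Y; rewrite -mulmxA mxtrace_mulC mulmxA.
rewrite exchange_big; apply: eq_bigr => k _.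
rewrite (reindex (fun i => (i.2, i.1))) /=; last by exists (fun p => (p.2, p.1)) => -[].
apply: (@casimir _ (fun X Y : M => dmT k *t X *t p (Y *m dm k)) q qT); last exact: adj.
- move=> Y; exact: (lin_comp (tens_linl _) (tens_linr _)).
- move=> X; apply: (lin_comp (tens_linr _)); apply: (lin_comp lp); exact: mulmx_linl.
Qed.

End TensorCalc.

(** * The algebraic identities of the r-matrix *)

Section Algebraic.
Context {R : realType} {n : nat}.
Local Notation C := (Cplx R).
Local Notation M := 'M[C]_n.
Variable tau : C.
Hypothesis tau_gt0 : 0 < complex.Im tau.
Local Notation f := (thf tau).

Lemma LambdaN z : Lambda tau z -> Lambda tau (- z).
Proof.
move=> [a [b ->]]; exists (- a), (- b); by rewrite !intrN mulrN opprD.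
Qed.

Lemma SigmaN (B : M) v : Sigma tau B v -> Sigma tau B (- v).
Proof.
move=> [l [l' [w [h1 h2 Lw ->]]]]; exists l', l, (- w); split => //.
  exact: LambdaN.
by ring.
Qed.

Lemma thf_neq0 x : ~ Lambda tau x -> f x != 0.
Proof. by move=> xL; apply/eqP => /(thf_eq0 tau_gt0). Qed.

Section OneMatrix.
Variable B : M.
Hypothesis B_unit : B \in unitmx.
Local Notation rt := (r_tilde tau B).
Local Notation Sg := (Sigma tau B).
Local Notation L := (Lambda tau).

(** [sol_dual] at - x; the factor e(x) is the one in theta(- x) = - e(x) theta(x). *)
Lemma r_tilde_dual u x X Y : ~ Sg u -> ~ L x ->
  \tr (- rt (- u) (- x) X *m Y) = \tr (X *m rt u x Y).
Proof.
move=> uS xL; have uS' : ~ Sg (- u) by move=> /SigmaN; rewrite opprK.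
rewrite !r_tildeE -scaleNr -scalemxAl -scalemxAr !mxtraceZ (sol_dual tau_gt0 B_unit X Y (- x) uS uS').
rewrite opprK mulrA; congr (_ * _); rewrite (thf_opp tau_gt0).
by field; rewrite (thf_neq0 xL) ee_neq0.
Qed.

(** [sol_fay] at t = y, divided by theta(x) theta(y) theta(x + y). *)
Lemma r_tilde_fay u v x y Z1 Z2 : ~ Sg u -> ~ Sg v -> ~ Sg (u + v) ->
  ~ L x -> ~ L y -> ~ L (x + y) ->
  rt (u + v) y (Z2 *m rt u x Z1) =
    rt (u + v) (x + y) (- rt v (- x) Z2 *m Z1) + rt v y Z2 *m rt u (x + y) Z1.
Proof.
move=> uS vS wS xL yL xyL.
have fx := thf_neq0 xL; have fy := thf_neq0 yL; have fxy := thf_neq0 xyL.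
have Z k t (X : M) : sol tau B (u + v) (k *: X) t = k *: sol tau B (u + v) X t.
  have h := sol_lin tau_gt0 B_unit wS t k X 0.
  by rewrite !addr0 (lin0 (sol_lin tau_gt0 B_unit wS t)) addr0 in h.
have := sol_fay tau_gt0 B_unit Z1 Z2 y xL uS vS wS.
rewrite !r_tildeE -scaleNr -!scalemxAr -!scalemxAl !Z !scalerA [y + x]addrC.
set P := _ *m _; set Q := sol _ _ _ _ y; set S := sol _ _ _ _ _.
move=> /(congr1 (fun X => ((f x)^-1 * (f y)^-1 * (f (x + y))^-1) *: X)).
rewrite scalerDr !scalerA.
rewrite (_ : _ * f x = (f y)^-1 * (f (x + y))^-1); last by field; rewrite fx fy fxy.
rewrite (_ : _ * f (x + y) = (f y)^-1 * (f x)^-1); last by field; rewrite fx fy fxy.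
rewrite (_ : _ * (f y * _) = (f (x + y))^-1 * (f (- x))^-1); last first.
  by field; rewrite thf_neq0 ?fx ?fy ?fxy// => /LambdaN; rewrite opprK.
rewrite [(f y)^-1 / f (x + y)]mulrC => ->; rewrite mulrN scaleNr addrCA addNr addr0.
by [].
Qed.

Lemma r_tens_unitary : tensor_unitary (dom_r tau B) (r_tens tau B).
Proof.
move=> u x [/= uS xL].
have adj X Y := r_tilde_dual X Y uS xL.
rewrite /r_tens (hom_tens_swap (r_tilde_lin tau_gt0 B_unit uS x) adj).
by rewrite !hom_tens_sum -sumrN; apply: eq_bigr => p _; rewrite tensN opprK.
Qed.

(** The argument - v on the right of the equation is turned into v by the duality
[r_tilde_dual], in which the transpose appears that [aybe_tens] asks for. *)
Lemma r_tens_aybe : AYBE_solution (dom_r tau B) (r_tens tau B).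
Proof.
move=> u v x y [/= uS xL] [/= wS yL] [/= _ xyL] [/= vS' _] [/= vS _] _.
have lin w z := @r_tilde_lin _ _ _ tau_gt0 _ B_unit w z.
apply: (@aybe_tens _ _ _ _ _ _ _ _ (fun Z => - rt v (- x) Z)); try exact: (lin).
- by move=> X Y; have := r_tilde_dual X Y vS' xL; rewrite opprK.
- by move=> Z1 Z2; exact: r_tilde_fay.
Qed.

End OneMatrix.

Lemma Sigma_conj (B S A : M) v : S \in unitmx -> A = invmx S *m B *m S ->
  Sigma tau A v -> Sigma tau B v.
Proof.
move=> S_unit ->.
have eig a : eigenvalue (invmx S *m B *m S) a -> eigenvalue B a.
  move=> /eigenvalueP[w wE w0]; apply/eigenvalueP; exists (w *m invmx S).
    by rewrite scalemxAl -wE !mulmxA mulmxK.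
  by apply: contraNneq w0 => h; rewrite -[w](mulmxKV S_unit) h mul0mx.
by move=> [l [l' [w [/eig h1 /eig h2 Lw ->]]]]; exists l, l', w.
Qed.

(** S^-1 Phi S solves the functional equation of S^-1 B S when Phi solves the one of
B; uniqueness identifies it by its value at 0. *)
Lemma sol_similar (B S A : M) v Z z : B \in unitmx -> S \in unitmx ->
  A = invmx S *m B *m S -> ~ Sigma tau B v ->
  sol tau A v Z z = invmx S *m sol tau B v (S *m Z *m invmx S) z *m S.
Proof.
move=> B_unit S_unit AE vS.
have vSA : ~ Sigma tau A v by move=> /(Sigma_conj S_unit AE).
have A_unit : A \in unitmx by rewrite AE !unitmx_mul unitmx_inv S_unit B_unit.
have [[hB pB qB] e] := Sol_solP tau_gt0 B_unit vS (S *m Z *m invmx S).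
have S1 : Sol tau A v (fun z => invmx S *m sol tau B v (S *m Z *m invmx S) z *m S).
  split.
  - by apply/holP; apply: (hol_lin (mul_lin (invmx S) S)); apply/holP.
  - by move=> x; rewrite (pB x).
  - move=> x; have {}qB := qB x; rewrite AE.
    move: (sol tau B v _ (x + tau)) (sol tau B v _ x) (e_factor tau v x) qB => P Q c qB.
    have -> : invmx S *m P *m S *m (invmx S *m B *m S) = invmx S *m (P *m B) *m S.
      by rewrite !mulmxA mulmxK.
    by rewrite qB -scalemxAr -scalemxAl !mulmxA mulmxK.
have := sol_uniq tau_gt0 A_unit vSA S1; rewrite /= e !mulmxA mulVmx// mul1mx mulmxKV// => h.
by rewrite -h.
Qed.

Lemma r_tens_similar (B : M) : B \in unitmx ->
  forall S A : M, S \in unitmx -> A = invmx S *m B *m S ->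
    forall v y : C, dom_r tau B (v, y) ->
      r_tens tau A v y =
        (invmx S *t invmx S) *m r_tens tau B v y *m (S *t S).
Proof.
move=> B_unit S A S_unit AE v y [/= vS _].
rewrite /r_tens (hom_tens_conj _ _ _ _ (r_tilde_lin tau_gt0 B_unit vS y)); congr hom_tens.
apply/funext => Z; rewrite !r_tildeE (sol_similar Z y B_unit S_unit AE vS).
by rewrite -scalemxAr -scalemxAl.
Qed.

End Algebraic.

(** * Avoiding the poles *)

Section Avoid.
Context {R : realType}.
Local Notation C := (Cplx R).
Local Notation RtoC t := ((t : R)%:C : C).
Variable tau : C.
Hypothesis tau_gt0 : 0 < complex.Im tau.
Local Notation L := (Lambda tau).

Lemma LambdaB z w : L z -> L w -> L (z - w).
Proof.
move=> [a [b ->]] [c [d ->]]; exists (a - c), (b - d); rewrite !intrB; ring.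
Qed.

Lemma Lambda_real (t : R) : L (RtoC t) -> exists k : int, t = k%:~R.
Proof.
move=> [a [b]]; rewrite -[a%:~R](rmorph_int (real_complex R)) -[b%:~R](rmorph_int (real_complex R)).
case: (tau) tau_gt0 => tr ti /= ti0 E.
have := congr1 (@complex.Im R) E; rewrite cImD cImM /= mulr0 !add0r => /esym/eqP.
rewrite mulf_eq0 gt_eqF//= intr_eq0 => /eqP b0; exists a.
by have := congr1 (@complex.Re R) E; rewrite b0 cReD cReM /= !mulr0 subr0 addr0.
Qed.

(** A real interval of length at most 1/2 contains at most one t with p + t - c in the
lattice, because the difference of two such t is a real lattice point, hence an
integer. One of two disjoint thirds of the interval is therefore free of such t, for
each c in turn. *)
Lemma Lambda_avoid (s : seq C) (p : C) (a b : R) : a < b ->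
  exists a' b', [/\ a <= a', a' < b', b' <= b &
    forall t, a' <= t -> t <= b' -> forall c, c \in s -> ~ L (p + RtoC t - c)].
Proof.
move=> ab; elim: s => [|c s [a1 [b1 [aa1 ab1 bb1 H]]]].
  by exists a, b; split.
pose d := Num.min (b1 - a1) (1 / 2).
have d0 : 0 < d by rewrite lt_min subr_gt0 ab1; lra.
have d1 : d <= b1 - a1 by rewrite ge_min lexx.
have d2 : d <= 1 / 2 by rewrite ge_min lexx orbT.
have [[t [t1 t2 Lt]]|nL] := pselect (exists t, [/\ a1 <= t, t <= a1 + d / 3 & L (p + RtoC t - c)]).
  exists (a1 + 2 * d / 3), (a1 + d); split; [lra|lra|lra|].
  move=> t' h1 h2 c'; rewrite in_cons => /orP[/eqP -> Lt'|c's]; last by apply: H => //; lra.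
  have [k kE] : exists k : int, t' - t = k%:~R.
    apply: Lambda_real; have := LambdaB Lt' Lt; congr (L _).
    by rewrite rmorphB /=; ring.
  have k0 : (0 : R) < k%:~R by rewrite -kE; lra.
  have k1 : (k%:~R : R) < 1%:~R by rewrite -kE; lra.
  by move: k0 k1; rewrite ltr0z ltr_int; case: (k) => // -[].
exists a1, (a1 + d / 3); split; [lra|lra|lra|].
move=> t' h1 h2 c'; rewrite in_cons => /orP[/eqP -> Lt'|c's]; last by apply: H => //; lra.
by apply: nL; exists t'.
Qed.

Lemma Lambda_avoid_near (s : seq C) (p : C) (e : R) : 0 < e ->
  exists q, nrm (q - p) < e /\ forall c, c \in s -> ~ L (q - c).
Proof.
move=> e0; have [|a [b [a0 ab be H]]] := @Lambda_avoid s p 0 (e / 2); first lra.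
exists (p + RtoC a); split; last by apply: H; lra.
by rewrite addrAC subrr add0r nrm_real ger0_norm//; lra.
Qed.

Section Sigma.
Context {n : nat}.
Variable B : 'M[C]_n.
Hypothesis B_unit : B \in unitmx.

(** Logarithms of the finitely many eigenvalues are unique up to integers, so Sigma is
a finite union of translates of the lattice. *)
Lemma Sigma_finite : exists s : seq C, forall v, Sigma tau B v <-> exists2 c, c \in s & L (v - c).
Proof.
have [s [sE _ _]] := char_roots B.
have /choice[lg lgE] : forall a : C, exists l, a \in s -> ee l = a.
  move=> a; have [/sE/(eigenvalue_neq0 B_unit)/ee_surj[l lE]|] := boolP (a \in s); first by exists l.
  by exists 0.
exists [seq lg a - lg b | a <- s, b <- s] => v; split.
  move=> [l [l' [w [/sE h /sE h' Lw ->]]]].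
  exists (lg (ee l) - lg (ee l')); first exact: allpairs_f.
  have [k kE] : exists k : int, l - lg (ee l) = k%:~R.
    by apply: ee_eq1; rewrite eeB lgE// divff// ee_neq0.
  have [k' kE'] : exists k : int, l' - lg (ee l') = k%:~R.
    by apply: ee_eq1; rewrite eeB lgE// divff// ee_neq0.
  have -> : l - l' + w - (lg (ee l) - lg (ee l')) = (l - lg (ee l)) - (l' - lg (ee l')) + w by ring.
  rewrite kE kE'; case: Lw => a [b ->]; exists (k - k' + a), b.
  by rewrite intrD intrB addrA.
move=> [c /allpairsP[[a b] [/= ha hb ->]] Lv].
exists (lg a), (lg b), (v - (lg a - lg b)); split => //.
- by apply/sE; rewrite -[cexp _]/(ee (lg a)) lgE.
- by apply/sE; rewrite -[cexp _]/(ee (lg b)) lgE.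
- ring.
Qed.

(** The product of the functions theta(v - c) over the representatives c of the
translates. *)
Lemma Sigma_zeros : exists g : C -> C, entire g /\ forall v, Sigma tau B v <-> g v = 0.
Proof.
have [s sE] := Sigma_finite.
exists (fun v => \prod_(c <- s) thf tau (v - c)); split.
  move=> v; apply: (@differentiable_bigprod _ _ _ _ _ (fun c v => thf tau (v - c))) => c.
  rewrite (_ : (fun v => _) = (fun v => thf tau (- c + v))); last first.
    by apply/funext => z; rewrite addrC.
  exact: (entire_shift (- c) (entire_thf tau_gt0) v).
move=> v; rewrite sE; split.
  move=> [c cs /(thf_eq0 tau_gt0) h]; apply/eqP; rewrite prodf_seq_eq0.
  by apply/hasP; exists c; rewrite // h eqxx.
move=> /eqP; rewrite prodf_seq_eq0 => /hasP[c cs /andP[_ /eqP h]].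
by exists c => //; apply/(thf_eq0 tau_gt0).
Qed.

End Sigma.

End Avoid.

(** * Analytic properties of the r-matrix *)

Section Analytic.
Context {R : realType} {n : nat}.
Local Notation C := (Cplx R).
Local Notation M := 'M[C]_n.
Variable tau : C.
Hypothesis tau_gt0 : 0 < complex.Im tau.
Variable B : M.
Hypothesis B_unit : B \in unitmx.
Local Notation L := (Lambda tau).
Local Notation Sg := (Sigma tau B).
Local Notation f := (thf tau).
Local Notation D := (dom_r tau B).

Lemma entire_comp_diff (V : normedModType C) (g : C -> C) (h : V -> C) p :
  entire g -> differentiable h p -> differentiable (fun q => g (h q)) p.
Proof. by move=> eg dh; exact: (differentiable_comp dh (eg _)). Qed.

Lemma diff_fst (p : C * C) : differentiable (fun q : C * C => q.1 : C) p.
Proof. by apply: (@linear_differentiable _ _ _ fst) => q; exact: cvg_fst. Qed.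

Lemma diff_snd (p : C * C) : differentiable (fun q : C * C => q.2 : C) p.
Proof. by apply: (@linear_differentiable _ _ _ snd) => q; exact: cvg_snd. Qed.

Lemma open_dom_r : open D.
Proof.
have [g [eg gE]] := Sigma_zeros tau_gt0 B_unit.
pose G (q : C * C) := g q.1 * f q.2.
have -> : D = [set q | G q != 0].
  apply/seteqP; split => [q [/= h1 h2]|q /=]; rewrite /G mulf_eq0 negb_or.
    by rewrite (thf_neq0 tau_gt0 h2) andbT; apply/eqP => /gE.
  move=> /andP[/eqP h1 /eqP h2]; split => /=; first by move=> /gE.
  by move=> /(thf_eq0 tau_gt0).
have cG : continuous G.
  move=> q; apply: differentiable_continuous.
  apply: (@differentiableM _ _ (fun q : C * C => g q.1) (fun q : C * C => f q.2)).
    exact: (entire_comp_diff eg (diff_fst q)).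
  exact: (entire_comp_diff (entire_thf tau_gt0) (diff_snd q)).
apply: (@open_comp _ _ G [set x | x != 0]) => [q _|]; first exact: cG.
rewrite openE => x /= x0; apply/nearC; exists (nrm x); first by rewrite nrm_gt0.
by move=> y h; apply: contraTneq h => ->; rewrite sub0r nrmN ltxx.
Qed.

(** Near any point of C * C there are points of the domain at which moreover y + v is
not in Sigma; this gives the density of the domain and of the points of bijectivity
at once. *)
Lemma avoid_pair (p : C * C) (A : set (C * C)) : nbhs p A ->
  exists q, [/\ A q, D q & ~ Sg (q.2 + q.1)].
Proof.
move=> [[A1 A2] /= [/nearC[e1 e10 H1] /nearC[e2 e20 H2]] A12].
have [s sE] := Sigma_finite tau B_unit.
have [v [v1 vs]] := Lambda_avoid_near tau_gt0 s p.1 e10.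
(* The representative 0 keeps y off the lattice, the others keep y + v off
   Sigma. *)
have [y [y1 ys]] := Lambda_avoid_near tau_gt0 (0 :: [seq c - v | c <- s]) p.2 e20.
exists (v, y); split => /=.
- by apply: A12; split => /=; [apply: H1|apply: H2].
- split => /=; first by move=> /sE[c /vs].
  by have := ys 0 (mem_head _ _); rewrite subr0.
- move=> /sE[c cs]; have cs' : c - v \in 0 :: [seq c - v | c <- s].
    by rewrite in_cons (map_f (fun c => c - v) cs) orbT.
  by have := ys _ cs'; rewrite opprB addrA.
Qed.

Lemma dense_dom_r : dense D.
Proof.
move=> O [p Op] oO; have [|q [Oq Dq _]] := @avoid_pair p O; first exact: open_nbhs_nbhs.
by exists q.
Qed.

(** The matrix of F(w) acting on row vectors, so that its determinant and adjugate
are available. *)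
Definition Fmx (w : C) : 'M[C]_(n * n) := lin_mx (Fop tau B w).

Lemma mul_Fmx w X : mxvec X *m Fmx w = mxvec (Fop tau B w X).
Proof.
pose F : {linear M -> M} := HB.pack (Fop tau B w)
  (GRing.isLinear.Build _ _ _ _ (Fop tau B w) (Fop_lin tau_gt0 B w)).
exact: (mul_vec_lin F X).
Qed.

Lemma entire_Fmx p q : entire (fun w => Fmx w p q).
Proof.
case/mxvec_indexP: q => i j.
rewrite (_ : (fun w => _) = (fun w => Fop tau B w (vec_mx (delta_mx 0 p)) i j)); last first.
  by apply/funext => w; rewrite /Fmx /lin_mx /lin1_mx mxE /= mxvecE.
rewrite (_ : (fun w => _) = (fun w => laurent (fun m => thc tau m * adpow B (invmx B) m (vec_mx (delta_mx 0 p)) i j) w)); last first.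
  by apply/funext => w; exact: Fop_entry.
apply: entire_laurent; exact: rapid_coef.
Qed.

Lemma entire_det : entire (fun w => \det (Fmx w)).
Proof. by move=> w; apply: differentiable_det => i j; exact: entire_Fmx. Qed.

Lemma det_Fmx_neq0 w : ~ Sg w -> \det (Fmx w) != 0.
Proof.
move=> wS; rewrite -unitfE -[_ \is a _]/(Fmx w \in unitmx) -row_free_unit.
apply: inj_row_free => x; rewrite -[x]vec_mxK mul_Fmx => h.
have := congr1 vec_mx h; rewrite mxvecK linear0 => /(Fop_inj tau_gt0 B_unit wS) ->.
by rewrite linear0.
Qed.

(** det F(v) times F(y + v) F(v)^-1, with the inverse replaced by the adjugate: it is
entire in (v, y). *)
Definition r_numop (q : C * C) (Z : M) : M :=
  vec_mx (mxvec Z *m \adj (Fmx q.1) *m Fmx (q.2 + q.1)).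

Lemma sol_numop v y Z : ~ Sg v ->
  sol tau B v Z y = (\det (Fmx v))^-1 *: r_numop (v, y) Z.
Proof.
move=> vS; have [a <-] := Fop_surj tau_gt0 B_unit vS Z.
rewrite (sol_Fop tau_gt0 B_unit vS) /r_numop /= -mul_Fmx -(mulmxA (mxvec a)) mul_mx_adj.
rewrite mul_mx_scalar -scalemxAl mul_Fmx linearZ /= mxvecK scalerA mulVf ?scale1r//.
exact: det_Fmx_neq0.
Qed.

Lemma diff_r_numop (q : C * C) Z i j : differentiable (fun q => r_numop q Z i j : C) q.
Proof.
rewrite (_ : (fun q => _) = (fun q => (mxvec Z *m \adj (Fmx q.1) *m Fmx (q.2 + q.1)) 0 (mxvec_index i j))); last first.
  by apply/funext => x; rewrite /r_numop mxE.
have dF1 i' j' : differentiable (fun q : C * C => Fmx q.1 i' j' : C) q.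
  exact: (entire_comp_diff (entire_Fmx i' j') (diff_fst q)).
have dF2 i' j' : differentiable (fun q : C * C => Fmx (q.2 + q.1) i' j' : C) q.
  apply: (entire_comp_diff (entire_Fmx i' j')).
  exact: (differentiableD (diff_snd q) (diff_fst q)).
apply: (@differentiable_mulmx _ _ _ _ _ _ (fun q : C * C => mxvec Z *m \adj (Fmx q.1)) (fun q : C * C => Fmx (q.2 + q.1))) => // i' j'.
apply: (@differentiable_mulmx _ _ _ _ _ _ (fun q : C * C => mxvec Z) (fun q : C * C => \adj (Fmx q.1))).
  by move=> ? ?; exact: differentiable_cst.
by move=> ? ?; exact: (differentiable_adj _ _ dF1).
Qed.

Definition r_den (q : C * C) : C := f q.2 * \det (Fmx q.1).

Lemma diff_r_den q : differentiable r_den q.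
Proof.
apply: (@differentiableM _ _ (fun q : C * C => f q.2) (fun q : C * C => \det (Fmx q.1))).
  exact: (entire_comp_diff (entire_thf tau_gt0) (diff_snd q)).
exact: (entire_comp_diff entire_det (diff_fst q)).
Qed.

Lemma r_den_neq0 q : D q -> r_den q != 0.
Proof.
case: q => v y [/= vS yL]; rewrite /r_den mulf_neq0//=.
  exact: (thf_neq0 tau_gt0).
exact: det_Fmx_neq0.
Qed.

Definition r_num (q : C * C) : 'M[C]_(n * n) := hom_tens (r_numop q).

Lemma hol_r_num : holomorphic setT r_num.
Proof.
split=> [|q _]; first exact: openT.
apply: diff_mxE => i j.
case: (mxtens_indexP i) => a b; case: (mxtens_indexP j) => c d.
rewrite (_ : (fun z => _) = (fun z => r_numop z (delta_mx c a) b d)); first exact: diff_r_numop.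
by apply/funext => z; rewrite /r_num hom_tensE.
Qed.

Lemma r_tens_frac q : D q -> r_tens tau B q.1 q.2 = (r_den q)^-1 *: r_num q.
Proof.
case: q => v y [/= vS yL]; apply/matrixP => i j.
case: (mxtens_indexP i) => a b; case: (mxtens_indexP j) => c d.
rewrite mxE /r_tens /r_num !hom_tensE r_tildeE (sol_numop y _ vS) /r_den /= !mxE invfM mulrA.
by [].
Qed.

Lemma r_tens_holomorphic : holomorphic D (fun p : C * C => r_tens tau B p.1 p.2).
Proof.
split=> [|p Dp]; first exact: open_dom_r.
apply: (@differentiable_near _ _ _ _ (fun q => (r_den q)^-1 *: r_num q)).
  have : nbhs p D by apply: open_nbhs_nbhs; split; [exact: open_dom_r|].
  by apply: filterS => q; exact: r_tens_frac.
apply: diff_mxE => i j.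
rewrite (_ : (fun z => _) = (fun z => (r_den z)^-1 * r_num z i j)); last first.
  by apply/funext => z; rewrite mxE.
apply: (@differentiableM _ _ (fun z => (r_den z)^-1) (fun z => r_num z i j)).
  apply: differentiableV; [exact: diff_r_den|exact: r_den_neq0].
exact: (diff_entry _ _ (hol_r_num.2 p I)).
Qed.

(** The quotient of r_num by r_den is the required one around every point, both being
entire and r_den being nonzero on the dense domain. *)
Lemma r_tens_meromorphic : meromorphic D (fun p : C * C => r_tens tau B p.1 p.2).
Proof.
split; [exact: dense_dom_r|exact: r_tens_holomorphic|move=> p].
exists setT, r_den, r_num; split.
- by [].
- by split=> [|q _]; [exact: openT|exact: diff_r_den].
- exact: hol_r_num.
- move=> q _ A /avoid_pair[x [Ax Dx _]]; exists x; split=> //; split=> //=.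
  exact: r_den_neq0.
- by move=> q _ Dq; rewrite r_tens_frac// scalerA mulfV ?scale1r// r_den_neq0.
Qed.

(** r~(v, y) is proportional to F(y + v) F(v)^-1, which is bijective unless
det F(y + v) vanishes. *)
Lemma r_tens_nondegenerate : tensor_nondegenerate D (r_tens tau B).
Proof.
exists (fun q => \det (Fmx (q.2 + q.1))); split.
- split=> [|p _]; first exact: open_dom_r.
  apply: (entire_comp_diff entire_det).
  exact: (differentiableD (diff_snd p) (diff_fst p)).
- move=> q _ A /avoid_pair[x [Ax Dx xS]]; exists x; split=> //; split=> //=.
  exact: det_Fmx_neq0.
- case=> v y [/= vS yL] det0; have linr := r_tilde_lin tau_gt0 B_unit vS y.
  have hE := hom_tensK linr; rewrite -/(r_tens tau B v y) in hE.
  have inj Z : r_tilde tau B v y Z = 0 -> Z = 0.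
    have [a <-] := Fop_surj tau_gt0 B_unit vS Z.
    rewrite r_tildeE (sol_Fop tau_gt0 B_unit vS) => /eqP.
    rewrite scaler_eq0 invr_eq0 (negbTE (thf_neq0 tau_gt0 yL)) /= => /eqP h.
    have h' : mxvec a *m Fmx (y + v) = 0 by rewrite mul_Fmx h linear0.
    have U : Fmx (y + v) \in unitmx by rewrite unitmxE unitfE.
    have -> : a = 0.
      by rewrite -[a]mxvecK -[mxvec a](mulmxK U) h' mul0mx linear0.
    exact: (lin0 (Fop_lin tau_gt0 B v)).
  have /choice[g gE] := lin_inj_surj linr inj.
  exists g => X; rewrite ?hE ?gE//.
  apply/eqP; rewrite -subr_eq0; apply/eqP/inj.
  have := linr (-1) X (g (r_tilde tau B v y X)).
  by rewrite !scaleN1r gE addNr [- X + _]addrC.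
Qed.

End Analytic.

(** * The theorem *)

Theorem theorem2p2 (R : realType) (n : nat) (n_ge1 : (1 <= n)%N)
    (tau : Cplx R) (tau_gt0 : 0 < complex.Im tau)
    (B : 'M[Cplx R]_n) (B_unit : B \in unitmx) :
  [/\ tensor_nondegenerate (dom_r tau B) (r_tens tau B),
      holomorphic (dom_r tau B) (fun p : Cplx R * Cplx R => r_tens tau B p.1 p.2),
      tensor_unitary (dom_r tau B) (r_tens tau B),
      AYBE_solution (dom_r tau B) (r_tens tau B) &
      meromorphic (dom_r tau B) (fun p : Cplx R * Cplx R => r_tens tau B p.1 p.2)]
  /\
  (forall S A : 'M[Cplx R]_n, S \in unitmx -> A = invmx S *m B *m S ->
    forall v y : Cplx R, dom_r tau B (v, y) ->
      r_tens tau A v y =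
        (invmx S *t invmx S) *m r_tens tau B v y *m (S *t S)).
Proof.
split; last exact: r_tens_similar.
split.
- exact: r_tens_nondegenerate.
- exact: r_tens_holomorphic.
- exact: r_tens_unitary.
- exact: r_tens_aybe.
- exact: r_tens_meromorphic.
Qed.
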